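(* Suppose that the heat kernel of $X$ satisfies, for some constants $C_1,C_2>0$, $$C_1\Big(\frac1{V(\phi^{-1}(t))}\wedge\frac t{V(d(x,y))\phi(d(x,y))}\Big)\le p(t,x,y)\le C_2\Big(\frac1{V(\phi^{-1}(t))}\wedge\frac t{V(d(x,y))\phi(d(x,y))}\Big)$$ for every $x\in M\setminus\mathscr N$, $\mu$-almost all $y\in M$ and all $t>0$, where $V,\phi:(0,\infty)\to(0,\infty)$ are strictly increasing and, for some constants $c_1,\dots,c_4>0$, $d_2\ge d_1>0$, $d_3,d_4>0$, $$c_1\Big(\frac Rr\Big)^{d_1}\le\frac{V(R)}{V(r)}\le c_2\Big(\frac Rr\Big)^{d_2},\qquad c_3\Big(\frac Rr\Big)^{d_3}\le\frac{\phi(R)}{\phi(r)}\le c_4\Big(\frac Rr\Big)^{d_4}\qquad(0<r<R<\infty).$$ Then there exists a constant $c\in(0,\infty)$ such that for all $x\in M$, $\mathbf P^x$-a.s., $$\liminf_{t\to\infty}\frac{\sup_{0<s\le t}d(X_s,x)}{\phi^{-1}(t/\log\log t)}=c.$$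
   Context: $(M,d)$ is a locally compact, separable, connected metric space in which every ball $B(x,r)=\{y:d(x,y)<r\}$ is relatively compact, and $\mu$ is a Radon measure on $M$ with full support such that $C_*^{-1}V(r)\le\mu(B(x,r))\le C_*V(r)$ for all $x\in M$, $r>0$, where $C_*\ge1$ and $V$ is strictly increasing with $V(0)=0$, $V(\infty)=\infty$. $\phi^{-1}$ is the inverse function of $\phi$; $a\wedge b=\min\{a,b\}$. $(\mathscr E,\mathscr F)$ is a symmetric regular Dirichlet form on $L^2(M,\mu)$ of pure-jump type: there is a symmetric Radon measure $n(\cdot,\cdot)$ on $M\times M\setminus\mathrm{diag}$ with $\mathscr E(u,v)=\int_{M\times M\setminus \mathrm{diag}}(u(x)-u(y))(v(x)-v(y))\,n(dx,dy)$ for $u,v\in\mathscr F\cap C_c(M)$. $X=(X_t,t\ge0;\mathbf P^x;\mathscr F_t)$ is the associated Hunt process, uniquely determined for starting points outside a properly exceptional set $\mathscr N\subset M$, with semigroup $(P_t)$. A heat kernel is a non-negative symmetric measurable function $p$ on $(0,\infty)\times M\times M$ with $P_tf(x)=\int p(t,x,z)f(z)\,\mu(dz)$ and $p(t+s,x,y)=\int p(t,x,z)p(s,z,y)\,\mu(dz)$ for all $s,t>0$, $x\in M\setminus\mathscr N$ and $\mu$-a.a. $y$. Under the hypotheses of the statement $p$ has a jointly continuous version and the exceptional set $\mathscr N$ is taken to be empty, so $X$ can be started from every $x\in M$. *)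

(* Defs.v *)
From HB Require Import structures.
From mathcomp Require Import all_boot all_order all_algebra.
From mathcomp Require Import all_classical all_reals all_analysis measurable_realfun.
Import Order.TTheory GRing.Theory Num.Theory numFieldNormedType.Exports.

Set Implicit Arguments.
Unset Strict Implicit.
Unset Printing Implicit Defensive.

Local Open Scope classical_set_scope.
Local Open Scope ring_scope.

(* A base point is needed because measurableType structures are pointed. *)
#[short(type="pmetricType")]
HB.structure Definition PointedMetric (K : numDomainType) :=
  {M of Metric K M & Pointed M}.

Notation borel T := (g_sigma_algebraType (@open T)).

Notation opc := one_point_compactification.

Section spaces.
Context {R : realType}.

Definition separable (T : topologicalType) :=
  exists2 D : set T, countable D & dense D.

(* Radon measure on the open subspace [U] of [T].  On a sigma-compact [U],
   which is the only case used here, inner regularity holds on all Borel sets. *)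
Definition radon_on (T : topologicalType) (msb : set (set T))
    (m : set T -> \bar R) (U : set T) :=
  (forall K, compact K -> K `<=` U -> (m K < +oo)%E) /\
  (forall A, msb A -> A `<=` U ->
     m A = ereal_sup [set m K | K in [set K | compact K /\ K `<=` A]]).

Definition full_support (T : topologicalType) (m : set T -> \bar R) :=
  forall U : set T, open U -> U !=set0 -> (0 < m U)%E.

Definition Cc (T : topologicalType) : set (T -> R) :=
  [set u | continuous u /\ compact (closure [set x | u x != 0])].

Definition offdiag (T : Type) : set (T * T) := [set z | z.1 <> z.2].

End spaces.

Section scale_functions.
Context {R : realType}.
Implicit Types f V phi : R -> R.

Definition pos_increasing f :=
  (forall r : R, 0 < r -> 0 < f r) /\ (forall r s : R, 0 < r -> r < s -> f r < f s).

Definition scaling f (a1 a2 e1 e2 : R) :=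
  forall r s : R, 0 < r -> r < s ->
    a1 * (s / r) `^ e1 <= f s / f r <= a2 * (s / r) `^ e2.

(* The inverse of [phi] on (0,oo).  As [phi] is strictly increasing, the choice
   of <= or < is immaterial, and [ginv phi] is the usual inverse on the range of
   [phi]; this formula extends it across possible jumps of [phi]. *)
Definition ginv phi (t : R) : R := inf [set r | 0 < r /\ t <= phi r].

(* At r = 0 the second term of the minimum is t / 0 = oo, whereas division by
   zero gives 0 in the library. *)
Definition hk_profile V phi (t r : R) : R :=
  if r == 0 then (V (ginv phi t))^-1
  else Num.min (V (ginv phi t))^-1 (t / (V r * phi r)).

End scale_functions.

Section dirichlet_forms.
Context {R : realType} {M : pmetricType R}.
Variable mu : {measure set (borel M) -> \bar R}.

Definition L2 : set (M -> R) := [set u | u \in Lfun mu 2%:E].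

Definition ip2 (u v : M -> R) : R := \int[mu]_x (u x * v x).

Definition form1 (E : (M -> R) -> (M -> R) -> R) (u : M -> R) : R :=
  E u u + ip2 u u.

(* [F] is the domain of the form [E]; it consists of Borel functions, and [F]
   and [E] do not distinguish functions that are equal almost everywhere. *)
Record dirichlet_form (F : set (M -> R)) (E : (M -> R) -> (M -> R) -> R) :
    Prop := {
  df_L2 : F `<=` L2 ;
  df_ae : forall u v, F u -> L2 v -> {ae mu, forall x, u x = v x} ->
    F v /\ forall w, F w -> E u w = E v w ;
  df_zero : F (fun=> 0) ;
  df_lin : forall (a : R) u v, F u -> F v -> F (fun x => a * u x + v x) ;
  df_dense : forall u (e : R), L2 u -> 0 < e ->
    exists2 v, F v & ip2 (u \- v) (u \- v) < e ;
  df_bilin : forall (a : R) u v w, F u -> F v -> F w ->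
    E (fun x => a * u x + v x) w = a * E u w + E v w ;
  df_sym : forall u v, F u -> F v -> E u v = E v u ;
  df_ge0 : forall u, F u -> 0 <= E u u ;
  df_closed : forall u_ : nat -> M -> R, (forall n, F (u_ n)) ->
    (forall e : R, 0 < e -> exists N : nat, forall m n : nat,
       (N <= m)%N -> (N <= n)%N -> form1 E (u_ m \- u_ n) < e) ->
    exists2 u, F u & form1 E (u_ n \- u) @[n --> \oo] --> (0 : R) ;
  df_markov : forall u, F u ->
    let v := fun x => Num.min (Num.max (u x) 0) 1 in F v /\ E v v <= E u u
}.

Definition regular_form (F : set (M -> R)) (E : (M -> R) -> (M -> R) -> R) :=
  (forall u (e : R), F u -> 0 < e ->
     exists2 v, (F `&` Cc (T:=M)) v & form1 E (u \- v) < e) /\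
  (forall f (e : R), Cc f -> 0 < e ->
     exists2 v, (F `&` Cc (T:=M)) v & forall x, `|f x - v x| < e).

(* A measure on M x M \ diag is represented by a measure on M x M of which only
   the values on subsets of the complement of the diagonal are used. *)
Definition pure_jump (F : set (M -> R)) (E : (M -> R) -> (M -> R) -> R) :=
  exists n : {measure set (borel M * borel M) -> \bar R},
  [/\ @radon_on R (M * M)%type
        (measurable : set (set (borel M * borel M))) n (@offdiag M),
      forall A : set (borel M * borel M), measurable A -> A `<=` @offdiag M ->
        n [set z | A (z.2, z.1)] = n A
    & forall u v, (F `&` Cc (T:=M)) u -> (F `&` Cc (T:=M)) v ->
        (E u v)%:E = (\int[n]_(z in @offdiag M)
                       ((u z.1 - u z.2) * (v z.1 - v z.2))%:E)%E].

End dirichlet_forms.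

Section hunt_processes.
Context {R : realType} {M : pmetricType R}.
Context {d : measure_display} {Omega : measurableType d}.

Definition stopping_time (Ft : R -> set (set Omega)) (sigma : Omega -> \bar R) :=
  (forall w, (0 <= sigma w)%E) /\
  (forall t : R, 0 <= t -> Ft t [set w | (sigma w <= t%:E)%E]).

Definition stopped_sigma_algebra (Ft : R -> set (set Omega))
    (sigma : Omega -> \bar R) : set (set Omega) :=
  [set L | measurable L /\
     forall t : R, 0 <= t -> Ft t (L `&` [set w | (sigma w <= t%:E)%E])].

(* The state space is the one-point compactification of [M]; its point at
   infinity [None] is the cemetery. *)
Record hunt_process := HuntProcess {
  hX : R -> Omega -> opc M ;
  hP : opc M -> probability Omega R ;
  hF : R -> set (set Omega) ;
  hF_sigma : forall t : R, 0 <= t -> sigma_algebra setT (hF t) ;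
  hF_sub : forall t : R, 0 <= t -> hF t `<=` measurable ;
  hF_mono : forall s t : R, 0 <= s -> s <= t -> hF s `<=` hF t ;
  hF_rcont : forall t : R, 0 <= t -> \bigcap_(s in [set s | t < s]) hF s `<=` hF t ;
  hX_adapted : forall (t : R) (A : set (borel (opc M))), 0 <= t -> measurable A ->
    hF t (hX t @^-1` A) ;
  hP_meas : forall (t : R) (A : set (borel (opc M))), 0 <= t -> measurable A ->
    measurable_fun setT
      ((fun x => hP x (hX t @^-1` A)) : borel (opc M) -> \bar R) ;
  hP_start : forall x, hP x [set w | hX 0 w = x] = 1%E ;
  hX_cemetery : forall (s t : R) w, 0 <= s -> s <= t ->
    hX s w = None -> hX t w = None ;
  hX_rcont : forall (t : R) w, 0 <= t -> hX s w @[s --> t^'+] --> hX t w ;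
  hX_llim : forall (t : R) w, 0 < t -> exists l : opc M, hX s w @[s --> t^'-] --> l ;
  hX_shift : forall t : R, 0 <= t -> exists theta : Omega -> Omega,
    forall (s : R) w, 0 <= s -> hX s (theta w) = hX (s + t) w ;
  hX_strong_markov : forall x sigma (s : R) L (A : set (borel (opc M))),
    stopping_time hF sigma -> 0 <= s -> stopped_sigma_algebra hF sigma L ->
    measurable A ->
    hP x (L `&` [set w | (sigma w < +oo)%E /\ A (hX (fine (sigma w) + s) w)]) =
    (\int[hP x]_(w in L `&` [set w | (sigma w < +oo)%E])
        hP (hX (fine (sigma w)) w) (hX s @^-1` A))%E ;
  hX_quasi_left : forall x (sigma_ : nat -> Omega -> \bar R) sigma,
    (forall n, stopping_time hF (sigma_ n)) ->
    (forall n w, (sigma_ n w <= sigma_ n.+1 w)%E) ->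
    (forall w, sigma w = ereal_sup (range (fun n => sigma_ n w))) ->
    {ae hP x, forall w, (sigma w < +oo)%E ->
       hX (fine (sigma_ n w)) w @[n --> \oo] --> hX (fine (sigma w)) w}
}.

Variables (mu : {measure set (borel M) -> \bar R}) (X : hunt_process).

Definition at_cemetery0 (f : M -> R) (z : opc M) : R :=
  if z is Some y then f y else 0.

(* P_t f (x) = E^x [f (X_t)] *)
Definition semigroup (t : R) (f : M -> R) (x : M) : \bar R :=
  (\int[hP X (Some x)]_w (at_cemetery0 f (hX X t w))%:E)%E.

Definition approx_form (t : R) (u v : M -> R) : R :=
  t^-1 * ip2 mu (fun x => u x - fine (semigroup t u x)) v.

(* (E, F) is the form of the symmetric semigroup P_t:
   F = {u in L2 : lim_(t -> 0+) (u - P_t u, u) / t exists and is finite},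
   E(u, v) = lim_(t -> 0+) (u - P_t u, v) / t. *)
Definition associated (F : set (M -> R)) (E : (M -> R) -> (M -> R) -> R) :=
  [/\ forall (t : R) (f g : borel M -> R), 0 < t ->
        measurable_fun setT f -> measurable_fun setT g ->
        (forall x, 0 <= f x) -> (forall x, 0 <= g x) ->
        (\int[mu]_x (semigroup t f x * (g x)%:E) =
         \int[mu]_x ((f x)%:E * semigroup t g x))%E,
      forall u, F u <-> L2 mu u /\ cvg (approx_form t u u @[t --> 0^'+])
    & forall u v, F u -> F v -> approx_form t u v @[t --> 0^'+] --> E u v].

(* The exceptional set is empty: the identities hold for every x. *)
Record heat_kernel (p : R -> M -> M -> R) : Prop := {
  hk_ge0 : forall (t : R) x y, 0 < t -> 0 <= p t x y ;
  hk_sym : forall (t : R) x y, 0 < t -> p t x y = p t y x ;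
  hk_meas : measurable_fun ([set t : R | 0 < t] `*` setT)
    (fun z : R * (borel M * borel M) => p z.1 z.2.1 z.2.2) ;
  hk_semigroup : forall (t : R) x (f : borel M -> R), 0 < t ->
    measurable_fun setT f -> (forall z, 0 <= f z) ->
    semigroup t f x = (\int[mu]_z (p t x z * f z)%:E)%E ;
  hk_chapman : forall (s t : R) x, 0 < s -> 0 < t ->
    {ae mu, forall y,
       (p (t + s) x y)%:E = (\int[mu]_z (p t x z * p s z y)%:E)%E}
}.

(* d(z, x), with the convention that the cemetery is infinitely far away. *)
Definition edist (x : M) (z : opc M) : \bar R :=
  if z is Some y then (mdist y x)%:E else +oo%E.

Definition running_max (x : M) (t : R) (w : Omega) : \bar R :=
  ereal_sup [set edist x (hX X s w) | s in [set s | 0 < s /\ s <= t]].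

End hunt_processes.

Arguments hunt_process {R} M {d} Omega.

(* Main.v *)
Require Import Defs.
From HB Require Import structures.
From mathcomp Require Import all_boot all_order all_algebra.
From mathcomp Require Import all_classical all_reals all_analysis measurable_realfun.
From mathcomp Require Import ring lra.
Import Order.TTheory GRing.Theory Num.Theory numFieldNormedType.Exports.

Set Implicit Arguments.
Unset Strict Implicit.
Unset Printing Implicit Defensive.

Local Open Scope classical_set_scope.
Local Open Scope ring_scope.

(* Write [M_t] for the running maximum of the distance to the starting point, and
   [rho t = phi^-1 (t / ln ln t)].  The heat kernel bounds give three estimates:
   [P (M_t > r) <= C t / phi r]; [P (M_t <= r)] decays geometrically in
   [t / phi r]; and, conversely, staying within [5 r] during a time
   [n e phi r] has probability at least [k ^ n].  The process is conservative,
   because a pure-jump form has no killing part.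

   The event "[M_q <= b rho q] for arbitrarily large [q]" is, up to null sets,
   invariant under time shifts, and the heat kernels of any two points overlap
   by a fixed proportion at comparable times.  So its probability contracts to
   a constant in the starting point and is 0 or 1.  It increases with [b]; the
   geometric decay, summed over [t = 2 ^ k], shows that the probability is not 1
   for small [b], while about [k ^ -n] trials at separated scales, each lasting
   about [n] steps, show that it is not 0 for large [b].  The critical value of
   [b] is the constant of the theorem. *)

(** The kernel bounds hold only up to constants, so the limit cannot be computed. Since the zero-one
    law turns a probability below 1 into 0 and a positive one into 1, bounds by 1/2 at one small and
    one large level suffice, and no independence of trials is needed.

    The event is centred at the fixed [point] of [M], not at the starting point: only then is it the
    same event for all starting points and stable under shifts. The distance between the two centres
    is absorbed by an arbitrarily small change of level, as the rate tends to infinity.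

    The kernel speaks of single times, the theorem of suprema. A path that has gone far is still far
    at the end of the time interval with probability bounded below, which turns a bound at one time
    into a bound for the supremum. As long as the process may die, that probability is only half of
    a survival constant; this weak form is enough to prove conservativeness.

    [phi] may jump, so [phi (ginv phi t)] is only comparable with [t]; every argument tolerates this
    factor. *)

Definition weak_scaling {R : realType} (f : R -> R) :=
  pos_increasing f /\ exists a1 a2 e1 e2,
    [/\ 0 < a1, 0 < a2, 0 < e1 & scaling f a1 a2 e1 e2].

(** * Scale functions: doubling, reverse doubling and the generalized inverse *)

Section scale.
Context {R : realType}.
Variable f : R -> R.
Hypothesis fS : weak_scaling f.

Lemma scale_gt0 r : 0 < r -> 0 < f r. Proof. exact: fS.1.1. Qed.

Lemma scale_lt r s : 0 < r -> r < s -> f r < f s. Proof. exact: fS.1.2. Qed.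

Lemma scale_le r s : 0 < r -> r <= s -> f r <= f s.
Proof. by move=> r0; rewrite le_eqVlt => /predU1P[->//|/(scale_lt r0)/ltW]. Qed.

Lemma scale_bound l : 0 < l -> exists2 K, 0 < K & forall r, 0 < r -> f (l * r) <= K * f r.
Proof.
have [_ [a1 [a2 [e1 [e2 [a1_gt0 a2_gt0 e1_gt0 f_scal]]]]]] := fS.
move=> l0; have [l1|l1] := leP l 1.
  exists 1 => // r r0; rewrite mul1r scale_le ?mulr_gt0//.
  by rewrite ler_piMl// ltW.
exists (a2 * l `^ e2); first by rewrite mulr_gt0// powR_gt0.
move=> r r0; have rl : r < l * r by rewrite ltr_pMl.
have /andP[_] := f_scal _ _ r0 rl; rewrite ler_pdivrMr ?scale_gt0//.
by rewrite mulfK// gt_eqF.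
Qed.

(** Reverse doubling. The lower exponent is positive, so a fixed enlargement of the radius beats any
    prescribed constant. This is how constants from the kernel bounds are absorbed later. *)
Lemma scale_grow N : exists2 l, 1 < l & forall r, 0 < r -> N * f r <= f (l * r).
Proof.
have [_ [a1 [a2 [e1 [e2 [a1_gt0 a2_gt0 e1_gt0 f_scal]]]]]] := fS.
pose l := Num.max 2 ((`|N| / a1) `^ e1^-1).
have l1 : 1 < l by rewrite /l lt_max ltr1n.
exists l => // r r0; have rl : r < l * r by rewrite ltr_pMl.
have /andP[+ _] := f_scal _ _ r0 rl; rewrite ler_pdivlMr ?scale_gt0//.
apply: le_trans; rewrite (ler_wpM2r (ltW (scale_gt0 r0)))//.
rewrite mulfK ?gt_eqF// (le_trans (ler_norm N))//.
rewrite -ler_pdivrMl// mulrC.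
have Na : 0 <= `|N| / a1 by rewrite divr_ge0// ltW.
rewrite -[leLHS](powRr1 Na) -(@mulVf _ e1) ?gt_eqF//
  powRrM ge0_ler_powR// ?nnegrE ?powR_ge0 ?(ltW e1_gt0)//.
  by rewrite ltW// (lt_trans _ l1).
by rewrite /l le_max lexx orbT.
Qed.

Lemma scale_geo : exists2 b, 1 < b & exists2 a, 0 < a &
  forall (k : nat) r, 0 < r -> a * b ^+ k * f r <= f (2 ^+ k * r).
Proof.
have [_ [a1 [a2 [e1 [e2 [a1_gt0 a2_gt0 e1_gt0 f_scal]]]]]] := fS.
exists (2 `^ e1).
  have := @gt0_ltr_powR _ e1 e1_gt0 1 2; rewrite powR1; apply.
  - by rewrite nnegrE.
  - by rewrite nnegrE.
  - by rewrite ltr1n.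
(* [scaling] compares distinct radii only, so [k = 0] is a separate case, and it forces the cap at
   1. *)
exists (Num.min a1 1) => [|[|k] r r0]; first by rewrite lt_min a1_gt0/=.
  by rewrite !expr0 mulr1 mul1r ler_piMl ?(ltW (scale_gt0 r0))// ge_min lexx orbT.
have k1 : 1 < 2 ^+ k.+1 :> R by rewrite exprn_egt1// ltr1n.
have rl : r < 2 ^+ k.+1 * r by rewrite ltr_pMl.
have /andP[+ _] := f_scal _ _ r0 rl; rewrite ler_pdivlMr ?scale_gt0//.
apply: le_trans; rewrite (ler_wpM2r (ltW (scale_gt0 r0)))//.
rewrite mulfK ?gt_eqF// -powR_mulrn ?powR_ge0// -powRrM (mulrC e1) powRrM powR_mulrn ?ler0n//.
apply: ler_wpM2r; first by rewrite ?exprn_ge0 ?powR_ge0.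
by rewrite ge_min lexx.
Qed.

Lemma scale_unbounded t : exists2 r, 0 < r & t <= f r.
Proof.
have [l l1 lP] := scale_grow (t / f 1).
exists (l * 1); first by rewrite mulr1 (lt_trans _ l1).
have := lP 1 ltr01; rewrite divfK// gt_eqF// scale_gt0//.
Qed.

Lemma scale_small t : 0 < t -> exists2 r, 0 < r & f r < t.
Proof.
move=> t0; have [l l1 lP] := scale_grow (2 * f 1 / t).
have l0 : 0 < l by rewrite (lt_trans _ l1).
exists l^-1; first by rewrite invr_gt0.
have := lP l^-1; rewrite invr_gt0 mulfV ?gt_eqF// => /(_ l0).
rewrite mulrAC ler_pdivrMr// mulrC mulrA.
have f1 := scale_gt0 ltr01.
rewrite (mulrC (f 1)) ler_pM2r// => /(lt_le_trans _); apply.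
by rewrite mulr_natr mulr2n ltrDl scale_gt0// invr_gt0.
Qed.

Let ginv_has_inf t : has_inf [set r | 0 < r /\ t <= f r].
Proof.
split; first by have [r r0 tr] := scale_unbounded t; exists r.
by exists 0 => r [/ltW].
Qed.

Lemma ginv_le t r : 0 < r -> t <= f r -> ginv f t <= r.
Proof. by move=> r0 tr; apply: ge_inf; [case: (ginv_has_inf t)|split]. Qed.

Lemma lt_ginv t r : 0 < r -> r < ginv f t -> f r < t.
Proof. by move=> r0; apply: contraTT; rewrite -!leNgt; exact: ginv_le. Qed.

Lemma le_ginv t r : 0 < r -> f r < t -> r <= ginv f t.
Proof.
move=> r0 rt; apply: lb_le_inf; first by case: (ginv_has_inf t).
move=> s [s0 ts]; rewrite leNgt; apply/negP => sr.
by have := lt_le_trans (lt_trans (scale_lt s0 sr) rt) ts; rewrite ltxx.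
Qed.

Lemma ginv_gt0 t : 0 < t -> 0 < ginv f t.
Proof.
by move=> t0; have [r r0 rt] := scale_small t0; exact: lt_le_trans (le_ginv r0 rt).
Qed.

Lemma ginv_nd s t : 0 < s -> s <= t -> ginv f s <= ginv f t.
Proof.
move=> s0 st; rewrite leNgt; apply/negP => ts.
have t0 := lt_le_trans s0 st; have g0 := ginv_gt0 t0.
have [m /andP[gm ms]] : exists m, ginv f t < m < ginv f s.
  by exists ((ginv f t + ginv f s) / 2); rewrite !midf_lt.
have m0 := lt_trans g0 gm.
have := lt_ginv m0 ms => /lt_le_trans/(_ st)/(le_ginv m0).
by rewrite leNgt gm.
Qed.

(** Across a jump the inverse is not exact. Still, [f] is below [t] at half of [ginv f t] and at
    least [t] at twice [ginv f t]; doubling carries both bounds to [ginv f t] itself. *)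
Lemma scale_ginv : exists2 K, 0 < K & forall t, 0 < t ->
  f (ginv f t) <= K * t /\ t <= K * f (ginv f t).
Proof.
have [K K0 KP] := @scale_bound 2 (ltr0n _ 2).
exists K => // t t0; have g0 := ginv_gt0 t0; split.
  have h0 : 0 < ginv f t / 2 by rewrite divr_gt0.
  have := KP _ h0; rewrite mulrCA divff ?mulr1// => /le_trans; apply.
  rewrite ler_wpM2l ?ltW// lt_ginv// ltr_pdivrMr// mulr_natr mulr2n ltrDl//.
apply: le_trans (KP _ g0); rewrite leNgt; apply/negP => /le_ginv.
by rewrite mulr_gt0// => /(_ isT); rewrite leNgt mulr_natl mulr2n ltrDl g0.
Qed.

Lemma ginv_grow l : 0 < l -> exists2 A, 0 < A & forall r T, 0 < r -> A * f r <= T -> l * r <= ginv f T.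
Proof.
move=> l0; have [K K0 KP] := scale_bound l0.
exists (2 * K); first by rewrite mulr_gt0.
move=> r T r0 AT; apply: le_ginv; first by rewrite mulr_gt0.
apply: le_lt_trans (KP r r0) (lt_le_trans _ AT).
by rewrite -mulrA mulr_natl mulr2n ltrDl mulr_gt0// scale_gt0.
Qed.

Lemma ginv_cvg B : exists2 T, 0 < T & forall t, T < t -> B <= ginv f t.
Proof.
have B0 : 0 < `|B| + 1 by rewrite ltr_wpDl.
exists (f (`|B| + 1)); first exact: scale_gt0.
move=> t /(le_ginv B0); apply: le_trans.
by rewrite (le_trans (ler_norm _))// lerDl.
Qed.

End scale.

(** * Measurability in the one-point compactification *)

Section one_point.
Context {R : realType} {M : pmetricType R}.
Local Notation S := (borel (opc M)).

Lemma openS (A : set (opc M)) : open A -> measurable (A : set S).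
Proof. exact: sub_sigma_algebra. Qed.

Lemma openM (A : set M) : open A -> measurable (A : set (borel M)).
Proof. exact: sub_sigma_algebra. Qed.

Lemma measurable_image_some (A : set (borel M)) : measurable A -> measurable (Some @` A : set S).
Proof.
have oT : measurable (Some @` [set: M] : set S).
  by apply: openS; apply: one_point_compactification_open_some; exact: openT.
suff : measurable `<=` [set A : set (borel M) | measurable (Some @` A : set S)] by apply.
apply: smallest_sub; last first.
  by move=> B oB; apply: openS; exact: one_point_compactification_open_some.
split => /=.
- by rewrite image_set0; exact: measurable0.
- move=> B mB; rewrite [X in measurable X](_ : _ = (Some @` [set: M]) `\` (Some @` B)).
    exact: measurableD.
  apply/seteqP; split=> [_ [y [_ nBy] <-]|z [[y _ <-] nz]].
    by split; [exists y|case=> y' By' [yy']; apply: nBy; rewrite -yy'].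
  by exists y => //; split=> // By; apply: nz; exists y.
- by move=> F mF; rewrite image_bigcup; exact: bigcupT_measurable.
Qed.

Lemma measurable_alive : measurable (Some @` setT : set S).
Proof. exact: (measurable_image_some measurableT). Qed.

Lemma measurable_fun_some : measurable_fun setT (Some : borel M -> S).
Proof.
apply: (@measurability _ _ _ _ setT (Some : borel M -> S) (@open (opc M))) => //.
move=> _ [B oB <-]; rewrite setTI; apply: openM.
exact: (continuousP _).1 (@one_point_compactification_some_continuous M) _ oB.
Qed.

Lemma mdist_ballE (x y : M) (r : R) : ball x r y = (mdist x y < r) :> Prop.
Proof. by rewrite ballEmdist. Qed.

Lemma open_ball_metric (x : M) (r : R) : open (ball x r).
Proof.
rewrite openE => y; rewrite mdist_ballE => xy; apply/nbhs_ballP.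
exists (r - mdist x y) => /=; first by rewrite subr_gt0.
move=> z; rewrite !mdist_ballE ltrBrDl => h; apply: le_lt_trans h.
exact: metric_triangle.
Qed.

Lemma open_ball_image (x : M) r : open (Some @` ball x r : set (opc M)).
Proof. exact/one_point_compactification_open_some/open_ball_metric. Qed.

Lemma edist_some x (z : opc M) r : (Defs.edist x z <= r%:E)%E -> exists2 y, z = Some y & mdist y x <= r.
Proof. by case: z => [y|] /=; rewrite ?lee_fin; [exists y|rewrite leye_eq]. Qed.

Lemma measurable_point (x : opc M) : measurable ([set x] : set S).
Proof.
case: x => [x|]; last first.
  rewrite (_ : [set None] = ~` (Some @` [set: M])); first exact: measurableC measurable_alive.
  apply/seteqP; split=> [_ -> [y]//|[y|]//=].
  by case; exists y.
rewrite (_ : [set Some x] = \bigcap_n (Some @` ball x n.+1%:R^-1)).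
  by apply: bigcapT_measurable => n; apply: openS; exact: open_ball_image.
apply/seteqP; split=> [_ -> n _|z zn]; first by exists x => //; exact: ballxx.
have [y _ yz] := zn 0%N I; rewrite -yz /=; congr Some.
apply/esym/mdist_positivity/eqP; rewrite eq_le mdist_ge0 andbT.
apply/ler_addgt0Pl => e e0; rewrite addr0.
near \oo => n; have [y' + ] := zn n I; rewrite -yz => + [y'y]; rewrite y'y mdist_ballE.
move/ltW/le_trans; apply; near: n.
by near do apply/ltW; exact: near_infty_natSinv_lt (PosNum e0).
Unshelve. all: by end_near. Qed.

Hypothesis M_balls : forall (x : M) (r : R), precompact (ball x r).

Lemma closed_ball_le (x : M) r : closed [set y : M | mdist y x <= r].
Proof.
rewrite -[X in closed X]setCK; apply: open_closedC; rewrite openE => y /=.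
move/negP; rewrite -ltNge => ry; apply/nbhs_ballP.
exists (mdist y x - r) => /=; first by rewrite subr_gt0.
move=> z; rewrite mdist_ballE ltrBrDl => yz; apply/negP; rewrite -ltNge.
by rewrite -(ltrD2r (mdist y z)) (lt_le_trans yz)// addrC metric_triangle.
Qed.

(** At a point of [M] this is the triangle inequality. At the point at infinity it is the relative
    compactness of balls: the complement is a closed ball, hence closed and compact, and so avoids a
    neighbourhood of [None]. *)
Lemma open_far (x : M) r : open [set z : opc M | (r%:E < Defs.edist x z)%E].
Proof.
rewrite openE => -[y /=|_]; rewrite ?lte_fin.
  move=> ry; rewrite /interior /=; apply/nbhs_ballP; exists (mdist y x - r) => /=.
    by rewrite subr_gt0.
  move=> z; rewrite mdist_ballE ltrBrDl /= lte_fin => yz.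
  by rewrite -(ltrD2r (mdist y z)) (lt_le_trans yz)// addrC metric_triangle.
exists [set y : M | mdist y x <= r].
  split; last exact: closed_ball_le.
  apply: (@subclosed_compact _ _ (closure (ball x (r + 1)))).
  - exact: closed_ball_le.
  - by rewrite -precompactE.
  - move=> y /= yr; apply: subset_closure; rewrite mdist_ballE metric_sym.
    by rewrite (le_lt_trans yr)// ltrDl.
move=> z [[y /= /negP yr <-]|-> /=]; last by rewrite ltry.
by rewrite /= lte_fin ltNge.
Qed.

Lemma measurable_near (x : M) r : measurable ([set z | (Defs.edist x z <= r%:E)%E] : set S).
Proof.
rewrite (_ : [set z | _] = ~` [set z | (r%:E < Defs.edist x z)%E]).
  by apply: measurableC; apply: openS; exact: open_far.
by apply/seteqP; split=> z /=; rewrite leNgt => /negP.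
Qed.

End one_point.

(** * Markov property and first passage *)

Section first_entrance.
Context d (T : measurableType d) (R : realType).
Variables (m1 m2 : {measure set T -> \bar R}).

(** The union is split according to the first index at which [H] occurs. When [H j] concerns the
    path at the [j]-th grid time, each piece is known at that time, so the Markov property can
    compare two measures piece by piece. *)
Lemma first_entrance_le (H : nat -> set T) (L : set T) N :
  measurable L -> (forall j, measurable (H j)) ->
  (forall j, (j < N)%N -> (m1 (L `&` (H j `\` \big[setU/set0]_(i < j) H i)) <=
                   m2 (L `&` (H j `\` \big[setU/set0]_(i < j) H i)))%E) ->
  (m1 (L `&` \big[setU/set0]_(i < N) H i) <= m2 (L `&` \big[setU/set0]_(i < N) H i))%E.
Proof.
move=> mL mH; elim: N => [_|N IH hN].
  by rewrite big_ord0 setI0 !measure0.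
have mU : measurable (\big[setU/set0]_(i < N) H i) by exact: bigsetU_measurable.
have E : L `&` \big[setU/set0]_(i < N.+1) H i =
    (L `&` \big[setU/set0]_(i < N) H i) `|` (L `&` (H N `\` \big[setU/set0]_(i < N) H i)).
  by rewrite big_ord_recr/= -setIUr setUDr setDv setD0.
have dis : (L `&` \big[setU/set0]_(i < N) H i) `&`
    (L `&` (H N `\` \big[setU/set0]_(i < N) H i)) = set0.
  by apply/seteqP; split=> // w [[_ w1] [_ [_ /(_ w1)]]].
rewrite E !measureU//; last 4 first.
- exact: measurableI.
- by apply: measurableI => //; exact: measurableD.
- exact: measurableI.
- by apply: measurableI => //; exact: measurableD.
apply: leeD; last exact: hN.
by apply: IH => j jN; apply: hN; exact: ltnW.
Qed.

Lemma nondecreasing_bigcup_le (K : nat -> set T) : (forall n, measurable (K n)) ->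
  nondecreasing_seq K -> (forall n, (m1 (K n) <= m2 (K n))%E) ->
  (m1 (\bigcup_n K n) <= m2 (\bigcup_n K n))%E.
Proof.
move=> mK ndK le12.
have c1 : m1 \o K @ \oo --> m1 (\bigcup_n K n) := nondecreasing_cvg_mu mK (bigcupT_measurable K mK) ndK.
have c2 : m2 \o K @ \oo --> m2 (\bigcup_n K n) := nondecreasing_cvg_mu mK (bigcupT_measurable K mK) ndK.
rewrite -(cvg_lim _ c1)// -(cvg_lim _ c2)//; apply: lee_lim.
- by apply/cvg_ex; eexists; exact: c1.
- by apply/cvg_ex; eexists; exact: c2.
- by apply: nearW => n /=; exact: le12.
Qed.

End first_entrance.

Section markov.
Context {R : realType} {M : pmetricType R} {d : measure_display}
  {Omega : measurableType d} (X : hunt_process M Omega).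
Local Notation S := (borel (opc M)).
Local Notation P := (hP X).

Lemma hF_C t A : 0 <= t -> hF X t A -> hF X t (~` A).
Proof. by move=> /(hF_sigma X)[_ h _] /h; rewrite setTD. Qed.

Lemma hF_bigcup t (A : nat -> set Omega) : 0 <= t -> (forall n, hF X t (A n)) -> hF X t (\bigcup_n A n).
Proof. by move=> /(hF_sigma X)[_ _]; exact. Qed.

Lemma hF_0 t : 0 <= t -> hF X t set0.
Proof. by move=> /(hF_sigma X)[]. Qed.

Lemma hF_T t : 0 <= t -> hF X t setT.
Proof. by move=> t0; rewrite -setC0; apply: hF_C => //; exact: hF_0. Qed.

Lemma hF_U t A B : 0 <= t -> hF X t A -> hF X t B -> hF X t (A `|` B).
Proof. by move=> t0 hA hB; rewrite -bigcup2E; apply: hF_bigcup => // -[|[|n]]//=; exact: hF_0. Qed.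

Lemma hF_I t A B : 0 <= t -> hF X t A -> hF X t B -> hF X t (A `&` B).
Proof. by move=> t0 hA hB; rewrite -(setCK (A `&` B)) setCI; apply/hF_C/hF_U => //; exact: hF_C. Qed.

Lemma hF_bigsetU t (A : nat -> set Omega) N : 0 <= t -> (forall n, (n < N)%N -> hF X t (A n)) ->
  hF X t (\big[setU/set0]_(i < N) A i).
Proof.
move=> t0 hA; elim: N hA => [|N IH] hA; first by rewrite big_ord0; exact: hF_0.
rewrite big_ord_recr/=; apply: hF_U => //; last exact: hA.
by apply: IH => n nN; apply: hA; exact: ltnW.
Qed.

Lemma hF_D t A B : 0 <= t -> hF X t A -> hF X t B -> hF X t (A `\` B).
Proof. by move=> t0 hA hB; rewrite setDE; apply: hF_I => //; exact: hF_C. Qed.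

Lemma hF_meas t A : 0 <= t -> hF X t A -> measurable A.
Proof. by move=> t0; exact: hF_sub. Qed.

Lemma hX_hF s t (A : set S) : 0 <= s -> s <= t -> measurable A -> hF X t (hX X s @^-1` A).
Proof. by move=> s0 st mA; apply: (hF_mono s0 st); exact: hX_adapted. Qed.

Lemma measurable_hX t : 0 <= t -> measurable_fun setT (hX X t : Omega -> S).
Proof. by move=> t0 _ A mA; rewrite setTI; apply: (hF_meas t0); exact: hX_adapted. Qed.

Lemma measurable_hXA t (A : set S) : 0 <= t -> measurable A -> measurable (hX X t @^-1` A).
Proof. by move=> t0 mA; apply: (hF_meas t0); exact: hX_adapted. Qed.

Lemma markov_at x t s L (A : set S) : 0 <= t -> 0 <= s -> hF X t L -> measurable A ->
  P x (L `&` hX X (t + s) @^-1` A) = (\int[P x]_(w in L) P (hX X t w) (hX X s @^-1` A))%E.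
Proof.
move=> t0 s0 hL mA.
have tconst (t' : R) : 0 <= t' -> hF X t' [set w : Omega | (t%:E <= t'%:E)%E].
  move=> t'0; have [tt'|tt'] := boolP (t%:E <= t'%:E)%E.
    by rewrite (_ : [set _ | _] = setT); [exact: hF_T|apply/seteqP; split].
  by rewrite (_ : [set _ | _] = set0); [exact: hF_0|apply/seteqP; split].
have st : stopping_time (hF X) (fun=> t%:E) by split=> // w; rewrite lee_fin.
have sL : stopped_sigma_algebra (hF X) (fun=> t%:E) L.
  split; first exact: hF_meas t0 hL.
  move=> t' t'0 /=; have [tt'|tt'] := boolP (t%:E <= t'%:E)%E.
    rewrite (_ : [set _ | _] = setT); last by apply/seteqP; split.
    by rewrite setIT; apply: hF_mono hL.
  by rewrite (_ : [set _ | _] = set0) ?setI0; [exact: hF_0|apply/seteqP; split].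
have := hX_strong_markov x st s0 sL mA => /=.
rewrite (_ : [set w | (t%:E < +oo)%E] = setT); last by apply/seteqP; split=> // w _; exact: ltry.
rewrite setIT => <-; congr (P x _); congr (_ `&` _).
by apply/seteqP; split => w /=; [move=> ?; split => //; exact: ltry|case].
Qed.

Lemma measurable_law s t (A : set S) : 0 <= s -> 0 <= t -> measurable A ->
  measurable_fun setT (fun w => P (hX X t w) (hX X s @^-1` A)).
Proof.
move=> s0 t0 mA.
exact: (measurableT_comp (f := (fun x => P x (hX X s @^-1` A)) : S -> \bar R) (hP_meas X s0 mA) (measurable_hX t0)).
Qed.

Lemma markov_lb x t s L (A : set S) (c : R) : 0 <= t -> 0 <= s -> hF X t L -> measurable A ->
  0 <= c -> (forall w, L w -> (c%:E <= P (hX X t w) (hX X s @^-1` A))%E) ->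
  (c%:E * P x L <= P x (L `&` hX X (t + s) @^-1` A))%E.
Proof.
move=> t0 s0 hL mA c0 cP; have mL := hF_meas t0 hL; rewrite markov_at// -integral_cst//.
apply: ge0_le_integral => //.
by apply: measurable_funTS; exact: measurable_law.
Qed.

Lemma markov_ub x t s L (A : set S) (c : R) : 0 <= t -> 0 <= s -> hF X t L -> measurable A ->
  0 <= c -> (forall w, L w -> (P (hX X t w) (hX X s @^-1` A) <= c%:E)%E) ->
  (P x (L `&` hX X (t + s) @^-1` A) <= c%:E * P x L)%E.
Proof.
move=> t0 s0 hL mA c0 cP; have mL := hF_meas t0 hL; rewrite markov_at// -integral_cst//.
apply: ge0_le_integral => //.
by apply: measurable_funTS; exact: measurable_law.
Qed.

Definition grid (t0 T : R) n j : R := t0 + T * (j%:R / 2 ^+ n).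

(** First passage without a stopping time: the event only records that [D] is visited. For open [D],
    right-continuity exhausts it by visits at dyadic times, and there the Markov property at
    deterministic times is enough. *)
Definition hit (t0 T : R) (D : set (opc M)) : set Omega :=
  [set w | exists2 s, t0 <= s <= t0 + T & D (hX X s w)].

Definition hit_grid t0 T n (D : set (opc M)) : set Omega :=
  \big[setU/set0]_(j < (2 ^ n).+1) (hX X (grid t0 T n j) @^-1` D).

Lemma grid_ge t0 T n j : 0 <= T -> t0 <= grid t0 T n j.
Proof. by move=> T0; rewrite lerDl mulr_ge0// divr_ge0// exprn_ge0. Qed.

Lemma grid_le t0 T n j : 0 <= T -> (j <= 2 ^ n)%N -> grid t0 T n j <= t0 + T.
Proof.
move=> T0 jn; rewrite lerD2l ler_piMr// ler_pdivrMr ?exprn_gt0// mul1r.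
by rewrite -natrX ler_nat.
Qed.

Lemma grid_last t0 T n : grid t0 T n (2 ^ n) = t0 + T.
Proof. by rewrite /grid natrX divff ?mulr1// expf_neq0. Qed.

Lemma hit_gridP t0 T n (D : set (opc M)) w :
  hit_grid t0 T n D w <-> exists2 j, (j <= 2 ^ n)%N & D (hX X (grid t0 T n j) w).
Proof.
rewrite /hit_grid -(bigcup_mkord _ (fun j => hX X (grid t0 T n j) @^-1` D)); split=> [[j /= jn Dj]|[j jn Dj]].
  by exists j.
by exists j.
Qed.

Lemma hit_grid_nd t0 T D : nondecreasing_seq (fun n => hit_grid t0 T n D).
Proof.
apply/nondecreasing_seqP => n; apply/subsetPset => w /hit_gridP[j jn Dj].
apply/hit_gridP; exists (2 * j)%N; first by rewrite expnS leq_mul2l jn orbT.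
rewrite (_ : grid t0 T n.+1 (2 * j) = grid t0 T n j)//.
by rewrite /grid exprS natrM -mulf_div divff// mul1r.
Qed.

Lemma grid_dense t0 T s e : 0 < T -> t0 <= s -> s < t0 + T -> 0 < e ->
  exists n j, (j <= 2 ^ n)%N /\ s < grid t0 T n j < s + e.
Proof.
move=> T0 ts sT e0; pose a := (s - t0) / T.
have a0 : 0 <= a by rewrite divr_ge0 ?subr_ge0// ltW.
have a1 : a < 1 by rewrite ltr_pdivrMr// mul1r ltrBlDl.
have [n nP] : exists n, (2 ^+ n)^-1 < e / T :> R.
  have eT : 0 < e / T by rewrite divr_gt0.
  have [n _ /(_ n (leqnn n))] := near_infty_natSinv_expn_lt (PosNum eT).
  by rewrite /= div1r => ?; exists n.
have n0 : 0 < 2 ^+ n :> R by rewrite exprn_gt0.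
have an0 : 0 <= a * 2 ^+ n by rewrite mulr_ge0// ltW.
(* The first dyadic point strictly to the right of [s]; paths are continuous from the right only, so
   the approximation must come from that side. *)
exists n, (Num.truncn (a * 2 ^+ n)).+1.
have /andP[h1 h2] := truncn_itv an0.
have sE : s = t0 + T * a by rewrite mulrC divfK ?gt_eqF// addrC subrK.
split.
  rewrite -(ltr_nat R) (le_lt_trans h1)// natrX gtr_pMl//.
apply/andP; split.
  by rewrite sE ltrD2l ltr_pM2l// ltr_pdivlMr.
rewrite sE -addrA ltrD2l -ltr_pdivlMl// mulrDr mulKf ?gt_eqF// (mulrC _ e).
rewrite ltr_pdivrMr// mulrDl.
rewrite -natr1 ler_ltD// -ltr_pdivrMr// mul1r//.
Qed.

Lemma hitE t0 T (D : set (opc M)) : 0 <= t0 -> 0 < T -> open D ->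
  hit t0 T D = \bigcup_n hit_grid t0 T n D.
Proof.
move=> t00 T0 oD; apply/seteqP; split=> w; last first.
  case=> n _ /hit_gridP[j jn Dj]; exists (grid t0 T n j) => //.
  by rewrite grid_ge ?grid_le// ltW.
(* The right end point has no later time in the interval to approximate it, but it is itself a point
   of every grid. *)
case=> s /andP[ts]; rewrite le_eqVlt => /predU1P[->|sT] Ds.
  exists 0%N => //; apply/hit_gridP; exists 1%N => //.
  by rewrite (_ : grid t0 T 0 1 = t0 + T)//; exact: (grid_last _ _ 0).
have s0 : 0 <= s by exact: le_trans ts.
have /(@hX_rcont _ _ _ _ X s w s0) : nbhs (hX X s w) D by exact: open_nbhs_nbhs.
move=> [e /= e0 eP].
have [n [j [jn /andP[h1 h2]]]] := grid_dense T0 ts sT e0.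
exists n => //; apply/hit_gridP; exists j => //.
apply: eP => //=; by rewrite ltr0_norm ?subr_lt0// opprB ltrBlDl.
Qed.

Lemma hF_hit_grid t0 T n (D : set S) : 0 <= t0 -> 0 <= T -> measurable D ->
  hF X (t0 + T) (hit_grid t0 T n D).
Proof.
move=> t00 T0 mD; apply: (@hF_bigsetU _ (fun j => hX X (grid t0 T n j) @^-1` D)); first exact: addr_ge0.
move=> j jn; apply: hX_hF => //; last exact: grid_le.
exact: le_trans (grid_ge _ _ _ T0).
Qed.

Lemma hF_hit t0 T (D : set S) : 0 <= t0 -> 0 < T -> open (D : set (opc M)) -> hF X (t0 + T) (hit t0 T D).
Proof.
move=> t00 T0 oD; rewrite hitE//; apply: hF_bigcup; first by rewrite addr_ge0// ltW.
by move=> n; apply: hF_hit_grid => //; [exact: ltW|exact: openS].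
Qed.

Section hit_estimates.
Variables (x : opc M) (t0 T : R) (L : set Omega) (D A : set S).
Hypotheses (t00 : 0 <= t0) (T0 : 0 < T) (hL : hF X t0 L) (oD : open (D : set (opc M))) (mA : measurable A).

Let mL : measurable L. Proof. exact: hF_meas hL. Qed.

Let mXA : measurable (hX X (t0 + T) @^-1` A).
Proof. by apply: measurable_hXA => //; rewrite addr_ge0// ltW. Qed.

Let mhit n : measurable (hit_grid t0 T n D).
Proof.
apply: (@hF_meas (t0 + T)); first by rewrite addr_ge0// ltW.
by apply: hF_hit_grid => //; [exact: ltW|exact: openS].
Qed.

Let hF_first n j : (j < (2 ^ n).+1)%N -> hF X (grid t0 T n j)
  (L `&` (hX X (grid t0 T n j) @^-1` D `\` \big[setU/set0]_(i < j) (hX X (grid t0 T n i) @^-1` D))).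
Proof.
have gn0 i : 0 <= grid t0 T n i by rewrite (le_trans t00)// grid_ge// ltW.
move=> jn; apply: hF_I => //.
  by apply: hF_mono hL => //; apply: grid_ge; exact: ltW.
apply: hF_D => //; first by apply: hX_hF => //; exact: openS.
apply: (@hF_bigsetU _ (fun j => hX X (grid t0 T n j) @^-1` D)) => // i ij; apply: hX_hF => //; last exact: openS.
by rewrite lerD2l ler_wpM2l ?(ltW T0)// ler_wpM2r ?invr_ge0 ?exprn_ge0// ler_nat ltnW.
Qed.

Let grid_split n j : t0 + T = grid t0 T n j + (t0 + T - grid t0 T n j).
Proof. by rewrite [RHS]addrC subrK. Qed.

Let grid_rest n j : (j < (2 ^ n).+1)%N -> 0 <= t0 + T - grid t0 T n j <= T.
Proof.
move=> jn; rewrite subr_ge0 grid_le ?(ltW T0)//=.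
by rewrite lerBlDr addrC lerD2l grid_ge// ltW.
Qed.

(** At the first dyadic visit to [D] the time that remains is some [s] in [[0, T]], which is why the
    hypothesis is uniform in [s]. The Markov property at that visit gives the factor [eta] on each
    piece of the first entrance decomposition, and the grids then increase to the whole event.
    Formally [m1] is the law scaled by [eta] and [m2] its restriction to the final event. *)
Lemma hit_lb (eta : R) : 0 <= eta ->
  (forall z s, D z -> 0 <= s <= T -> (eta%:E <= P z (hX X s @^-1` A))%E) ->
  (eta%:E * P x (L `&` hit t0 T D) <= P x (L `&` hit t0 T D `&` hX X (t0 + T) @^-1` A))%E.
Proof.
move=> eta0 hA; pose m1 := mscale (NngNum eta0) (P x); pose m2 := mrestr (P x) mXA.
rewrite hitE// setI_bigcupr.
suff : (m1 (\bigcup_n (L `&` hit_grid t0 T n D)) <= m2 (\bigcup_n (L `&` hit_grid t0 T n D)))%E by [].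
apply: nondecreasing_bigcup_le.
- by move=> n; exact: measurableI.
- by move=> m n mn; apply/subsetPset => w [Lw hw]; split => //; have /subsetPset/(_ w hw) := hit_grid_nd t0 T D mn.
move=> n; apply: (@first_entrance_le _ _ _ _ _ (fun j => hX X (grid t0 T n j) @^-1` D) _ _ mL) => [j|j jn].
  apply: measurable_hXA; last exact: openS.
  by rewrite (le_trans t00)// grid_ge// ltW.
have /andP[g1 g2] := grid_rest jn.
set L' := L `&` _; have hL' : hF X (grid t0 T n j) L' by exact: hF_first.
suff : (eta%:E * P x L' <= P x (L' `&` hX X (t0 + T) @^-1` A))%E by [].
rewrite [in leRHS](grid_split n j); apply: markov_lb => //.
  by rewrite (le_trans t00)// grid_ge// ltW.
by move=> w [_ [Dw _]]; apply: hA => //; rewrite g1.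
Qed.

Lemma hit_ub (beta : R) : 0 <= beta ->
  (forall z s, D z -> 0 <= s <= T -> (P z (hX X s @^-1` A) <= beta%:E)%E) ->
  (P x (L `&` hit t0 T D `&` hX X (t0 + T) @^-1` A) <= beta%:E * P x (L `&` hit t0 T D))%E.
Proof.
move=> beta0 hA; pose m1 := mscale (NngNum beta0) (P x); pose m2 := mrestr (P x) mXA.
rewrite hitE// setI_bigcupr.
suff : (m2 (\bigcup_n (L `&` hit_grid t0 T n D)) <= m1 (\bigcup_n (L `&` hit_grid t0 T n D)))%E by [].
apply: nondecreasing_bigcup_le.
- by move=> n; exact: measurableI.
- by move=> m n mn; apply/subsetPset => w [Lw hw]; split => //; have /subsetPset/(_ w hw) := hit_grid_nd t0 T D mn.
move=> n; apply: (@first_entrance_le _ _ _ _ _ (fun j => hX X (grid t0 T n j) @^-1` D) _ _ mL) => [j|j jn].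
  apply: measurable_hXA; last exact: openS.
  by rewrite (le_trans t00)// grid_ge// ltW.
have /andP[g1 g2] := grid_rest jn.
set L' := L `&` _; have hL' : hF X (grid t0 T n j) L' by exact: hF_first.
suff : (P x (L' `&` hX X (t0 + T) @^-1` A) <= beta%:E * P x L')%E by [].
rewrite [in leLHS](grid_split n j); apply: markov_ub => //.
  by rewrite (le_trans t00)// grid_ge// ltW.
by move=> w [_ [Dw _]]; apply: hA => //; rewrite g1.
Qed.

End hit_estimates.

End markov.

(** * The Markov property for functions and for events of the whole path *)

Section mixture.
Context d1 d2 (Y : measurableType d1) (Z : measurableType d2) (R : realType).
Variables (nu : {measure set Y -> \bar R}) (D : set Y) (mD : measurable D).
Variables (rho : {measure set Z -> \bar R}) (k : Y -> {measure set Z -> \bar R}).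
Hypothesis mk : forall U, measurable U -> measurable_fun setT (k ^~ U).
Hypothesis rhoE : forall U, measurable U -> rho U = (\int[nu]_(y in D) k y U)%E.

Import HBNNSimple.

Lemma integral_mixture (H : Z -> \bar R) : (forall z, (0 <= H z)%E) ->
  measurable_fun setT H ->
  (\int[rho]_z H z = \int[nu]_(y in D) \int[k y]_z H z)%E.
Proof.
move=> H0 mH; pose f := nnsfun_approx measurableT mH.
have HE z : H z = limn (fun n => (f n z)%:E).
  by apply/esym/cvg_lim => //; exact: cvg_nnsfun_approx.
have step n : (\int[rho]_z (f n z)%:E = \int[nu]_(y in D) \int[k y]_z (f n z)%:E)%E.
  rewrite integralT_nnsfun sintegralE.
  transitivity (\sum_(r \in range (f n)) \int[nu]_(y in D) (r%:E * k y (f n @^-1` [set r])))%E.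
    apply: eq_fsbigr => r; rewrite inE => -[z _ zr]; rewrite rhoE// ge0_integralZl//.
    - by apply: measurable_funTS; exact: mk.
    - by rewrite lee_fin -zr.
  rewrite -ge0_integral_fsum//; last 2 first.
  - by move=> r; apply: measurable_funeM; apply: measurable_funTS; exact: mk.
  - by move=> r y _; have := mulemu_ge0 (fun r => f n @^-1` [set r]); apply; exact: preimage_nnfun0.
  by apply: eq_integral => y _; rewrite integralT_nnsfun sintegralE.
have mfn n : measurable_fun setT (fun z => (f n z)%:E) by exact/measurable_EFinP.
have ndf z : {homo (fun n => (f n z)%:E) : m n / (m <= n)%N >-> (m <= n)%E}.
  by move=> m n mn; rewrite lee_fin; exact/lefP/nd_nnsfun_approx.
have mono (m : {measure set Z -> \bar R}) : (\int[m]_z H z = limn (fun n => \int[m]_z (f n z)%:E))%E.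
  under eq_integral do rewrite HE.
  by rewrite monotone_convergence// => n z _; rewrite lee_fin.
rewrite mono; under eq_fun do rewrite step.
rewrite -monotone_convergence//.
- by apply: eq_integral => y _; rewrite mono.
- move=> n; apply: measurable_funTS; apply: measurable_fun_integral_kernel => // z.
  by rewrite lee_fin.
- by move=> n y _; apply: integral_ge0 => z _; rewrite lee_fin.
- move=> y _ m n mn; apply: ge0_le_integral => //.
  + by move=> z _; rewrite lee_fin.
  + by move=> z _; exact: ndf.
Qed.

End mixture.

Section markov_integral.
Context {R : realType} {M : pmetricType R} {d : measure_display}
  {Omega : measurableType d} (X : hunt_process M Omega).
Local Notation S := (borel (opc M)).
Local Notation P := (hP X).

Definition law (m : {measure set Omega -> \bar R}) s (s0 : 0 <= s) : {measure set S -> \bar R} :=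
  measure_function_pushforward__canonical__measure_function_Measure m (measurable_hX X s0).

Lemma integral_law m s (s0 : 0 <= s) (H : S -> \bar R) : (forall z, (0 <= H z)%E) -> measurable_fun setT H ->
  (\int[law m s0]_z H z = \int[m]_w H (hX X s w))%E.
Proof.
by move=> H0 mH; rewrite /law (ge0_integral_pushforward (measurable_hX X s0)).
Qed.

(** The law of the path at time [t + s], restricted to [L], is a mixture in two ways: of Dirac
    masses at the values of the path, and, by the Markov property for sets, of the laws at time [s]
    started from the position at time [t]. Integrating [H] against both mixtures gives the two
    sides. *)
Lemma markov_integral x t s L (H : S -> \bar R) : 0 <= t -> 0 <= s -> hF X t L ->
  (forall z, (0 <= H z)%E) -> measurable_fun setT H ->
  (\int[P x]_(w in L) H (hX X (t + s) w) =
   \int[P x]_(w in L) \int[P (hX X t w)]_w' H (hX X s w'))%E.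
Proof.
move=> t0 s0 hL H0 mH; have mL := hF_meas t0 hL.
have ts0 := addr_ge0 t0 s0.
have mrestrE U : measurable U -> law (mrestr (P x) mL) ts0 U = P x (L `&` hX X (t + s) @^-1` U).
  by move=> mU; rewrite /law /= /pushforward /mrestr /= setIC.
transitivity (\int[law (mrestr (P x) mL) ts0]_z H z)%E.
  rewrite (@integral_mixture _ _ _ _ _ (P x) L mL _ (fun w => \d_(hX X (t + s) w : S)))//.
  - by apply: eq_integral => w _; rewrite integral_dirac// diracT mul1e.
  - move=> U mU /=; apply/measurable_EFinP => /=.
    rewrite (_ : (fun w => _) = \1_(hX X (t + s) @^-1` U)) //.
    by apply: measurable_indic; exact: measurable_hXA.
  - move=> U mU; rewrite mrestrE// setIC -integral_indic//; last exact: measurable_hXA.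
rewrite (@integral_mixture _ _ _ _ _ (P x) L mL _ (fun w => law (P (hX X t w)) s0))//.
- by apply: eq_integral => w _; rewrite integral_law.
- by move=> U mU; exact: measurable_law.
- by move=> U mU; rewrite mrestrE// markov_at.
Qed.

Lemma measurable_expectation s (H : S -> \bar R) : 0 <= s ->
  (forall z, (0 <= H z)%E) -> measurable_fun setT H ->
  measurable_fun setT ((fun y => \int[P y]_w H (hX X s w)) : S -> \bar R)%E.
Proof.
move=> s0 H0 mH.
rewrite (_ : (fun y => _) = (fun y => \int[law (P y) s0]_z H z)%E); last first.
  by apply/funext => y; rewrite integral_law.
apply: (@measurable_fun_integral_kernel _ _ S S R (fun y => law (P y) s0)) => //.
by move=> U mU; exact: hP_meas.
Qed.

End markov_integral.

Section path_markov.
Context {R : realType} {M : pmetricType R} {d : measure_display}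
  {Omega : measurableType d} (X : hunt_process M Omega).
Local Notation S := (borel (opc M)).
Local Notation P := (hP X).

Definition cylinders : set (set Omega) := [set C | exists l : seq R, exists A : R -> set S,
  [/\ forall s, s \in l -> 0 <= s, forall s, measurable (A s)
    & C = [set w | forall s, s \in l -> A s (hX X s w)]]].

Lemma cylinders_setI : setI_closed cylinders.
Proof.
move=> _ _ [l [A [l0 mA ->]]] [l' [A' [l'0 mA' ->]]].
exists (l ++ l'), (fun s => (if s \in l then A s else setT) `&` (if s \in l' then A' s else setT)).
split=> [s|s|].
- by rewrite mem_cat => /orP[/l0|/l'0].
- by apply: measurableI; case: ifPn.
apply/seteqP; split=> w /=.
  by move=> [h h'] s _; split; case: ifPn => // sl; [exact: h|exact: h'].
move=> h; split=> s sl.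
  by have := h s; rewrite mem_cat sl => /(_ isT)[].
by have := h s; rewrite mem_cat sl orbT => /(_ isT)[_].
Qed.

(** Induction along the ordered times, with [o] the time already elapsed, so that the tail of the
    list is again a cylinder seen from its first time. Measurability of [g] is carried along because
    the preceding step integrates it. *)
Lemma cylinder_markov (A : R -> set S) (l : seq R) o : (forall s, measurable (A s)) ->
  path <=%R o l ->
  let g (y : S) := P y [set w | forall s, s \in l -> A s (hX X (s - o) w)] in
  measurable_fun setT g /\
  forall x t L, 0 <= t -> hF X t L ->
    measurable [set w | forall s, s \in l -> A s (hX X (t + (s - o)) w)] /\
    P x (L `&` [set w | forall s, s \in l -> A s (hX X (t + (s - o)) w)]) =
    (\int[P x]_(w in L) g (hX X t w))%E.
Proof.
move=> mA; elim: l o => [|s1 l IH] o /=.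
  move=> _; have E f : [set w | forall s : R, s \in [::] -> A s (f s w)] = [set: Omega].
    by apply/seteqP; split.
  split.
    rewrite (_ : (fun y => _) = cst 1%E); first exact: measurable_cst.
    by apply/funext => y; rewrite E probability_setT.
  move=> x t L t0 hL; rewrite !E setIT; split => //.
  under eq_integral do rewrite probability_setT.
  by rewrite integral_cst ?mul1e//; exact: hF_meas hL.
move=> /andP[os1 pl]; have [mg IH2] := IH s1 pl.
set g1 := (fun y : S => _) in mg IH2.
have u0 : 0 <= s1 - o by rewrite subr_ge0.
pose H (z : S) := (g1 z * (\1_(A s1) z)%:E)%E.
have H0 z : (0 <= H z)%E by rewrite /H mule_ge0// lee_fin.
have mH : measurable_fun setT H.
  by apply: emeasurable_funM => //; apply/measurable_EFinP; exact: measurable_indic.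
have split_set t : [set w | forall s, s \in s1 :: l -> A s (hX X (t + (s - o)) w)] =
    (hX X (t + (s1 - o)) @^-1` A s1) `&`
    [set w | forall s, s \in l -> A s (hX X (t + (s1 - o) + (s - s1)) w)].
  have tE s : t + (s1 - o) + (s - s1) = t + (s - o) by ring.
  apply/seteqP; split=> w /=.
    move=> h; split; first by apply: h; rewrite inE eqxx.
    by move=> s sl; rewrite tE; apply: h; rewrite inE sl orbT.
  move=> [h1 h2] s; rewrite inE => /predU1P[->//|sl].
  by have := h2 s sl; rewrite tE.
have key x t L : 0 <= t -> hF X t L ->
    P x (L `&` [set w | forall s, s \in s1 :: l -> A s (hX X (t + (s - o)) w)]) =
    (\int[P x]_(w in L) H (hX X (t + (s1 - o)) w))%E.
  move=> t0 hL; have tu0 : 0 <= t + (s1 - o) by rewrite addr_ge0.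
  rewrite split_set setIA.
  have hL' : hF X (t + (s1 - o)) (L `&` hX X (t + (s1 - o)) @^-1` A s1).
    apply: hF_I => //; last exact: hX_hF.
    by apply: hF_mono hL => //; rewrite lerDl.
  have [_ ->] := IH2 x (t + (s1 - o)) _ tu0 hL'.
  rewrite integral_mkcondr; apply: eq_integral => w _.
  rewrite /H patchE indicE; case: ifPn => hw.
    by rewrite (_ : _ \in _ = true) ?mule1//; move: hw; rewrite !inE.
  by rewrite (_ : _ \in _ = false) ?mule0//; apply/negbTE; move: hw; rewrite !notin_setE.
have gE (y : S) : P y [set w | forall s, s \in s1 :: l -> A s (hX X (s - o) w)] =
    (\int[P y]_w H (hX X (s1 - o) w))%E.
  have := key y 0 setT (lexx 0) (hF_T X (lexx 0)); rewrite setTI.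
  under eq_set do under eq_forall do rewrite add0r.
  by under eq_integral do rewrite add0r.
split.
  under eq_fun do rewrite gE.
  exact: measurable_expectation.
move=> x t L t0 hL; split.
  rewrite split_set; apply: measurableI; first by apply: measurable_hXA => //; rewrite addr_ge0.
  have tu0 := addr_ge0 t0 u0.
  by have [] := IH2 x _ setT tu0 (hF_T X tu0).
rewrite key// markov_integral//; apply: eq_integral => w _.
by rewrite gE.
Qed.

(** A shift [th] is known only through its action on the path and is not assumed measurable.
    Measurability of the preimage of [A] is therefore proved together with the Markov identity. *)
Definition markov_set (A : set Omega) :=
  [/\ measurable A, measurable_fun setT ((fun y => P y A) : S -> \bar R) &
   forall x t th L, 0 <= t -> (forall s w, 0 <= s -> hX X s (th w) = hX X (s + t) w) ->
   hF X t L -> measurable (th @^-1` A) /\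
   P x (L `&` th @^-1` A) = (\int[P x]_(w in L) P (hX X t w) A)%E].

Lemma path_markov (A : set Omega) : <<s cylinders >> A -> markov_set A.
Proof.
pose Q := markov_set.
have cylQ : cylinders `<=` Q.
  move=> _ [l [B [l0 mB ->]]].
  have pl : path <=%R 0 (sort <=%R l).
    have : sorted <=%R (sort <=%R l) by apply: sort_sorted; exact: le_total.
    have : forall s, s \in sort <=%R l -> 0 <= s by move=> s; rewrite mem_sort; exact: l0.
    by case: (sort _ _) => [//|s l'] /= h ->; rewrite h ?inE ?eqxx.
  have [] := cylinder_markov mB pl.
  set g := (fun y : S => _) => mg mk.
  have gE y : g y = P y [set w | forall s, s \in l -> B s (hX X s w)].
    rewrite /g; congr (P y _); apply/seteqP; split=> w /= h s sl.
      by have := h s; rewrite mem_sort subr0; exact.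
    by rewrite subr0; apply: h; rewrite mem_sort in sl.
  split.
  - have [+ _] := mk point 0 setT (lexx 0) (hF_T X (lexx 0)).
    congr (measurable _); apply/seteqP; split=> w /= h s sl.
      by have := h s; rewrite mem_sort subr0 add0r; exact.
    by rewrite subr0 add0r; apply: h; rewrite mem_sort in sl.
  - by under eq_fun do rewrite -gE.
  move=> x t th L t0 hth hL.
  have thE : th @^-1` [set w | forall s, s \in l -> B s (hX X s w)] =
      [set w | forall s, s \in sort <=%R l -> B s (hX X (t + (s - 0)) w)].
    apply/seteqP; split=> w /= h s sl.
      by rewrite subr0 addrC -hth; [apply: h; rewrite mem_sort in sl|apply: l0; rewrite mem_sort in sl].
    by rewrite hth ?l0//; have := h s; rewrite mem_sort subr0 addrC; exact.
  rewrite thE; have [m1 ->] := mk x t L t0 hL; split => //.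
  by apply: eq_integral => w _; exact: gE.
apply: lambda_system_subset => //; first exact: cylinders_setI.
apply/dynkin_lambda_system; split.
- split => //.
    rewrite (_ : (fun y => _) = cst 1%E); first exact: measurable_cst.
    by apply/funext => y; rewrite probability_setT.
  move=> x t th L t0 hth hL; rewrite preimage_setT setIT; split => //.
  under eq_integral do rewrite probability_setT.
  by rewrite integral_cst ?mul1e//; exact: hF_meas hL.
- move=> B [mB mP mk]; split.
  + exact: measurableC.
  + rewrite (_ : (fun y => _) = (fun y : S => 1 - P y B)%E); last first.
      by apply/funext => y; rewrite probability_setC.
    exact: emeasurable_funB.
  move=> x t th L t0 hth hL; have [mthB PB] := mk x t th L t0 hth hL.
  have mL := hF_meas t0 hL.
  rewrite preimage_setC; split; first exact: measurableC.
  have mPX C : measurable_fun setT ((fun y => P y C) : S -> \bar R) ->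
      measurable_fun L (fun w => P (hX X t w) C).
    by move=> mPC; apply: measurable_funTS; exact: (measurableT_comp mPC (measurable_hX X t0)).
  (* Finiteness allows the identity for the complement to be checked after adding the identity for
     [B] to both sides. *)
  have fin : (\int[P x]_(w in L) P (hX X t w) B)%E \is a fin_num.
    by rewrite -PB; apply: fin_num_measure; exact: measurableI.
  rewrite -[LHS](addeK _ fin) -[RHS](addeK _ fin); congr (_ - _)%E.
  rewrite addeC [RHS]addeC; transitivity (P x L).
    rewrite -PB -measureU //; last 3 first.
    - exact: measurableI.
    - by apply: measurableI => //; exact: measurableC.
    - by rewrite setIACA setICr setI0.
    by rewrite -setIUr setUv setIT.
  rewrite -ge0_integralD//; last 2 first.
  - exact: mPX.
  - apply: mPX; under eq_fun do rewrite probability_setC//.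
    exact: emeasurable_funB.
  rewrite -[LHS]mul1e -integral_cst//; apply: eq_integral => w _ /=.
  by rewrite probability_setC// addeC subeK// fin_num_measure.
- move=> F tF QF; split.
  + by apply: bigcupT_measurable => n; have [] := QF n.
  + rewrite (_ : (fun y => _) = (fun y : S => \sum_(0 <= n <oo) P y (F n))%E); last first.
      apply/funext => y; apply/esym/cvg_lim => //; apply: measure_semi_sigma_additive => //.
      * by move=> n; have [] := QF n.
      * by apply: bigcupT_measurable => n; have [] := QF n.
    apply: ge0_emeasurable_sum => //.
    by move=> n _; have [] := QF n.
  move=> x t th L t0 hth hL; have mL := hF_meas t0 hL.
  have mth n : measurable (th @^-1` F n) by have [_ _ /(_ x t th L t0 hth hL)[]] := QF n.
  rewrite preimage_bigcup; split; first exact: bigcupT_measurable.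
  transitivity (\sum_(0 <= n <oo) P x (L `&` th @^-1` F n))%E.
    rewrite setI_bigcupr; apply/esym/cvg_lim => //; apply: measure_semi_sigma_additive => //.
    * by move=> n; exact: measurableI.
    * apply/trivIsetP => i j _ _ ij; move/trivIsetP : tF => /(_ i j I I ij) Fij.
      by rewrite setIACA setIid -preimage_setI Fij preimage_set0 setI0.
    * by apply: bigcupT_measurable => n; exact: measurableI.
  transitivity (\sum_(0 <= n <oo) \int[P x]_(w in L) P (hX X t w) (F n))%E.
    by apply: eq_eseriesr => n _; have [_ _ /(_ x t th L t0 hth hL)[_ ->]] := QF n.
  rewrite -integral_nneseries//; last first.
    move=> n; have [_ mP _] := QF n.
    by apply: measurable_funTS; exact: (measurableT_comp mP (measurable_hX X t0)).
  apply: eq_integral => w _; apply/cvg_lim => //; apply: measure_semi_sigma_additive => //.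
  * by move=> n; have [] := QF n.
  * by apply: bigcupT_measurable => n; have [] := QF n.
Qed.

End path_markov.

(** * Consequences of the heat kernel bounds *)

Section limits.
Context d (T : measurableType d) (R : realType) (m : {measure set T -> \bar R}).

Lemma nondecreasing_bigcup_bound (K : nat -> set T) c : (forall n, measurable (K n)) ->
  nondecreasing_seq K -> (forall n, (m (K n) <= c)%E) -> (m (\bigcup_n K n) <= c)%E.
Proof.
move=> mK ndK Kc.
have cK : m \o K @ \oo --> m (\bigcup_n K n) := nondecreasing_cvg_mu mK (bigcupT_measurable K mK) ndK.
rewrite -(cvg_lim _ cK)//; apply: lime_le.
- by apply/cvg_ex; eexists; exact: cK.
- by apply: nearW => n /=; exact: Kc.
Qed.

End limits.

Section profile.
Context {R : realType}.
Variables (V phi : R -> R).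
Hypotheses (VS : weak_scaling V) (phiS : weak_scaling phi).

Lemma hk_profile_le1 t r : 0 < t -> hk_profile V phi t r <= (V (ginv phi t))^-1.
Proof. by move=> t0; rewrite /hk_profile; case: ifP => // _; rewrite ge_min lexx. Qed.

Lemma hk_profile_le2 t r s : 0 < t -> 0 < s -> s <= r ->
  hk_profile V phi t r <= t / (V s * phi s).
Proof.
move=> t0 s0 sr; have r0 := lt_le_trans s0 sr.
rewrite /hk_profile gt_eqF// ge_min; apply/orP; right.
rewrite ler_pM2l// lef_pV2 ?posrE ?mulr_gt0 ?scale_gt0//.
by rewrite ler_pM ?(ltW (scale_gt0 VS s0)) ?(ltW (scale_gt0 phiS s0))// scale_le.
Qed.

Lemma hk_profile_ge t r s : 0 < t -> 0 <= r -> r <= s -> 0 < s ->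
  Num.min (V (ginv phi t))^-1 (t / (V s * phi s)) <= hk_profile V phi t r.
Proof.
move=> t0 r0 rs s0; rewrite /hk_profile; case: eqP => [_|/eqP rn].
  by rewrite ge_min lexx.
have {}r0 : 0 < r by rewrite lt_neqAle eq_sym rn.
rewrite le_min ge_min lexx/= ge_min; apply/orP; right.
rewrite ler_pM2l// lef_pV2 ?posrE ?mulr_gt0 ?scale_gt0//.
by rewrite ler_pM ?(ltW (scale_gt0 _ r0))// scale_le.
Qed.

End profile.

Section heat_kernel_estimates.
Context {R : realType} {M : pmetricType R} {d : measure_display}
  {Omega : measurableType d}.
Variables (mu : {measure set (borel M) -> \bar R}) (V phi : R -> R).
Variable (X : hunt_process M Omega).
Local Notation S := (borel (opc M)).
Local Notation P := (hP X).

Definition volume_comparable (C : R) := forall (x : M) (r : R), 0 < r ->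
  ((C^-1 * V r)%:E <= mu (ball x r) /\ mu (ball x r) <= (C * V r)%:E)%E.

Definition tail_bound (C : R) := forall (x : M) (t r : R), 0 < t -> 0 < r ->
  (P (Some x) (hX X t @^-1` (Some @` [set y : M | (r <= mdist x y)%R])) <= (C * (t / phi r))%:E)%E.

Definition on_diag_bound (C : R) := forall (x : M) (t : R) (A : set (borel M)), 0 < t -> measurable A ->
  (P (Some x) (hX X t @^-1` (Some @` A)) <= (C / V (ginv phi t))%:E * mu A)%E.

(** Together with [tail_bound] and [on_diag_bound] this is all that the later sections retain of the
    heat kernel. A test function is allowed, and not only sets, because the zero-one law compares
    two semigroups acting on the same function. *)
Definition lower_bound (C : R) := forall (x : M) (t r : R) (A : set (borel M)) (f : borel M -> R),
  0 < t -> 0 < r -> measurable A -> A `<=` ball x r ->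
  measurable_fun setT f -> (forall z, 0 <= f z) ->
  ((C * Num.min (V (ginv phi t))^-1 (t / (V r * phi r)))%:E * \int[mu]_(z in A) (f z)%:E <=
   semigroup X t f x)%E.

Lemma semigroup_indic (t : R) (A : set (borel M)) x : 0 <= t -> measurable A ->
  semigroup X t \1_A x = P (Some x) (hX X t @^-1` (Some @` A)).
Proof.
move=> t0 mA; rewrite /semigroup.
transitivity (\int[P (Some x)]_w (\1_(hX X t @^-1` (Some @` A)) w)%:E)%E.
  apply: eq_integral => w _; rewrite indicE /at_cemetery0.
  case E : (hX X t w) => [y|].
    rewrite !indicE; congr ((nat_of_bool _)%:R%:E); apply/idP/idP; rewrite !inE /= E.
      by move=> Ay; exists y.
    by case=> y' Ay' [<-].
  by rewrite (_ : _ \in _ = false)//; apply/negbTE; rewrite notin_setE /= E => -[].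
rewrite integral_indic ?setIT//; apply: measurable_hXA => //.
exact: measurable_image_some.
Qed.

Lemma closed_annulus_measurable (x : M) a b : measurable ([set y : M | a <= mdist x y < b] : set (borel M)).
Proof.
rewrite (_ : [set y | _] = ball x b `\` ball x a).
  by apply: measurableD; apply: openM; exact: open_ball_metric.
apply/seteqP; split=> y /=; rewrite !mdist_ballE.
  by move=> /andP[ay yb]; split=> //; apply/negP; rewrite -leNgt.
by move=> [-> /negP]; rewrite -leNgt andbT.
Qed.

Lemma far_measurable (x : M) a : measurable ([set y : M | a <= mdist x y] : set (borel M)).
Proof.
rewrite (_ : [set y | _] = ~` ball x a).
  by apply: measurableC; apply: openM; exact: open_ball_metric.
apply/seteqP; split=> y /=; rewrite mdist_ballE leNgt; first by move/negP.
by move=> ?; apply/negP.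
Qed.

Hypotheses (VS : weak_scaling V) (phiS : weak_scaling phi).
Variables (Cstar : R) (p : R -> M -> M -> R) (C1 C2 : R).
Hypotheses (Cstar1 : 1 <= Cstar) (mu_ball : volume_comparable Cstar).
Hypothesis p_hk : heat_kernel mu X p.
Hypotheses (C1_gt0 : 0 < C1) (C2_gt0 : 0 < C2).
Hypothesis p_bounds : forall (t : R) (x : M), 0 < t ->
      {ae mu, forall y : M,
         C1 * hk_profile V phi t (mdist x y) <= p t x y <=
         C2 * hk_profile V phi t (mdist x y)}.

Let measurable_p t x : 0 < t -> measurable_fun setT (p t x : borel M -> R).
Proof.
move=> t0; have mD : measurable ([set t : R | 0 < t] `*` [set: borel M * borel M]).
  apply: measurableX => //; rewrite (_ : [set _ | _] = `]0, +oo[%classic).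
    exact: measurable_itv.
  by apply/seteqP; split=> s /=; rewrite in_itv/= andbT.
apply: (measurable_comp mD (f := fun z : R * (borel M * borel M) => p z.1 z.2.1 z.2.2)
  (g := fun z => (t, (x, z))) _ (hk_meas p_hk)).
  by move=> _ [z _ <-].
by do 2 (apply: measurable_fun_pair => //).
Qed.

Let integral_p t x (A : set (borel M)) : 0 < t -> measurable A ->
  P (Some x) (hX X t @^-1` (Some @` A)) = (\int[mu]_(z in A) (p t x z)%:E)%E.
Proof.
move=> t0 mA; rewrite -semigroup_indic ?ltW// (hk_semigroup p_hk)//.
rewrite [RHS]integral_mkcond; apply: eq_integral => z _.
by rewrite patchE indicE; case: ifPn => _; rewrite ?mulr1 ?mulr0.
Qed.

Let integral_p_le t x (A : set (borel M)) c : 0 < t -> measurable A -> 0 <= c ->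
  (forall z, A z -> C2 * hk_profile V phi t (mdist x z) <= c) ->
  (P (Some x) (hX X t @^-1` (Some @` A)) <= c%:E * mu A)%E.
Proof.
move=> t0 mA c0 Ac; rewrite integral_p// -integral_cst//; apply: ae_ge0_le_integral => //.
- by move=> z _; rewrite lee_fin (hk_ge0 p_hk).
- by apply/measurable_EFinP; apply: measurable_funTS; exact: measurable_p.
- move: (p_bounds x t0); apply: (@filterS _ _ (ae_filter_ringOfSetsType mu)) => z /andP[_ pz] Az; rewrite lee_fin.
  exact: le_trans pz (Ac _ Az).
Qed.

Lemma hk_on_diag_bound : on_diag_bound C2.
Proof.
move=> x t A t0 mA; apply: integral_p_le => //.
  by rewrite divr_ge0 ?ltW// scale_gt0// ginv_gt0.
by move=> z _; rewrite ler_pM2l// hk_profile_le1.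
Qed.

Lemma hk_lower_bound : lower_bound C1.
Proof.
move=> x t r A f t0 r0 mA Ar mf f0; set m := C1 * _.
have Vr : 0 < V r := scale_gt0 VS r0; have pr : 0 < phi r := scale_gt0 phiS r0.
have m0 : 0 <= m.
  rewrite mulr_ge0 ?ltW// lt_min invr_gt0 scale_gt0 ?ginv_gt0//=.
  by rewrite divr_gt0 ?mulr_gt0.
rewrite (hk_semigroup p_hk)// -ge0_integralZl//; last 2 first.
- by apply/measurable_EFinP; exact: measurable_funTS.
- by move=> z _; rewrite lee_fin.
apply: (@le_trans _ _ (\int[mu]_(z in A) (p t x z * f z)%:E)%E); last first.
  apply: ge0_subset_integral => //.
  - by apply/measurable_EFinP; apply: measurable_funM => //; exact: measurable_p.
  - by move=> z _; rewrite lee_fin mulr_ge0// (hk_ge0 p_hk).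
apply: ae_ge0_le_integral => //.
- by move=> z _; rewrite -EFinM lee_fin mulr_ge0.
- by apply: measurable_funeM; apply/measurable_EFinP; exact: measurable_funTS.
- by move=> z _; rewrite lee_fin mulr_ge0// (hk_ge0 p_hk).
- apply/measurable_EFinP; apply: measurable_funTS; apply: measurable_funM => //.
  exact: measurable_p.
move: (p_bounds x t0); apply: (@filterS _ _ (ae_filter_ringOfSetsType mu)) => z /andP[pz _] Az; rewrite -EFinM lee_fin.
rewrite ler_wpM2r// (le_trans _ pz)// ler_pM2l//.
apply: hk_profile_ge => //; first exact: mdist_ge0.
by have := Ar _ Az; rewrite mdist_ballE => /ltW.
Qed.

(** The complement of the ball is cut into dyadic annuli. On the [k]-th one the off-diagonal bound
    is [t / (V * phi)] at radius [2 ^ k * r], and by doubling the volume of the annulus cancels [V].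
    What remains, [t / phi (2 ^ k * r)], decays geometrically by [scale_geo]. *)
Lemma hk_tail_bound : exists2 C, 0 < C & tail_bound C.
Proof.
have [KV KV0 KVP] := @scale_bound _ _ VS 2 (ltr0n _ 2).
have [b b1 [a a0 geo]] := scale_geo phiS.
have b0 : 0 < b by rewrite (lt_trans _ b1).
have Cs0 : 0 < Cstar by rewrite (lt_le_trans _ Cstar1).
have q1 : 0 < 1 - b^-1 by rewrite subr_gt0 invf_lt1.
pose C0 := C2 * Cstar * KV / a.
have C00 : 0 < C0 by rewrite /C0 divr_gt0 ?mulr_gt0.
exists (C0 / (1 - b^-1)); first by rewrite divr_gt0.
move=> x t r t0 r0; have pr : 0 < phi r := scale_gt0 phiS r0.
have k0 (k : nat) : 0 < 2 ^+ k * r by rewrite mulr_gt0// exprn_gt0.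
pose A (k : nat) : set (borel M) := [set y | 2 ^+ k * r <= mdist x y < 2 ^+ k.+1 * r].
pose c := C0 * (t / phi r).
have c0 : 0 < c by rewrite mulr_gt0// divr_gt0.
have mA k : measurable (A k) by exact: closed_annulus_measurable.
have PA k : (P (Some x) (hX X t @^-1` (Some @` A k)) <= (c * b^-1 ^+ k)%:E)%E.
  have Vk : 0 < V (2 ^+ k * r) := scale_gt0 VS (k0 k).
  have pk : 0 < phi (2 ^+ k * r) := scale_gt0 phiS (k0 k).
  apply: le_trans (@integral_p_le t x (A k) (C2 * (t / (V (2 ^+ k * r) * phi (2 ^+ k * r)))) t0 (mA k) _ _) _.
  - by rewrite mulr_ge0 ?ltW// divr_gt0 ?mulr_gt0.
  - by move=> z /= /andP[zk _]; rewrite ler_pM2l// hk_profile_le2.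
  have muA : (mu (A k) <= (Cstar * (KV * V (2 ^+ k * r)))%:E)%E.
    apply: (@le_trans _ _ (mu (ball x (2 ^+ k.+1 * r)))).
      apply: le_measure; rewrite ?inE//; first by apply: openM; exact: open_ball_metric.
      by move=> y /= /andP[_]; rewrite mdist_ballE.
    apply: (le_trans (mu_ball x (k0 k.+1)).2); rewrite lee_fin ler_pM2l//.
    by rewrite exprS -mulrA KVP.
  apply: (@le_trans _ _ ((C2 * (t / (V (2 ^+ k * r) * phi (2 ^+ k * r))))%:E * (Cstar * (KV * V (2 ^+ k * r)))%:E)%E).
    by rewrite lee_pmul// lee_fin mulr_ge0 ?ltW// divr_gt0 ?mulr_gt0.
  rewrite -EFinM lee_fin.
  rewrite (_ : C2 * _ * _ = C2 * Cstar * KV * t * (phi (2 ^+ k * r))^-1); last first.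
    by field; rewrite !gt_eqF.
  rewrite (_ : c * _ = C2 * Cstar * KV * t * (a * b ^+ k * phi r)^-1); last first.
    by rewrite /c /C0 exprVn; field; rewrite !gt_eqF// exprn_gt0.
  rewrite ler_pM2l ?mulr_gt0// lef_pV2 ?posrE ?mulr_gt0 ?exprn_gt0//.
  exact: geo.
pose K n : set Omega := \big[setU/set0]_(k < n) (hX X t @^-1` (Some @` A k)).
have mXA k : measurable (hX X t @^-1` (Some @` A k)).
  by apply: measurable_hXA; [exact: ltW|exact: measurable_image_some].
have mK n : measurable (K n) by exact: bigsetU_measurable.
(* The geometric sum is kept in closed form, so that its bound passes directly to the increasing
   union. *)
have PK n : (P (Some x) (K n) <= (c / (1 - b^-1) * (1 - b^-1 ^+ n))%:E)%E.
  elim: n => [|n IH]; first by rewrite /K big_ord0 measure0 lee_fin expr0 subrr mulr0.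
  rewrite /K big_ord_recr/=; apply: (le_trans (measureU2 _ (mK n) (mXA n))).
  apply: le_trans (leeD IH (PA n)) _; rewrite -EFinD lee_fin le_eqVlt; apply/orP; left.
  by move: (b^-1) q1 => q q1; apply/eqP; rewrite exprSr; field; rewrite gt_eqF.
apply: (@le_trans _ _ (P (Some x) (\bigcup_n K n))).
  apply: le_measure; rewrite ?inE.
  - by apply: measurable_hXA; [exact: ltW|apply: measurable_image_some; exact: far_measurable].
  - exact: bigcupT_measurable.
  move=> w [y /= ry yw]; pose T (n : nat) := mdist x y < 2 ^+ n * r.
  have [n Tn] : exists n, T n.
    have [n nP] : exists n, mdist x y / r < 2 ^+ n.
      by exists (Num.bound (mdist x y / r)); exact: upper_nthrootP.
    by exists n; rewrite /T -ltr_pdivrMr.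
  have exT : exists n, T n by exists n.
  have Tm := ex_minnP exT; case: Tm => m Tm mmin.
  case: m Tm mmin => [|m] Tm mmin; first by move: Tm; rewrite /T expr0 mul1r ltNge ry.
  exists m.+1 => //; rewrite /K big_ord_recr/=; right; exists y => //=.
  apply/andP; split; last exact: Tm.
  by rewrite leNgt; apply/negP => /mmin; rewrite ltnn.
apply: nondecreasing_bigcup_bound => //.
  by move=> m n mn; apply/subsetPset; exact: (@subset_bigsetU _ (fun k => hX X t @^-1` (Some @` A k)) _ _ mn).
move=> n; apply: (le_trans (PK n)); rewrite lee_fin.
rewrite [leRHS](_ : _ = c / (1 - b^-1) * 1); last by rewrite /c; ring.
by rewrite ler_pM2l ?divr_gt0// gerBl exprn_ge0// invr_ge0 ltW.
Qed.

End heat_kernel_estimates.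

Section survival.
Context {R : realType} {M : pmetricType R} {d : measure_display}
  {Omega : measurableType d}.
Variables (mu : {measure set (borel M) -> \bar R}) (V phi : R -> R).
Variable (X : hunt_process M Omega).
Local Notation S := (borel (opc M)).
Local Notation P := (hP X).
Hypotheses (VS : weak_scaling V) (phiS : weak_scaling phi).
Variables (Cstar Cl : R).
Hypotheses (Cstar1 : 1 <= Cstar) (mu_ball : volume_comparable mu V Cstar).
Hypotheses (Cl0 : 0 < Cl) (lowb : lower_bound mu V phi X Cl).

Lemma lower_bound_set (x : M) (t r : R) (A : set (borel M)) : 0 < t -> 0 < r -> measurable A -> A `<=` ball x r ->
  ((Cl * Num.min (V (ginv phi t))^-1 (t / (V r * phi r)))%:E * mu A <=
   P (Some x) (hX X t @^-1` (Some @` A)))%E.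
Proof.
move=> t0 r0 mA Ar.
have := lowb t0 r0 mA Ar (@measurable_indic _ _ _ setT A mA) (fun z => ler0n _ _).
have E : (\int[mu]_(z in A) (\1_A z)%:E = mu A)%E by rewrite integral_indic// setIid.
by rewrite semigroup_indic ?(ltW t0)//; apply: le_trans; rewrite E.
Qed.

(** At radius [ginv phi t] both terms of the minimum are of order [1 / V], which cancels the volume
    of the ball. The constant obtained is only positive; that survival has probability 1 needs the
    absence of killing in the form. *)
Lemma survival_lb : exists2 c, 0 < c & forall (x : M) (t : R), 0 < t -> (c%:E <= P (Some x) (hX X t @^-1` (Some @` setT)))%E.
Proof.
have Cs0 : 0 < Cstar by rewrite (lt_le_trans _ Cstar1).
have [K K0 KP] := scale_ginv phiS.
exists (Cl * Num.min 1 K^-1 / Cstar).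
  by rewrite divr_gt0// mulr_gt0// lt_min ltr01 invr_gt0.
move=> x t t0; have g0 := ginv_gt0 phiS t0; set r := ginv phi t in g0.
have Vr : 0 < V r := scale_gt0 VS g0; have pr : 0 < phi r := scale_gt0 phiS g0.
apply: (@le_trans _ _ (P (Some x) (hX X t @^-1` (Some @` ball x r)))); last first.
  apply: le_measure; rewrite ?inE.
  - by apply: measurable_hXA; [exact: ltW|apply: measurable_image_some; apply: openM; exact: open_ball_metric].
  - by apply: measurable_hXA; [exact: ltW|exact: measurable_alive].
  - by move=> w /= [y _ <-]; exists y.
have mB : measurable (ball x r : set (borel M)) by apply: openM; exact: open_ball_metric.
apply: le_trans (lower_bound_set t0 g0 mB (@subset_refl _ _)).
apply: (@le_trans _ _ ((Cl * Num.min (V r)^-1 (t / (V r * phi r)))%:E * (Cstar^-1 * V r)%:E)%E); last first.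
  apply: lee_wpmul2l; last exact: (mu_ball x g0).1.
  rewrite lee_fin mulr_ge0 ?ltW// lt_min invr_gt0 Vr/= divr_gt0 ?mulr_gt0//.
rewrite -EFinM lee_fin.
rewrite (_ : Num.min (V r)^-1 _ = (V r)^-1 * Num.min 1 (t / phi r)); last first.
  rewrite minr_pMr ?invr_ge0 ?(ltW Vr)// mulr1; congr (Num.min _ _).
  by field; rewrite !gt_eqF.
rewrite (_ : Cl * (_ * _) * _ = Cl * Num.min 1 (t / phi r) / Cstar); last first.
  by field; rewrite !gt_eqF.
rewrite ler_pM2r ?invr_gt0// ler_pM2l// le_min ge_min lexx/= ge_min; apply/orP; right.
by rewrite ler_pdivlMr// ler_pdivrMl//; have [] := KP _ t0.
Qed.

End survival.

(** * Conservativeness *)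

Section cutoff.
Context {R : realType} {M : pmetricType R}.

Lemma continuous_contraction (g : M -> R) : (forall y z, `|g y - g z| <= mdist y z) -> continuous g.
Proof.
move=> gl y; apply/cvgrPdist_lt => e e0; apply/nbhs_ballP; exists e => // z.
by rewrite mdist_ballE; exact: le_lt_trans.
Qed.

Lemma continuous_comp_contraction (c : R -> R) (v : M -> R) :
  (forall a b, `|c a - c b| <= `|a - b|) -> continuous v -> continuous (c \o v).
Proof.
move=> cl cv y; apply/cvgrPdist_lt => e e0.
by have /cvgrPdist_lt/(_ e e0) := cv y; apply: filterS => z; apply: le_lt_trans; exact: cl.
Qed.

Lemma continuous_measurable (v : M -> R) : continuous v -> measurable_fun setT (v : borel M -> R).
Proof.
move=> /continuousP cv; apply: (measurability _ (RGenOInfty.measurableE R)) => //.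
move=> _ [_ [x ->] <-]; rewrite setTI; apply: openM; apply: cv.
exact: interval_open.
Qed.

Lemma compact_sub_ball (x0 : M) (K : set M) : compact K -> exists2 r, 0 < r & K `<=` ball x0 r.
Proof.
move=> cK; have cd : continuous (fun y : M => mdist x0 y).
  apply: continuous_contraction => y z; rewrite ler_norml.
  have h1 := metric_triangle x0 y z; have h2 := metric_triangle x0 z y.
  by rewrite (metric_sym z y) in h2; apply/andP; split; lra.
have : compact ((fun y => mdist x0 y) @` K).
  by apply: continuous_compact => //; exact: continuous_subspaceT.
move=> /compact_bounded[r' [_ /(_ (r' + 1))]]; rewrite ltrDl ltr01 => /(_ isT).
set r := r' + 1 => rP; exists (Num.max r 0 + 1).
  by rewrite ltr_pwDr// le_max lexx orbT.
move=> y Ky; rewrite mdist_ballE ltr_pwDr// le_max; apply/orP; left.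
apply: le_trans (rP (mdist x0 y) _); last by exists y.
exact: ler_norm.
Qed.

Variables (mu : {measure set (borel M) -> \bar R}) (F : set (M -> R)) (E : (M -> R) -> (M -> R) -> R).
Hypothesis M_balls : forall (x : M) (r : R), precompact (ball x r).
Hypotheses (EF_dirichlet : dirichlet_form mu F E) (EF_regular : regular_form mu F E).

Definition cutoff (u : M -> R) := (F `&` @Cc R M) u /\ forall y, 0 <= u y <= 1.

Lemma cutoff_exists (x0 : M) r : exists2 u, cutoff u & forall y, ball x0 r y -> u y = 1.
Proof.
pose g (y : M) := Num.max 0 (r + 2 - mdist x0 y).
have gc : continuous g.
  apply: continuous_contraction => y z; rewrite /g ler_norml.
  have h1 := metric_triangle x0 y z; have h2 := metric_triangle x0 z y.
  rewrite (metric_sym z y) in h2; have h3 := mdist_ge0 y z.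
  by rewrite /Num.max /Order.max; do 2 case: ifPn; rewrite -?leNgt => *; apply/andP; split; lra.
have gC : @Cc R M g.
  split => //; apply: (@subclosed_compact _ _ (closure (ball x0 (r + 2)))).
  - exact: closed_closure.
  - by rewrite -precompactE.
  - apply: closure_subset => y /= gy; rewrite mdist_ballE ltNge; apply/negP => h.
    by move/eqP : gy; apply; rewrite /g; apply/max_idPl; lra.
(* The tent function exceeds 2 on the ball, so an approximation within 1/2 exceeds 1 there, and
   truncation to [[0, 1]], under which [F] is stable, makes it equal to 1. *)
have [v [Fv Cv] vg] := EF_regular.2 _ _ gC (ltac:(lra) : 0 < 1 / 2 :> R).
pose c (a : R) := Num.min (Num.max a 0) 1.
have cl a b : `|c a - c b| <= `|a - b|.
  rewrite /c ler_norml; have := ler_norm (a - b); have := ler_norm (- (a - b)); rewrite normrN.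
  rewrite /Num.max /Order.max /Num.min /Order.min.
  by move=> h1 h2; repeat case: ifPn; rewrite -?leNgt => *; apply/andP; split; lra.
exists (c \o v); first split; first split.
- by have [] := df_markov EF_dirichlet Fv.
- split; first by apply: continuous_comp_contraction => //; exact: Cv.1.
  apply: (@subclosed_compact _ _ (closure [set x | v x != 0])).
  + exact: closed_closure.
  + exact: Cv.2.
  + apply: closure_subset => y /=; apply: contra => /eqP vy.
    by rewrite /c vy maxxx min_l.
- move=> y; rewrite /c /= le_min ler01 andbT le_max lexx orbT/=.
  by rewrite ge_min lexx orbT.
move=> y; rewrite mdist_ballE => yr /=; rewrite /c.
have := vg y; rewrite /g max_r; last lra.
rewrite ltr_norml => /andP[h1 h2]; rewrite max_l; last lra.
by rewrite min_r//; lra.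
Qed.

Hypothesis EF_jump : pure_jump F E.

(** Formally the energy of the constant 1 against [f] is zero, since a pure-jump form sees only
    differences. As [u] is 1 where [f] does not vanish, the integrand is non-negative; along cutoffs
    tending to 1 it tends to 0, and dominated convergence applies. *)
Lemma energy_small (x0 : M) (f : M -> R) (e : R) : cutoff f -> 0 < e ->
  exists2 u, cutoff u /\ (forall y, f y != 0 -> u y = 1) & E u f < e.
Proof.
move=> [[Ff Cf] f01] e0; have [n [_ _ nE]] := EF_jump.
have supp (u : M -> R) : @Cc R M u -> exists2 r, 0 < r & forall y, u y != 0 -> ball x0 r y.
  move=> [_ cu]; have [r r0 rP] := compact_sub_ball x0 cu.
  by exists r => // y uy; apply: rP; apply: subset_closure.
have [r r0 fr] := supp f Cf.
have [u0 [[Fu0 Cu0] u001] u01] := cutoff_exists x0 r.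
have [r' r'0 u0r] := supp u0 Cu0.
(* Every [u k] is 1 where [f] or [u0] does not vanish. Hence [u0 <= u k], and the integrand for
   [u k] is dominated by that for [u0], which is integrable because its integral is the finite
   energy [E u0 f]. *)
pose N := r + r'.
have [u uP] := choice (fun k : nat => (let: ex_intro2 u h1 h2 := cutoff_exists x0 (N + k%:R) in
   ex_intro (fun u => cutoff u /\ forall y, ball x0 (N + k%:R) y -> u y = 1) u (conj h1 h2))).
have uk1 k y : mdist x0 y < N + k%:R -> u k y = 1 by move=> h; apply: (uP k).2; rewrite mdist_ballE.
have fu k y : f y != 0 -> u k y = 1.
  move=> /fr; rewrite mdist_ballE => h; apply: uk1; rewrite (lt_le_trans h)// /N.
  by have : 0 <= k%:R :> R by []; lra.
have fu0 y : f y != 0 -> u0 y = 1 by move=> /fr; exact: u01.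
have u0u k y : u0 y <= u k y.
  have [->|u0y] := eqVneq (u0 y) 0; first by have [_ /(_ y)/andP[]] := (uP k).1.
  rewrite uk1; first by have /andP[] := u001 y.
  move/u0r : u0y; rewrite mdist_ballE => h; rewrite (lt_le_trans h)// /N.
  by have : 0 <= k%:R :> R by []; lra.
pose h (w : M -> R) (z : M * M) := (w z.1 - w z.2) * (f z.1 - f z.2).
have hge0 w : (forall y, f y != 0 -> w y = 1) -> (forall y, 0 <= w y <= 1) -> forall z, 0 <= h w z.
  move=> w1 w01 [y z]; rewrite /h /=.
  have /andP[a1 a2] := w01 y; have /andP[b1 b2] := w01 z.
  have /andP[c1 c2] := f01 y; have /andP[d1 d2] := f01 z.
  have [fy|fy] := eqVneq (f y) 0; have [fz|fz] := eqVneq (f z) 0.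
  - by rewrite fy fz subrr mulr0.
  - by rewrite (w1 z fz) fy mulr_le0//; lra.
  - by rewrite (w1 y fy) fz mulr_ge0//; lra.
  - by rewrite (w1 y fy) (w1 z fz) subrr mul0r.
have hle k z : h (u k) z <= h u0 z.
  case: z => y z; rewrite /h /=.
  have /andP[c1 c2] := f01 y; have /andP[d1 d2] := f01 z.
  have := u0u k y; have := u0u k z.
  have [fy|fy] := eqVneq (f y) 0; have [fz|fz] := eqVneq (f z) 0 => h1 h2.
  - by rewrite fy fz subrr !mulr0.
  - by rewrite (fu k z fz) (fu0 z fz) fy; nra.
  - by rewrite (fu k y fy) (fu0 y fy) fz; nra.
  - by rewrite (fu k y fy) (fu0 y fy) (fu k z fz) (fu0 z fz) !subrr !mul0r.
have mh w : continuous w -> measurable_fun setT (fun z : borel M * borel M => (h w z)%:E).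
  move=> cw; have mw := continuous_measurable cw.
  have mf := continuous_measurable Cf.1.
  apply/measurable_EFinP; apply: measurable_funM; apply: measurable_funB.
  - exact: (measurableT_comp mw measurable_fst).
  - exact: (measurableT_comp mw measurable_snd).
  - exact: (measurableT_comp mf measurable_fst).
  - exact: (measurableT_comp mf measurable_snd).
have Eh w : (F `&` @Cc R M) w -> (E w f)%:E = (\int[n]_z (h w z)%:E)%E.
  move=> FCw; rewrite nE//; rewrite integral_mkcond; apply: eq_integral => z _.
  rewrite patchE; case: ifPn => // /negP zd; rewrite /h; congr (_%:E).
  have -> : z.1 = z.2 by apply: contrapT => zn; apply: zd; rewrite inE.
  by rewrite !subrr mulr0.
have int0 : n.-integrable setT (fun z => (h u0 z)%:E).
  apply/integrableP; split; first exact: mh Cu0.1.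
  under eq_integral do rewrite gee0_abs ?lee_fin ?hge0//.
  by rewrite -Eh// ltry.
have cvg0 z : (h (u k) z)%:E @[k --> \oo] --> 0%E.
  case: z => y z; apply: cvg_near_cst.
  near=> k; rewrite /h /= !uk1 ?subrr ?mul0r//.
  - have : mdist x0 z < k%:R by near: k; exact: nbhs_infty_gtr.
    by rewrite /N; lra.
  - have : mdist x0 y < k%:R by near: k; exact: nbhs_infty_gtr.
    by rewrite /N; lra.
have := @dominated_cvg _ _ _ n setT measurableT (fun k z => (h (u k) z)%:E) (cst 0%E) (fun z => (h u0 z)%:E)
   (fun k => mh _ (uP k).1.1.2.1) (fun z _ => cvg0 z) (fun z _ => erefl) int0.
have dom k z : setT z -> (`|(h (u k) z)%:E| <= (h u0 z)%:E)%E.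
  by move=> _; rewrite gee0_abs lee_fin ?hle// hge0// => y; [exact: fu|exact: (uP k).1.2].
move=> /(_ dom); rewrite integral0 => cE.
have : (E (u k) f)%:E @[k --> \oo] --> 0%E.
  rewrite (_ : (fun k => (E (u k) f)%:E) = (fun k => \int[n]_z (h (u k) z)%:E)%E) //.
  by apply/funext => k; rewrite Eh//; exact: (uP k).1.1.
move=> /fine_cvgP[_] /cvgrPdist_lt/(_ e e0)[k _ /(_ k (leqnn k))] /=.
rewrite sub0r normrN => /(le_lt_trans (ler_norm _)) Ek.
exists (u k) => //; split; first exact: (uP k).1.
by move=> y; exact: fu.
Unshelve. all: by end_near. Qed.

End cutoff.

Section killing.
Context {R : realType} {M : pmetricType R} {d : measure_display}
  {Omega : measurableType d}.
Variables (mu : {measure set (borel M) -> \bar R}) (V phi : R -> R).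
Variables (F : set (M -> R)) (E : (M -> R) -> (M -> R) -> R).
Variable (X : hunt_process M Omega).
Local Notation S := (borel (opc M)).
Local Notation P := (hP X).

Lemma alive_or_dead : Some @` setT = ~` [set None] :> set (opc M).
Proof.
apply/seteqP; split=> [_ [y _ <-]//|[y|]] /=; first by exists y.
by move=> /(_ erefl).
Qed.

Lemma measurable_dead : measurable ([set None] : set S).
Proof. exact: (@measurable_point R M None). Qed.

Lemma probability_alive (z : opc M) t : 0 <= t ->
  P z (hX X t @^-1` (Some @` setT)) = (1 - P z (hX X t @^-1` [set None]))%E.
Proof.
move=> t0; rewrite alive_or_dead -preimage_setC probability_setC//.
by apply: measurable_hXA => //; exact: measurable_dead.
Qed.

Lemma measurable_at_cemetery (u : borel M -> R) : measurable_fun setT u ->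
  measurable_fun setT (at_cemetery0 u : S -> R).
Proof.
move=> mu' _ B mB; rewrite setTI.
have -> : at_cemetery0 u @^-1` B =
    (Some @` (u @^-1` B)) `|` (if 0 \in B then [set None] else set0) :> set (opc M).
  apply/seteqP; split=> [[y|] /=|].
  - by move=> uy; left; exists y.
  - by move=> B0; right; rewrite mem_set.
  - move=> z [[y uy <-]//|]; case: ifPn; last by [].
    by rewrite inE => B0 ->.
apply: measurableU; last by case: ifPn => // _; exact: measurable_dead.
by apply: measurable_image_some; rewrite -[X in measurable X]setTI; exact: mu'.
Qed.

Lemma at_cemetery_ge0 (u : M -> R) : (forall y, 0 <= u y) -> forall z, 0 <= at_cemetery0 u z.
Proof. by move=> u0 [y|] /=. Qed.

Lemma measurable_semigroup (t : R) (u : borel M -> R) : 0 <= t ->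
  measurable_fun setT u -> (forall y, 0 <= u y) ->
  measurable_fun setT (semigroup X t u : borel M -> \bar R).
Proof.
move=> t0 mu' u0.
have H : measurable_fun setT ((fun z => (at_cemetery0 u z)%:E) : S -> \bar R).
  by apply/measurable_EFinP; exact: measurable_at_cemetery.
have := measurable_expectation X t0 (fun z => at_cemetery_ge0 u0 z : (0 <= (at_cemetery0 u z)%:E)%E) H.
by move=> /measurableT_comp/(_ (@measurable_fun_some R M)).
Qed.

Lemma semigroup_ge0 (t : R) (u : M -> R) y : (forall y, 0 <= u y) -> (0 <= semigroup X t u y)%E.
Proof. by move=> u0; apply: integral_ge0 => w _; rewrite lee_fin at_cemetery_ge0. Qed.

Lemma semigroup_le_alive (t : R) (u : borel M -> R) y : 0 <= t -> measurable_fun setT u ->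
  (forall y, 0 <= u y <= 1) -> (semigroup X t u y <= P (Some y) (hX X t @^-1` (Some @` setT)))%E.
Proof.
move=> t0 mu' u01; rewrite -semigroup_indic// /semigroup.
have mc (v : borel M -> R) : measurable_fun setT v ->
    measurable_fun setT (fun w => (at_cemetery0 v (hX X t w))%:E).
  move=> mv; apply/measurable_EFinP.
  exact: (measurableT_comp (measurable_at_cemetery mv) (measurable_hX X t0)).
apply: ge0_le_integral => //.
- by move=> w _; rewrite lee_fin; apply: at_cemetery_ge0 => z; have /andP[] := u01 z.
- exact: mc.
- exact: mc.
- move=> w _; rewrite lee_fin; case: (hX X t w) => [z|]//=.
  by rewrite indicT; have /andP[] := u01 z.
Qed.

Definition kill (t : R) (y : M) : \bar R := P (Some y) (hX X t @^-1` [set None]).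

Lemma kill_ge0 t y : (0 <= kill t y)%E. Proof. exact: measure_ge0. Qed.

Lemma kill_le1 t y : 0 <= t -> (kill t y <= 1)%E.
Proof. by move=> t0; apply: probability_le1; apply: measurable_hXA => //; exact: measurable_dead. Qed.

Lemma kill_fin t y : 0 <= t -> (fine (kill t y))%:E = kill t y.
Proof.
move=> t0; rewrite fineK// ge0_fin_numE ?kill_ge0//.
by apply: le_lt_trans (kill_le1 y t0) _; rewrite ltry.
Qed.

Lemma measurable_kill t : 0 <= t -> measurable_fun setT (kill t : borel M -> \bar R).
Proof.
move=> t0; have := hP_meas X t0 measurable_dead.
by move=> /measurableT_comp/(_ (@measurable_fun_some R M)).
Qed.

Hypothesis M_balls : forall (x : M) (r : R), precompact (ball x r).
Hypotheses (EF_dirichlet : dirichlet_form mu F E) (EF_regular : regular_form mu F E).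
Hypothesis EF_jump : pure_jump F E.
Hypothesis X_assoc : associated mu X F E.
Hypothesis mu_fin : forall (x : M) r, 0 < r -> (mu (ball x r) < +oo)%E.

Let mball (x : M) r : measurable (ball x r : set (borel M)).
Proof. by apply: openM; exact: open_ball_metric. Qed.

(** Let [f] be 1 on the ball and [u] be 1 where [f] does not vanish. Then [(u - P_t u) f] is
    non-negative everywhere, and on the ball it is at least [1 - P_t 1], the killing probability.
    Its integral divided by [t] tends to [E u f], which [energy_small] makes smaller than [e]. *)
Lemma killing_small (x0 : M) r e : 0 < e ->
  exists2 dl, 0 < dl & forall t, 0 < t -> t < dl ->
   (\int[mu]_(y in ball x0 r) kill t y <= (e * t)%:E)%E.
Proof.
move=> e0; have [f cf f1] := cutoff_exists M_balls EF_dirichlet EF_regular x0 r.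
have [u [cu uf] Euf] := energy_small M_balls EF_dirichlet EF_regular EF_jump x0 cf e0.
have [_ _ /(_ u f cu.1.1 cf.1.1)/cvgr_lt/(_ e Euf)] := X_assoc.
move=> [dl /= dl0 dlP]; exists dl => // t t0 tdl.
have {}dlP : approx_form mu X t u f < e.
  by apply: dlP => //=; rewrite sub0r normrN gtr0_norm.
have mf := continuous_measurable cf.1.2.1; have mu' := continuous_measurable cu.1.2.1.
have [N N0 fN] := compact_sub_ball x0 cf.1.2.2.
have u0 y : 0 <= u y by have /andP[] := cu.2 y.
have f0 y : 0 <= f y by have /andP[] := cf.2 y.
have sl y : (semigroup X t u y <= 1 - kill t y)%E.
  apply: (le_trans (semigroup_le_alive y (ltW t0) mu' cu.2)).
  by rewrite probability_alive// ltW.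
have s1 y : (semigroup X t u y <= 1)%E.
  by apply: (le_trans (sl y)); rewrite leeBlDr ?leeDl ?kill_ge0// -kill_fin// ltW.
have sfin y : (fine (semigroup X t u y))%:E = semigroup X t u y.
  rewrite fineK// ge0_fin_numE ?semigroup_ge0//.
  by apply: le_lt_trans (s1 y) _; rewrite ltry.
pose G y := (u y - fine (semigroup X t u y)) * f y.
have G0 y : 0 <= G y.
  have [fy|fy] := eqVneq (f y) 0; first by rewrite /G fy mulr0.
  by rewrite mulr_ge0// (uf y fy) subr_ge0 -lee_fin sfin.
have Gf y : G y <= f y.
  rewrite -[leRHS]mul1r ler_wpM2r// lerBlDr.
  have /andP[_ u1] := cu.2 y; rewrite (le_trans u1)// lerDl -lee_fin sfin.
  exact: semigroup_ge0.
have mG : measurable_fun setT (G : borel M -> R).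
  apply: measurable_funM => //; apply: measurable_funB => //.
  apply: measurableT_comp => //; apply: measurable_semigroup => //; exact: ltW.
have mGE : measurable_fun setT (fun y : borel M => (G y)%:E) by exact/measurable_EFinP.
(* The inner product in [approx_form] is a real-valued integral; finiteness ensures that it is the
   true integral and not a default value. *)
have Gfin : (\int[mu]_y (G y)%:E < +oo)%E.
  apply: (@le_lt_trans _ _ (\int[mu]_y (\1_(ball x0 N) y)%:E)%E).
    apply: ge0_le_integral => //.
    - by move=> y _; rewrite lee_fin.
    - by apply/measurable_EFinP; exact: measurable_indic.
    - move=> y _; rewrite lee_fin (le_trans (Gf y))//.
      have [->//|fy] := eqVneq (f y) 0.
      rewrite indicE mem_set; first by have /andP[] := cf.2 y.
      by apply: fN; exact: subset_closure.
  by rewrite integral_indic// setIT mu_fin.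
apply: (@le_trans _ _ (\int[mu]_y (G y)%:E)%E).
  apply: (@le_trans _ _ (\int[mu]_(y in ball x0 r) (G y)%:E)%E).
    apply: ge0_le_integral => //.
    - by apply: measurable_funTS; apply: measurable_kill; exact: ltW.
    - exact: measurable_funTS.
    - move=> y yr; have f1y := f1 y yr.
      rewrite /G f1y mulr1 uf ?f1y ?oner_neq0// EFinB sfin.
      have := sl y; rewrite -(sfin y) -(kill_fin y (ltW t0)) -!EFinB !lee_fin; lra.
  apply: ge0_subset_integral => //.
  by move=> y _; rewrite lee_fin.
have Ifin : (\int[mu]_y (G y)%:E)%E \is a fin_num.
  by rewrite ge0_fin_numE// integral_ge0// => y _; rewrite lee_fin.
rewrite -(fineK Ifin) lee_fin mulrC -ler_pdivrMl//; exact: ltW.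
Qed.

Hypothesis phiS : weak_scaling phi.
Hypothesis VS : weak_scaling V.
Variables (c Ct Cu : R).
Hypotheses (c0 : 0 < c) (surv : forall (x : M) (t : R), 0 < t -> (c%:E <= P (Some x) (hX X t @^-1` (Some @` setT)))%E).
Hypotheses (Ct0 : 0 < Ct) (tail : tail_bound phi X Ct).
Hypothesis ondiag : on_diag_bound mu V phi X Cu.

Lemma start_prob x (A : set S) : measurable A -> A x -> P x (hX X 0 @^-1` A) = 1%E.
Proof.
move=> mA Ax; have m0 := measurable_hXA X (lexx 0) mA.
apply/eqP; rewrite eq_le probability_le1//=.
rewrite -(hP_start X x); apply: le_measure; rewrite ?inE.
- rewrite (_ : [set w | _] = hX X 0 @^-1` [set x])//.
  by apply: measurable_hXA => //; exact: (@measurable_point R M).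
- exact: m0.
- by move=> w /= ->.
Qed.

Lemma start_prob0 x (A : set S) : measurable A -> ~ A x -> P x (hX X 0 @^-1` A) = 0%E.
Proof.
move=> mA Ax; have m0 := measurable_hXA X (lexx 0) mA.
have := @start_prob x (~` A) (measurableC mA) Ax.
rewrite -preimage_setC probability_setC// => h.
have fin : P x (hX X 0 @^-1` A) \is a fin_num by rewrite fin_num_measure// measurable_hXA.
by move: h; rewrite -(fineK fin) -EFinB => -[/eqP]; rewrite subr_eq addrC -subr_eq subrr => /eqP <-.
Qed.

(** Survival has probability at least [c] and a displacement by [r] or more at most [c / 2]; the
    difference is left for the ball. *)
Lemma stay_lb (y : M) (s r : R) : 0 <= s -> 0 < r -> Ct * (s / phi r) <= c / 2 ->
  ((c / 2)%:E <= P (Some y) (hX X s @^-1` (Some @` ball y r)))%E.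
Proof.
move=> s0 r0 sr; have c2 : 0 < c / 2 by rewrite divr_gt0.
have mB := measurable_image_some (mball y r).
have mfar := measurable_image_some (far_measurable y r).
move: s0; rewrite le_eqVlt => /predU1P[<-|s0].
  rewrite start_prob//; last by exists y => //; exact: ballxx.
  have := surv y ltr01; have := probability_le1 (P (Some y)) (measurable_hXA X (@ler01 R) measurable_alive).
  by move=> h1 h2; have := le_trans h2 h1; rewrite !lee_fin; lra.
have := surv y s0; have := tail y s0 r0.
have sub : hX X s @^-1` (Some @` setT) `<=` hX X s @^-1` (Some @` ball y r) `|` hX X s @^-1` (Some @` [set z : M | r <= mdist y z]).
  move=> w [z _ zw]; have [h|h] := ltP (mdist y z) r.
    by left; exists z => //; rewrite mdist_ballE.
  by right; exists z.
have m1 := measurable_hXA X (ltW s0) mB; have m2 := measurable_hXA X (ltW s0) mfar.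
have m3 := measurable_hXA X (ltW s0) (@measurable_alive R M).
have : (P (Some y) (hX X s @^-1` (Some @` setT)) <= P (Some y) (hX X s @^-1` (Some @` ball y r)) +
   P (Some y) (hX X s @^-1` (Some @` [set z : M | (r <= mdist y z)%R])))%E.
  apply: le_trans (measureU2 _ m1 m2); apply: le_measure; rewrite ?inE//.
  exact: measurableU.
have f1 := fin_num_measure (P (Some y)) _ m1; have f2 := fin_num_measure (P (Some y)) _ m2.
have f3 := fin_num_measure (P (Some y)) _ m3.
rewrite -(fineK f1) -(fineK f2) -(fineK f3) -EFinD !lee_fin; lra.
Qed.

(** The cemetery is left out, in contrast with [esc] below: the first passage argument that precedes
    conservativeness needs a living process, which can then be found far away at the final time. *)
Definition far_set (x0 : M) r : set (opc M) := Some @` [set z : M | r < mdist x0 z].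

Lemma open_far_set x0 r : open (far_set x0 r).
Proof.
apply: one_point_compactification_open_some.
rewrite (_ : [set _ | _] = ~` [set z | mdist z x0 <= r]).
  by apply: closed_openC; exact: closed_ball_le.
apply/seteqP; split=> z /=; rewrite metric_sym ltNge; first by move/negP.
by move=> ?; apply/negP.
Qed.

(* First passage: after reaching distance [r] from [x0], with probability at
   least [c / 2] the process is still at distance [r / 2] at time [T]. *)
Lemma hit_far_le (x0 y : M) (T r : R) : 0 < T -> 0 < r -> mdist x0 y < r / 2 ->
  Ct * (T / phi (r / 2)) <= c / 2 ->
  ((c / 2)%:E * P (Some y) (hit X 0 T (far_set x0 r)) <= (Ct * (T / phi (r / 2 - mdist x0 y)))%:E)%E.
Proof.
move=> T0 r0 yr Tr; have c2 : 0 <= c / 2 by rewrite divr_ge0// ltW.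
have mA := measurable_image_some (far_measurable x0 (r / 2)).
have h z s : far_set x0 r z -> 0 <= s <= T ->
    ((c / 2)%:E <= P z (hX X s @^-1` (Some @` [set z : M | (r / 2 <= mdist x0 z)%R])))%E.
  move=> [z' /= rz' <-] /andP[s0 sT].
  apply: (@le_trans _ _ (P (Some z') (hX X s @^-1` (Some @` ball z' (r / 2))))).
    apply: stay_lb => //; first by rewrite divr_gt0.
    apply: le_trans Tr; rewrite ler_pM2l// ler_pM2r// invr_gt0 scale_gt0// divr_gt0//.
  apply: le_measure; rewrite ?inE.
  - by apply: measurable_hXA => //; exact: measurable_image_some.
  - exact: measurable_hXA.
  - move=> w [z'' zz zE]; exists z'' => //=; move: zz; rewrite mdist_ballE => zz.
    by have := metric_triangle x0 z'' z'; rewrite (metric_sym z'' z'); lra.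
have := @hit_lb _ _ _ _ X (Some y) 0 T setT (far_set x0 r) _ (lexx 0) T0 (hF_T X (lexx 0)) (@open_far_set x0 r) mA _ c2 h.
rewrite setTI add0r => /le_trans; apply.
have m1 := measurable_hXA X (ltW T0) mA.
have ry : 0 < r / 2 - mdist x0 y by rewrite subr_gt0.
apply: le_trans (tail y T0 ry); apply: le_measure; rewrite ?inE//.
- apply: measurableI => //.
  have := hF_hit X (lexx 0) T0 (@open_far_set x0 r); rewrite add0r; apply: hF_meas; exact: ltW.
- by apply: measurable_hXA; [exact: ltW|apply: measurable_image_some; exact: far_measurable].
- move=> w [_ [z /= rz <-]]; exists z => //=.
  by have := metric_triangle x0 y z; lra.
Qed.

End killing.

Section conservative.
Context {R : realType} {M : pmetricType R} {d : measure_display}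
  {Omega : measurableType d}.
Variables (mu : {measure set (borel M) -> \bar R}) (V phi : R -> R).
Variables (F : set (M -> R)) (E : (M -> R) -> (M -> R) -> R).
Variable (X : hunt_process M Omega).
Local Notation S := (borel (opc M)).
Local Notation P := (hP X).
Local Notation kill := (kill X).
Hypothesis M_balls : forall (x : M) (r : R), precompact (ball x r).
Hypotheses (EF_dirichlet : dirichlet_form mu F E) (EF_regular : regular_form mu F E).
Hypothesis EF_jump : pure_jump F E.
Hypothesis X_assoc : associated mu X F E.
Hypothesis mu_fin : forall (x : M) (r : R), 0 < r -> (mu (ball x r) < +oo)%E.
Hypothesis phiS : weak_scaling phi.
Variables (c Ct Cu : R).
Hypotheses (c0 : 0 < c) (surv : forall (x : M) (t : R), 0 < t -> (c%:E <= P (Some x) (hX X t @^-1` (Some @` setT)))%E).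
Hypotheses (Ct0 : 0 < Ct) (tail : tail_bound phi X Ct).
Hypothesis ondiag : on_diag_bound mu V phi X Cu.

Let mball (x : M) r : measurable (ball x r : set (borel M)).
Proof. by apply: openM; exact: open_ball_metric. Qed.

Section one_step.
Variables (x0 : M) (r h : R) (h0 : 0 < h).

Definition local_kill (y : M) : R := \1_(ball x0 r) y * fine (kill h y).

Lemma local_kill_ge0 y : 0 <= local_kill y.
Proof. by rewrite mulr_ge0// fine_ge0// kill_ge0. Qed.

Lemma measurable_local_kill : measurable_fun setT (local_kill : borel M -> R).
Proof.
apply: measurable_funM; first exact: measurable_indic.
by apply: measurableT_comp => //; apply: measurable_kill; exact: ltW.
Qed.

Lemma integral_local_kill :
  (\int[mu]_y (local_kill y)%:E = \int[mu]_(y in ball x0 r) kill h y)%E.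
Proof.
rewrite [RHS]integral_mkcond; apply: eq_integral => y _.
rewrite patchE /local_kill indicE; case: ifPn => _; rewrite ?mul0r// mul1r.
by rewrite kill_fin// ltW.
Qed.

Lemma step_killE (y : M) (s : R) : 0 <= s ->
  P (Some y) (hX X s @^-1` (Some @` ball x0 r) `&` hX X (s + h) @^-1` [set None]) =
  semigroup X s local_kill y.
Proof.
move=> s0; have mB := measurable_image_some (mball x0 r).
rewrite (markov_at _ s0 (ltW h0) (hX_hF X s0 (lexx s) mB) (@measurable_dead R M)).
rewrite integral_mkcond /semigroup; apply: eq_integral => w _.
rewrite patchE /local_kill; case E1 : (hX X s w) => [z|] /=; last first.
  by case: ifPn => //; rewrite inE /= E1 => -[z _].
rewrite indicE; have [zB|zB] := pselect (ball x0 r z).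
  by rewrite !mem_set//= ?E1; [rewrite mul1r kill_fin ?ltW|exists z].
rewrite (memNset zB) mul0r; case: ifPn => //; rewrite inE /= E1 => -[z' z'B [zz]].
by case: zB; rewrite -zz.
Qed.

End one_step.

(* Between the times [k h] and [(k + 1) h] the process can only die inside a
   large ball, and this has small probability because the form has no killing
   part; leaving the large ball before [T] is unlikely by [hit_far_le]. *)
Lemma integral_kill_ball (x0 : M) (r0 T : R) : 0 < T -> 0 < r0 ->
  (\int[mu]_(y in ball x0 r0) kill T y = 0)%E.
Proof.
move=> T0 r00; set B := ball x0 r0.
apply/eqP; rewrite eq_le; apply/andP; split; last by apply: integral_ge0 => y _; exact: kill_ge0.
apply/lee_addgt0Pr => e e0; rewrite add0e.
have muB : mu B \is a fin_num by rewrite ge0_fin_numE// mu_fin.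
pose m := fine (mu B); have m0 : 0 <= m by rewrite fine_ge0.
(* The first term gives the smallness required by [hit_far_le]; the second makes the probability of
   leaving the large ball, integrated over [B], at most [e / 2]. *)
pose Q := 2 * Ct * T / c + 4 * Ct * T * m / (c * e).
have Q0 : 0 < Q by rewrite ltr_pwDl ?divr_gt0 ?mulr_gt0// divr_ge0 ?mulr_ge0// ltW.
have [rho rho0 rhoQ] := scale_unbounded phiS Q.
have prho : 0 < phi rho := scale_gt0 phiS rho0.
pose Rb := 2 * (rho + r0); have Rb0 : 0 < Rb by rewrite mulr_gt0// addr_gt0.
have Rb2 : Rb / 2 = rho + r0 by rewrite /Rb mulrC mulKf.
have phiRb : phi rho <= phi (Rb / 2) by rewrite Rb2 (scale_le phiS)// lerDl ltW.
pose q := 2 / c * (Ct * (T / phi rho)).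
have q0 : 0 <= q by rewrite /q !mulr_ge0 ?invr_ge0// ltW.
have Tphi : Ct * (T / phi rho) <= c / 2.
  rewrite mulrA ler_pdivrMr// (le_trans _ (ler_wpM2l _ rhoQ))//; last by rewrite divr_ge0// ltW.
  rewrite /Q mulrDr (_ : c / 2 * (2 * Ct * T / c) = Ct * T); last by field; rewrite gt_eqF.
  rewrite lerDl; do ![rewrite mulr_ge0 ?invr_ge0//]; exact: ltW.
have hitle y : B y -> (P (Some y) (hit X 0 T (far_set x0 Rb)) <= q%:E)%E.
  rewrite /B mdist_ballE => yr.
  have yRb : mdist x0 y < Rb / 2 by rewrite Rb2; lra.
  have h1 : Ct * (T / phi (Rb / 2)) <= c / 2.
    apply: le_trans Tphi; rewrite ler_pM2l// ler_pM2l// lef_pV2 ?posrE//.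
    by rewrite (scale_gt0 phiS)// divr_gt0.
  have := hit_far_le phiS c0 surv Ct0 tail T0 Rb0 yRb h1.
  rewrite -lee_pdivlMl ?divr_gt0// => /le_trans; apply.
  rewrite -EFinM lee_fin /q invf_div ler_pM2l ?divr_gt0// ler_pM2l// ler_pM2l// lef_pV2 ?posrE//.
    by apply: (scale_le phiS) => //; lra.
  by apply: (scale_gt0 phiS) => //; lra.
have qm : q * m <= e / 2.
  rewrite /q (_ : _ * m = (4 * Ct * T * m / (c * e)) * (e / 2) / phi rho); last first.
    by field; rewrite !gt_eqF.
  rewrite ler_pdivrMr// mulrC ler_pM2l ?divr_gt0// (le_trans _ rhoQ)// /Q.
  by rewrite lerDr divr_ge0 ?mulr_ge0// ltW.
(* With this rate of killing, [n] steps of length [h = T / n] contribute [e / 2] in all. *)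
pose e' := e / 2 / T; have e'0 : 0 < e' by rewrite divr_gt0// divr_gt0.
have [dl dl0 dlP] := killing_small M_balls EF_dirichlet EF_regular EF_jump X_assoc mu_fin x0 (Rb + 1) e'0.
pose n := (Num.truncn (T / dl)).+1.
pose h := T / n%:R; have n0 : 0 < n%:R :> R by rewrite ltr0n.
have h0 : 0 < h by rewrite divr_gt0.
have hdl : h < dl.
  by rewrite ltr_pdivrMr// mulrC -ltr_pdivrMr//; exact: truncnS_gt.
have hn : h * n%:R = T by rewrite divfK// gt_eqF.
have {}dlP := dlP h h0 hdl.
pose g := local_kill x0 (Rb + 1) h.
have g0 y : 0 <= g y := local_kill_ge0 _ _ _ _.
have mg : measurable_fun setT (g : borel M -> R) := measurable_local_kill _ _ h0.
pose N0 : set Omega := hX X 0 @^-1` [set None].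
pose C (k : nat) := hX X (h * k%:R) @^-1` (Some @` ball x0 (Rb + 1)) `&` hX X (h * k%:R + h) @^-1` [set None].
have hk0 (k : nat) : 0 <= h * k%:R by rewrite mulr_ge0// ltW.
have mC k : measurable (C k).
  apply: measurableI; first by apply: measurable_hXA => //; exact: measurable_image_some.
  by apply: measurable_hXA; [rewrite addr_ge0// ltW|exact: measurable_dead].
have mhit : measurable (hit X 0 T (far_set x0 Rb)).
  by have := hF_hit X (lexx 0) T0 (@open_far_set R M x0 Rb); rewrite add0r; apply: hF_meas; exact: ltW.
have mN0 : measurable N0 by apply: measurable_hXA => //; exact: measurable_dead.
have PC y k : P (Some y) (C k) = semigroup X (h * k%:R) g y by exact: step_killE.
(* The least [k] with a dead process at time [h * k] gives the step in which death occurs. Just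
   before, the process is alive and within [Rb], hence in the open ball of radius [Rb + 1], unless
   the far set has been visited. *)
have cover : hX X T @^-1` [set None] `<=` (hit X 0 T (far_set x0 Rb) `|` N0) `|` \big[setU/set0]_(k < n) C k.
  move=> w /= XT; have [X0|X0] := eqVneq (hX X 0 w) None; first by left; right.
  have [Hh|Hh] := pselect (hit X 0 T (far_set x0 Rb) w); first by left; left.
  right; rewrite -bigcup_mkord.
  pose A (k : nat) := hX X (h * k%:R) w == None.
  have exA : exists k, A k by exists n; rewrite /A hn XT.
  case: (ex_minnP exA) => k Ak kmin.
  case: k Ak kmin => [|k] Ak kmin; first by move: Ak; rewrite /A mulr0 (negbTE X0).
  have kn : (k < n)%N by apply: kmin; rewrite /A hn XT.
  exists k => //; split; last first.
    by rewrite /= (_ : h * k%:R + h = h * k.+1%:R); [exact/eqP|rewrite -natr1 mulrDr mulr1].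
  have : ~~ A k by apply/negP => /kmin; rewrite ltnn.
  rewrite /A /=; case Ez : (hX X (h * k%:R) w) => [z|]// _; exists z => //.
  rewrite mdist_ballE ltNge; apply/negP => zR; apply: Hh.
  exists (h * k%:R); first by rewrite hk0/= add0r -hn ler_pM2l// ler_nat ltnW.
  by rewrite Ez; exists z => //=; lra.
have PT y : B y -> (kill T y <= q%:E + \sum_(k < n) semigroup X (h * k%:R) g y)%E.
  move=> By; have PN0 : P (Some y) N0 = 0%E by apply: start_prob0 => //; exact: measurable_dead.
  apply: (@le_trans _ _ (P (Some y) ((hit X 0 T (far_set x0 Rb) `|` N0) `|` \big[setU/set0]_(k < n) C k))).
    apply: le_measure; rewrite ?inE//.
    - by apply: measurable_hXA; [exact: ltW|exact: measurable_dead].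
    - by apply: measurableU; [exact: measurableU|exact: bigsetU_measurable].
  apply: le_trans (measureU2 _ _ _) _; [exact: measurableU|exact: bigsetU_measurable|].
  apply: leeD.
    have PN0' : (P (Some y) N0 <= 0)%E by rewrite PN0.
    apply: le_trans (measureU2 _ _ _) _ => //.
    by rewrite -[leRHS]adde0; apply: leeD; [exact: hitle|exact: PN0'].
  apply: (@le_trans _ _ (\sum_(k < n) P (Some y) (C k))%E).
    apply: content_subadditive => //; exact: bigsetU_measurable.
  by apply: lee_sum => k _; rewrite PC.
have msg k : measurable_fun setT (semigroup X (h * k%:R) g : borel M -> \bar R).
  exact: measurable_semigroup.
have Ig : (\int[mu]_y (g y)%:E <= (e' * h)%:E)%E by rewrite integral_local_kill.
(* By symmetry the semigroup is moved from [g] to the indicator of [B], where it is at most 1, so a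
   late step costs no more than the first. The symmetry is stated for positive times; at time 0 the
   path is at its starting point. *)
have Isg k : (\int[mu]_(y in B) semigroup X (h * k%:R) g y <= (e' * h)%:E)%E.
  apply: le_trans Ig; have sg0 y := semigroup_ge0 X (h * k%:R) y g0.
  case: k sg0 => [|k] sg0.
    apply: (@le_trans _ _ (\int[mu]_(y in B) (g y)%:E)%E); last first.
      apply: ge0_subset_integral => //; first exact: mball.
      - exact/measurable_EFinP.
      - by move=> y _; rewrite lee_fin.
    apply: ge0_le_integral => //; first exact: mball.
    - by apply: measurable_funTS; exact: msg.
    - by apply/measurable_EFinP; exact: measurable_funTS.
    move=> y _; rewrite mulr0 /semigroup.
    have ms : measurable [set w | hX X 0 w = Some y].
      rewrite (_ : [set w | _] = hX X 0 @^-1` [set Some y])//.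
      by apply: measurable_hXA => //; exact: measurable_point.
    rewrite (@ae_eq_integral _ _ _ (P (Some y)) setT (cst (g y)%:E))//.
    - rewrite (_ : (\int[P (Some y)]_x _)%E = ((g y)%:E * P (Some y) setT)%E); last exact: integral_cst.
      by rewrite probability_setT mule1.
    - apply/measurable_EFinP.
      exact: (measurableT_comp (measurable_at_cemetery mg) (measurable_hX X (lexx 0))).
    have PN : P (Some y) (~` [set w | hX X 0 w = Some y]) = 0%E.
      by rewrite probability_setC// hP_start subee.
    exists (~` [set w | hX X 0 w = Some y]); split.
    - exact: measurableC.
    - exact: PN.
    - by move=> w /= + h1; apply; rewrite h1.
  have hk : 0 < h * k.+1%:R by rewrite mulr_gt0// ltr0n.
  rewrite (_ : (\int[mu]_(y in B) _ = \int[mu]_y (semigroup X (h * k.+1%:R) g y * (\1_B y)%:E))%E); last first.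
    rewrite integral_mkcond; apply: eq_integral => y _; rewrite patchE indicE.
    by case: ifPn; rewrite ?mule1 ?mule0.
  have [assoc _ _] := X_assoc.
  have mI : measurable_fun setT (\1_B : borel M -> R) by apply: measurable_indic; exact: mball.
  rewrite assoc//.
  have s1 y : (semigroup X (h * k.+1%:R) \1_B y <= 1)%E.
    rewrite semigroup_indic ?(ltW hk)//; last exact: mball.
    apply: probability_le1; apply: measurable_hXA; first exact: ltW.
    by apply: measurable_image_some; exact: mball.
  apply: ge0_le_integral => //.
  - by move=> y _; rewrite mule_ge0 ?lee_fin// semigroup_ge0.
  - apply: emeasurable_funM; first exact/measurable_EFinP.
    by apply: measurable_semigroup => //; exact: measurable_indic.
  - exact/measurable_EFinP.
  - by move=> y _; rewrite -[leRHS]mule1 lee_wpmul2l// lee_fin.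
apply: (@le_trans _ _ (\int[mu]_(y in B) (q%:E + \sum_(k < n) semigroup X (h * k%:R) g y))%E).
  apply: ge0_le_integral => //; first exact: mball.
  - by apply: measurable_funTS; apply: measurable_kill; exact: ltW.
  - apply: emeasurable_funD; first exact: measurable_cst.
    by apply: emeasurable_sum => k; apply: measurable_funTS; exact: msg.
rewrite ge0_integralD//; last 3 first.
- exact: mball.
- by move=> y _; apply: sume_ge0 => k _; exact: semigroup_ge0.
- by apply: emeasurable_sum => k; apply: measurable_funTS; exact: msg.
rewrite (integral_cst mu (mball x0 r0) q%:E).
rewrite (ge0_integral_sum mu (mball x0 r0)); last 2 first.
- by move=> k; apply: measurable_funTS; exact: msg.
- by move=> k y _; exact: semigroup_ge0.
rewrite -/B -(fineK muB) -EFinM -/m [e%:E](_ : _ = (e / 2)%:E + (e / 2)%:E)%E; last first.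
  by rewrite -EFinD -splitr.
apply: leeD; first by rewrite lee_fin.
apply: (@le_trans _ _ (\sum_(k < n) (e' * h)%:E)%E).
  by apply: lee_sum => k _; exact: Isg.
rewrite sumEFin lee_fin sumr_const card_ord -(mulr_natr (e' * h)) -mulrA hn /e' divfK// gt_eqF//.
Qed.

Lemma kill_null (T : R) : 0 < T -> mu [set y | (0 < kill T y)%E] = 0%E /\
  measurable ([set y | (0 < kill T y)%E] : set (borel M)).
Proof.
move=> T0; have mk := measurable_kill X (ltW T0).
have mset : measurable ([set y | (0 < kill T y)%E] : set (borel M)).
  by rewrite -[X in measurable X]setTI; exact: emeasurable_fun_o_infty.
split => //; pose x0 : M := point.
have cov : [set y | (0 < kill T y)%E] = \bigcup_n ([set y | (0 < kill T y)%E] `&` ball x0 n.+1%:R).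
  rewrite -setI_bigcupr [X in _ `&` X](_ : _ = setT) ?setIT//.
  apply/seteqP; split=> // y _; exists (Num.truncn (mdist x0 y)) => //.
  by rewrite mdist_ballE truncnS_gt.
rewrite cov; apply/eqP; rewrite -measure_le0.
apply: nondecreasing_bigcup_bound => [n|m n mn|n].
- by apply: measurableI => //; exact: mball.
- apply/subsetPset; apply: setIS => y; rewrite !mdist_ballE => /lt_le_trans; apply.
  by rewrite ler_nat ltnS.
have n0 : 0 < n.+1%:R :> R by rewrite ltr0n.
have := integral_kill_ball x0 T0 n0 => I0.
have : (\int[mu]_(y in ball x0 n.+1%:R) `|kill T y| = 0)%E.
  by rewrite -[RHS]I0; apply: eq_integral => y _; rewrite gee0_abs// kill_ge0.
move=> /(ae_eq_integral_abs mu (mball x0 _) (measurable_funTS mk))[N [mN muN sN]].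
apply: (@le_trans _ _ (mu N)); last by rewrite muN.
apply: le_measure; rewrite ?inE//.
  by apply: measurableI => //; exact: mball.
move=> y [/= ky yB]; apply: sN => /= /(_ yB) ky0.
by rewrite ky0 ltxx in ky.
Qed.

(** The passage from almost every to every starting point: by the on-diagonal bound the law at a
    time [s > 0] does not charge the null set where killing is possible, so the process cannot die
    after [s]. Hence being dead at time [t] is no more likely than being dead at any earlier
    positive time, and right-continuity at 0 makes the latter probability tend to 0. *)
Lemma conservative (x : M) (t : R) : 0 <= t -> P (Some x) (hX X t @^-1` [set None]) = 0%E.
Proof.
have md (s : R) : 0 <= s -> measurable (hX X s @^-1` [set None]).
  by move=> s0; apply: measurable_hXA => //; exact: measurable_dead.
have step (s T : R) : 0 < s -> 0 < T -> (kill (s + T) x <= kill s x)%E.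
  move=> s0 T0; have [mu0 mN] := kill_null T0.
  set N := [set y | _] in mu0 mN.
  have mSN := measurable_image_some mN.
  pose L := hX X s @^-1` (Some @` (~` N)).
  have hL : hF X s L.
    by apply: hX_hF => //; [exact: ltW|apply: measurable_image_some; exact: measurableC].
  have mL := hF_meas (ltW s0) hL.
  have mLs : measurable (L `&` hX X (s + T) @^-1` [set None]).
    by apply: measurableI => //; apply: md; rewrite addr_ge0// ltW.
  have mSs := measurable_hXA X (ltW s0) mSN.
  have P1 : P (Some x) (hX X s @^-1` (Some @` N)) = 0%E.
    by apply/eqP; rewrite -measure_le0 (le_trans (ondiag x s0 mN))// mu0 mule0.
  have P2 : P (Some x) (L `&` hX X (s + T) @^-1` [set None]) = 0%E.
    apply/eqP; rewrite -measure_le0.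
    have := @markov_ub _ _ _ _ X (Some x) s T L [set None] 0 (ltW s0) (ltW T0) hL (@measurable_dead R M) (lexx 0).
    rewrite mul0e; apply => w [y /= yN yw]; rewrite -yw.
    by move: yN => /negP; rewrite -leNgt.
  apply: (@le_trans _ _ (P (Some x) ((hX X s @^-1` [set None] `|` hX X s @^-1` (Some @` N)) `|` (L `&` hX X (s + T) @^-1` [set None])))).
    apply: le_measure; rewrite ?inE.
    - by apply: md; rewrite addr_ge0// ltW.
    - by apply: measurableU => //; apply: measurableU => //; apply: md; exact: ltW.
    move=> w /= XsT; case Es : (hX X s w) => [y|]; last by left; left.
    have [yN|yN] := pselect (N y); first by left; right; exists y.
    by right; split => //; rewrite /L /= Es; exists y.
  apply: le_trans (measureU2 _ _ _) _ => //.
    by apply: measurableU => //; apply: md; exact: ltW.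
  rewrite -[leRHS]adde0; apply: leeD; last by move: P2 => /eqP; rewrite eq_le => /andP[].
  apply: le_trans (measureU2 _ _ _) _ => //; first by apply: md; exact: ltW.
  by rewrite -[leRHS]adde0; apply: leeD => //; move: P1 => /eqP; rewrite eq_le => /andP[].
move=> t0; move: (t0); rewrite le_eqVlt => /predU1P[<-|t1].
  by apply: start_prob0 => //; exact: measurable_dead.
pose s (n : nat) := t / n.+1%:R.
have s0 n : 0 < s n by rewrite divr_gt0// ltr0n.
have sd m n : (m <= n)%N -> s n <= s m.
  by move=> mn; rewrite ler_pM2l// lef_pV2 ?posrE ?ltr0n// ler_nat ltnS.
pose K n : set Omega := hX X (s n) @^-1` (Some @` setT).
have mK n : measurable (K n) by apply: measurable_hXA; [exact: ltW|exact: measurable_alive].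
have Kle n : (P (Some x) (K n) <= 1 - kill t x)%E.
  rewrite /K (probability_alive _ _ (ltW (s0 n))) leeB//.
  have [->|sn] := eqVneq (s n) t; first exact: lexx.
  have st : s n < t.
    by rewrite lt_neqAle sn ler_pdivrMr ?ltr0n// ler_peMr// ler1n.
  by have := @step (s n) (t - s n) (s0 n); rewrite subr_gt0 st addrC subrK; apply.
have ndK : nondecreasing_seq K.
  move=> m n mn; apply/subsetPset => w [y _ yw].
  rewrite /K /=; case En : (hX X (s n) w) => [z|]; first by exists z.
  have := hX_cemetery (ltW (s0 n)) (sd m n mn) En.
  by rewrite -yw.
have := nondecreasing_bigcup_bound mK ndK Kle.
have PU : (1 <= P (Some x) (\bigcup_n K n))%E.
  rewrite -(hP_start X (Some x)); apply: le_measure; rewrite ?inE.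
  - rewrite (_ : [set w | _] = hX X 0 @^-1` [set Some x])//.
    by apply: measurable_hXA => //; exact: measurable_point.
  - exact: bigcupT_measurable.
  move=> w /= Xw.
  have : nbhs (hX X 0 w) (Some @` [set: M] : set (opc M)).
    by rewrite Xw; apply: open_nbhs_nbhs; split; [apply: one_point_compactification_open_some; exact: openT|exists x].
  move=> /(@hX_rcont _ _ _ _ X 0 w (lexx 0))[e /= e0 eP].
  have [n _ /(_ n (leqnn n))] := near_infty_natSinv_lt (PosNum (divr_gt0 e0 t1)).
  rewrite /= ltr_pdivlMr// mulrC => sn.
  by exists n => //; apply: eP => //=; rewrite sub0r normrN gtr0_norm.
move=> /(le_trans PU); rewrite -kill_fin// -EFinB lee_fin => h; rewrite -/(kill t x) -kill_fin//.
apply/eqP; rewrite eqe eq_le; apply/andP; split; first by lra.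
by rewrite -lee_fin kill_fin// kill_ge0.
Qed.

End conservative.

(** * Exit and confinement probabilities *)

Section exit_estimates.
Context {R : realType} {M : pmetricType R} {d : measure_display}
  {Omega : measurableType d}.
Variables (mu : {measure set (borel M) -> \bar R}) (V phi : R -> R).
Variable (X : hunt_process M Omega).
Local Notation S := (borel (opc M)).
Local Notation P := (hP X).
Hypothesis M_balls : forall (x : M) (r : R), precompact (ball x r).
Hypotheses (VS : weak_scaling V) (phiS : weak_scaling phi).
Variables (Cstar Ct Cu Cl : R).
Hypotheses (Cstar1 : 1 <= Cstar) (mu_ball : volume_comparable mu V Cstar).
Hypotheses (Ct0 : 0 < Ct) (tail : tail_bound phi X Ct).
Hypotheses (Cu0 : 0 < Cu) (ondiag : on_diag_bound mu V phi X Cu).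
Hypotheses (Cl0 : 0 < Cl) (lowb : lower_bound mu V phi X Cl).
Hypothesis cons : forall (x : M) (t : R), 0 <= t -> P (Some x) (hX X t @^-1` [set None]) = 0%E.

Definition near_set (x0 : M) (r : R) : set (opc M) := [set z | (Defs.edist x0 z <= r%:E)%E].
Definition esc (x0 : M) (r : R) : set (opc M) := [set z | (r%:E < Defs.edist x0 z)%E].

Lemma near_setC x0 r : ~` near_set x0 r = esc x0 r.
Proof.
by apply/seteqP; split=> z /=; rewrite /near_set /esc /= ltNge => /negP.
Qed.

Lemma measurable_near_set x0 r : measurable (near_set x0 r : set S).
Proof. exact: measurable_near. Qed.

Lemma open_esc x0 r : open (esc x0 r). Proof. exact: open_far. Qed.

Lemma measurable_esc x0 r : measurable (esc x0 r : set S).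
Proof. exact: (openS (@open_esc x0 r)). Qed.

Let surv1 (x : M) (t : R) : 0 < t -> (1%:E <= P (Some x) (hX X t @^-1` (Some @` setT)))%E.
Proof. by move=> t0; rewrite probability_alive ?(ltW t0)// cons ?sube0// ltW. Qed.

Lemma dead_stays (t : R) : 0 <= t -> P None (hX X t @^-1` [set None]) = 1%E.
Proof.
move=> t0; have mD := measurable_hXA X t0 (@measurable_dead R M).
apply/eqP; rewrite eq_le probability_le1//=.
rewrite -(hP_start X None); apply: le_measure; rewrite ?inE//.
- rewrite (_ : [set w | _] = hX X 0 @^-1` [set None])//.
  by apply: measurable_hXA => //; exact: measurable_dead.
- by move=> w /= /(hX_cemetery (lexx 0) t0).
Qed.

Lemma dead_null (t : R) (A : set S) : 0 <= t -> measurable A -> ~ A None -> P None (hX X t @^-1` A) = 0%E.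
Proof.
move=> t0 mA nA; have mD := measurable_hXA X t0 (@measurable_dead R M).
apply/eqP; rewrite eq_le measure_ge0 andbT.
apply: (@le_trans _ _ (P None (~` (hX X t @^-1` [set None])))).
  apply: le_measure; rewrite ?inE.
  - exact: measurable_hXA.
  - exact: measurableC.
  - by move=> w /= Aw Xw; apply: nA; rewrite -Xw.
by rewrite probability_setC// dead_stays// subee.
Qed.

(** [hit_far_le], now with survival constant 1. When its smallness condition fails, the asserted
    bound exceeds 1 and is trivial. *)
Lemma escape_le : exists2 C, 0 < C & forall (x : M) (T r : R), 0 < T -> 0 < r ->
  (P (Some x) (hit X 0 T (esc x r)) <= (C * (T / phi r))%:E)%E.
Proof.
have [K K0 KP] := @scale_bound _ _ phiS 2 (ltr0n _ 2).
exists (2 * Ct * K); first by rewrite !mulr_gt0.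
move=> x T r T0 r0; have r2 : 0 < r / 2 by rewrite divr_gt0.
have p2 : 0 < phi (r / 2) := scale_gt0 phiS r2; have pr : 0 < phi r := scale_gt0 phiS r0.
have pp : phi r <= K * phi (r / 2) by have := KP _ r2; rewrite mulrCA divff ?mulr1.
have TT : 2 * (Ct * (T / phi (r / 2))) <= 2 * Ct * K * (T / phi r).
  have : (phi (r / 2))^-1 <= K / phi r by rewrite ler_pdivlMr// mulrC ler_pdivrMr.
  by rewrite -!mulrA ler_pM2l// ler_pM2l// mulrCA ler_pM2l.
have mh : measurable (hit X 0 T (esc x r)).
  by have := hF_hit X (lexx 0) T0 (@open_esc x r); rewrite add0r; apply: hF_meas; exact: ltW.
have mf : measurable (hit X 0 T (far_set x r)).
  by have := hF_hit X (lexx 0) T0 (@open_far_set R M x r); rewrite add0r; apply: hF_meas; exact: ltW.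
have mD := measurable_hXA X (ltW T0) (@measurable_dead R M).
have sub : hit X 0 T (esc x r) `<=` hit X 0 T (far_set x r) `|` hX X T @^-1` [set None].
  move=> w [s]; rewrite add0r => /andP[s0 sT]; rewrite /esc /=.
  case E1 : (hX X s w) => [z|] /=; last by move=> _; right; exact: hX_cemetery s0 sT E1.
  rewrite lte_fin metric_sym => rz; left; exists s; first by rewrite add0r s0.
  by rewrite E1; exists z.
have le1 : (P (Some x) (hit X 0 T (esc x r)) <= P (Some x) (hit X 0 T (far_set x r)))%E.
  apply: (@le_trans _ _ (P (Some x) (hit X 0 T (far_set x r) `|` hX X T @^-1` [set None]))).
    by apply: le_measure; rewrite ?inE//; exact: measurableU.
  apply: le_trans (measureU2 _ mf mD) _; rewrite -[leRHS]adde0; apply: leeD => //.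
  by move: (cons x (ltW T0)) => /eqP; rewrite eq_le => /andP[].
have [h|h] := leP (Ct * (T / phi (r / 2))) (1 / 2).
  have x2 : mdist x x < r / 2 by rewrite mdistxx.
  have := hit_far_le phiS ltr01 surv1 Ct0 tail T0 r0 x2 h.
  rewrite mdistxx subr0 -lee_pdivlMl ?divr_gt0// div1r invrK -EFinM => h2.
  apply: (le_trans le1); apply: (le_trans h2); rewrite lee_fin//.
apply: (@le_trans _ _ 1%E); first exact: probability_le1.
by rewrite lee_fin (le_trans _ TT)//; lra.
Qed.

(** By the on-diagonal bound the probability is at most a constant times
    [V (2 * r) / V (ginv phi T)]. For [T] large compared with [phi r] the radius [ginv phi T] is so
    much larger than [2 * r] that reverse doubling of [V] gives 1/2, from any starting point. *)
Lemma return_half : exists2 A, 0 < A & forall (x0 : M) (z : opc M) (r T : R), 0 < r -> A * phi r <= T ->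
  (P z (hX X T @^-1` near_set x0 r) <= (1 / 2)%:E)%E.
Proof.
have Cs0 : 0 < Cstar by rewrite (lt_le_trans _ Cstar1).
have [l l1 lP] := scale_grow VS (2 * Cu * Cstar).
have l20 : 0 < l * 2 by rewrite mulr_gt0// (lt_trans _ l1).
have [A A0 AP] := ginv_grow phiS l20.
exists A => // x0 z r T r0 AT; have T0 : 0 < T by rewrite (lt_le_trans _ AT)// mulr_gt0// (scale_gt0 phiS).
have mN := measurable_near_set x0 r.
case: z => [y|]; last by rewrite (dead_null (ltW T0) mN)// /near_set /= leye_eq.
have mB : measurable (ball x0 (2 * r) : set (borel M)) by apply: openM; exact: open_ball_metric.
have r20 : 0 < 2 * r by rewrite mulr_gt0.
apply: (@le_trans _ _ (P (Some y) (hX X T @^-1` (Some @` ball x0 (2 * r))))).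
  apply: le_measure; rewrite ?inE.
  - by apply: measurable_hXA => //; exact: ltW.
  - by apply: measurable_hXA; [exact: ltW|exact: measurable_image_some].
  - move=> w /= /edist_some[y' -> yr]; exists y' => //; rewrite mdist_ballE metric_sym.
    by rewrite (le_lt_trans yr)// mulr_natl mulr2n ltrDl.
apply: (le_trans (ondiag y T0 mB)).
have g0 : 0 < ginv phi T := ginv_gt0 phiS T0.
have Vg := scale_gt0 VS g0; have V2 := scale_gt0 VS r20.
apply: (@le_trans _ _ ((Cu / V (ginv phi T))%:E * (Cstar * V (2 * r))%:E)%E).
  by apply: lee_wpmul2l; [rewrite lee_fin divr_ge0// ltW|exact: (mu_ball x0 r20).2].
rewrite -EFinM lee_fin mulrAC ler_pdivrMr//.
have := lP _ r20; have : V (l * (2 * r)) <= V (ginv phi T).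
  by apply: (scale_le VS); [rewrite mulrA mulr_gt0|rewrite mulrA; exact: AP].
by lra.
Qed.

(** Confinement entails being near [x0] at the end of each of [n] blocks of length [A * phi r]; by
    [return_half] and the Markov property each block costs a factor 1/2. *)
Lemma confined_le : exists2 A, 0 < A & forall (x0 : M) (z : opc M) (r t : R) n, 0 < r ->
  0 < t -> A * phi r * n%:R <= t ->
  (P z (~` hit X 0 t (esc x0 r)) <= (2^-1 ^+ n)%:E)%E.
Proof.
have [A A0 AP] := return_half; exists A => // x0 z r t n r0 t0 nt.
pose T := A * phi r; have T0 : 0 < T by rewrite mulr_gt0// (scale_gt0 phiS).
have mN := measurable_near_set x0 r.
pose L := fix L (k : nat) : set Omega := if k is j.+1 then L j `&` hX X (T * j%:R + T) @^-1` near_set x0 r else setT.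
have Tk0 (k : nat) : 0 <= T * k%:R by rewrite mulr_ge0// ltW.
have TS (k : nat) : T * k%:R + T = T * k.+1%:R by rewrite -natr1 mulrDr mulr1.
have hL k : hF X (T * k%:R) (L k).
  elim: k => [|k IH] /=; first exact: hF_T.
  rewrite TS; apply: hF_I => //; last exact: hX_hF.
  by apply: hF_mono IH => //; rewrite ler_pM2l// ler_nat.
have PL k : (P z (L k) <= (2^-1 ^+ k)%:E)%E.
  elim: k => [|k IH] /=; first by rewrite probability_setT.
  apply: (@le_trans _ _ ((1 / 2)%:E * P z (L k))%E).
    apply: markov_ub => //; first exact: ltW.
    by move=> w _; apply: AP.
  by rewrite div1r exprS (EFinM 2^-1) lee_pmul// lee_fin invr_ge0.
apply: le_trans (PL n); apply: le_measure; rewrite ?inE.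
- apply: measurableC; have := hF_hit X (lexx 0) t0 (@open_esc x0 r).
  by rewrite add0r; apply: hF_meas; exact: ltW.
- exact: hF_meas (hL n).
move=> w nh; elim: n nt => [//|n IH] nt /=; split.
  by apply: IH; apply: le_trans nt; rewrite ler_pM2l// ler_nat.
apply: contrapT => Hn; apply: nh; exists (T * n%:R + T); last by rewrite -near_setC.
by rewrite add0r TS Tk0.
Qed.

(** In time [e * phi r] a return to the inner ball has probability at least [a * e]. A path that
    leaves radius [5 r] and still returns makes two long displacements, each of probability of order
    [e], so the loss is at most [2 * Ct ^+ 2 * e ^+ 2]. For small [e] this is at most half of the
    gain. *)
Lemma confined_step : exists2 e, 0 < e & exists2 k, 0 < k &
  forall (x : opc M) (x0 : M) (r t0 : R) (L : set Omega), 0 < r -> 0 <= t0 -> hF X t0 L ->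
  L `<=` hX X t0 @^-1` near_set x0 r ->
  (k%:E * P x L <= P x (L `&` ~` hit X t0 (e * phi r) (esc x0 (5 * r)) `&` hX X (t0 + e * phi r) @^-1` near_set x0 r))%E.
Proof.
have Cs0 : 0 < Cstar by rewrite (lt_le_trans _ Cstar1).
have [Kp Kp0 KpP] := @scale_bound _ _ phiS 2 (ltr0n _ 2).
have [Kv Kv0 KvP] := @scale_bound _ _ VS 2 (ltr0n _ 2).
pose a := Cl / (Kp * Kv * Cstar); have a0 : 0 < a by rewrite divr_gt0// !mulr_gt0.
(* The four bounds serve, in turn, [ginv phi T <= r], the first term of the kernel minimum,
   [Ct * e <= 1 / 2], and the comparison of the loss with [a * e / 2]. *)
pose e := Num.min (Num.min 1 (Kv * Kp)) (Num.min (1 / (2 * Ct)) (a / (4 * Ct ^+ 2))).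
have e0 : 0 < e by rewrite !lt_min ltr01 !divr_gt0 ?mulr_gt0// exprn_gt0.
have e1 : e <= 1 by rewrite /e !ge_min lexx.
have eK : e <= Kv * Kp by rewrite /e !ge_min lexx !orbT.
have eC : Ct * e <= 1 / 2.
  have : e <= 1 / (2 * Ct) by rewrite /e !ge_min lexx !orbT.
  by rewrite ler_pdivlMr ?mulr_gt0//; lra.
have ea : 2 * Ct ^+ 2 * e <= a / 2.
  have : e <= a / (4 * Ct ^+ 2) by rewrite /e !ge_min lexx !orbT.
  by rewrite ler_pdivlMr ?mulr_gt0 ?exprn_gt0//; lra.
exists e => //; exists (a * e / 2); first by rewrite divr_gt0// mulr_gt0.
move=> x x0 r t0 L r0 t00 hL Lr; have mL := hF_meas t00 hL.
have pr := scale_gt0 phiS r0; have Vr := scale_gt0 VS r0.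
set T := e * phi r; have T0 : 0 < T by rewrite mulr_gt0.
have tT0 : 0 <= t0 + T by rewrite addr_ge0// ltW.
have r2 : 0 < 2 * r by rewrite mulr_gt0.
have p2 := scale_gt0 phiS r2; have V2 := scale_gt0 VS r2.
have small s rho : s <= T -> r <= rho -> Ct * (s / phi rho) <= Ct * e.
  move=> sT rr; rewrite ler_pM2l// ler_pdivrMr; last by rewrite (scale_gt0 phiS)// (lt_le_trans r0).
  by apply: (le_trans sT); rewrite ler_pM2l// (scale_le phiS).
have mN := measurable_near_set x0 r.
have mXN := measurable_hXA X tT0 mN.
set D := esc x0 (5 * r); have oD : open D := @open_esc x0 (5 * r).
have mH : measurable (hit X t0 T D) by apply: hF_meas tT0 _; exact: hF_hit.
have lb : ((a * e)%:E * P x L <= P x (L `&` hX X (t0 + T) @^-1` near_set x0 r))%E.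
  apply: markov_lb => //; [exact: ltW|by rewrite mulr_ge0// ltW|].
  move=> w /Lr /edist_some[y -> yr].
  have mB : measurable (ball x0 r : set (borel M)) by apply: openM; exact: open_ball_metric.
  apply: (@le_trans _ _ (P (Some y) (hX X T @^-1` (Some @` ball x0 r)))); last first.
    apply: le_measure; rewrite ?inE.
    - by apply: measurable_hXA; [exact: ltW|exact: measurable_image_some].
    - by apply: measurable_hXA => //; exact: ltW.
    - move=> w' [z zr zE]; rewrite /near_set /= -zE /= lee_fin metric_sym ltW//.
      by move: zr; rewrite mdist_ballE.
  have sub : ball x0 r `<=` ball y (2 * r).
    move=> z; rewrite !mdist_ballE => zr; have := metric_triangle y x0 z; lra.
  apply: le_trans (lower_bound_set lowb T0 r2 mB sub).
  have Tr : ginv phi T <= r by apply: (ginv_le phiS) => //; rewrite /T ler_piMl// ltW.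
  have g0 := ginv_gt0 phiS T0; have Vg := scale_gt0 VS g0.
  have mlow : e / (Kv * Kp * V r) <= Num.min (V (ginv phi T))^-1 (T / (V (2 * r) * phi (2 * r))).
    rewrite le_min; apply/andP; split.
      apply: (@le_trans _ _ (V r)^-1); last by rewrite lef_pV2 ?posrE// (scale_le VS).
      by rewrite invfM mulrA ler_piMl ?invr_ge0 ?(ltW Vr)// ler_pdivrMr ?mulr_gt0// mul1r.
    rewrite ler_pdivrMr ?mulr_gt0// mulrAC ler_pdivlMr ?mulr_gt0//.
    rewrite /T -!mulrA ler_pM2l//.
    have := KvP _ r0; have := KpP _ r0 => h1 h2.
    apply: le_trans (ler_pM (ltW V2) (ltW p2) h2 h1) _.
    by rewrite le_eqVlt; apply/orP; left; apply/eqP; ring.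
  apply: (@le_trans _ _ ((Cl * (e / (Kv * Kp * V r)))%:E * (Cstar^-1 * V r)%:E)%E).
    rewrite -EFinM lee_fin le_eqVlt; apply/orP; left; apply/eqP; rewrite /a; field.
    by rewrite !gt_eqF.
  apply: lee_pmul.
  - by rewrite lee_fin mulr_ge0 ?divr_ge0// ltW// !mulr_gt0.
  - by rewrite lee_fin mulr_ge0 ?invr_ge0// ltW.
  - by rewrite lee_fin ler_pM2l.
  - exact: (mu_ball x0 r0).1.
have Le0 : 0 <= Ct * e by rewrite mulr_ge0// ltW.
(* The second displacement: from beyond [5 r] back into the inner ball. *)
have ub1 : (P x (L `&` hit X t0 T D `&` hX X (t0 + T) @^-1` near_set x0 r) <= (Ct * e)%:E * P x (L `&` hit X t0 T D))%E.
  apply: hit_ub => // z s Dz /andP[s0 sT].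
  move: s0; rewrite le_eqVlt => /predU1P[<-|s0].
    by rewrite start_prob0 ?lee_fin// => zN; move: Dz; rewrite /D -near_setC; apply; apply: le_trans zN _; rewrite lee_fin; lra.
  case: z Dz => [z|] Dz; last by rewrite (dead_null (ltW s0) mN) ?lee_fin// /near_set /= leye_eq.
  move: Dz; rewrite /D /esc /= lte_fin => Dz.
  apply: (@le_trans _ _ (P (Some z) (hX X s @^-1` (Some @` [set y : M | (r <= mdist z y)%R])))).
    apply: le_measure; rewrite ?inE.
    - by apply: measurable_hXA => //; exact: ltW.
    - by apply: measurable_hXA; [exact: ltW|apply: measurable_image_some; exact: far_measurable].
    - move=> w /= /edist_some[y -> yr]; exists y => //=.
      by have := metric_triangle z y x0; lra.
  by apply: (le_trans (tail z s0 r0)); rewrite lee_fin small.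
have mA := measurable_esc x0 (3 * r).
(* The first displacement is bounded through the final position: a path that reached [5 r] is still
   beyond [3 r] at the end with probability at least 1/2, and [ub3] bounds that position. *)
have ub2 : ((1 / 2)%:E * P x (L `&` hit X t0 T D) <= P x (L `&` hit X t0 T D `&` hX X (t0 + T) @^-1` esc x0 (3 * r)))%E.
  apply: hit_lb => //.
  move=> z s Dz /andP[s0 sT]; case: z Dz => [z|] Dz; last first.
    apply: (@le_trans _ _ 1%E); first by rewrite lee_fin; lra.
    rewrite -(dead_stays s0); apply: le_measure; rewrite ?inE.
    - by apply: measurable_hXA => //; exact: measurable_dead.
    - exact: measurable_hXA.
    - by move=> w /= ->; rewrite /esc /= ltry.
  move: Dz; rewrite /D /esc /= lte_fin => Dz.
  apply: (@le_trans _ _ (P (Some z) (hX X s @^-1` (Some @` ball z (2 * r))))).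
    apply: (stay_lb ltr01 surv1 tail) => //; apply: le_trans eC; apply: small => //.
    by rewrite mulr_natl mulr2n lerDl ltW.
  apply: le_measure; rewrite ?inE.
  - by apply: measurable_hXA => //; apply: measurable_image_some; apply: openM; exact: open_ball_metric.
  - exact: measurable_hXA.
  - move=> w [y + yE]; rewrite mdist_ballE /esc /= -yE /= lte_fin => zy.
    by have := metric_triangle z y x0; lra.
have ub3 : (P x (L `&` hX X (t0 + T) @^-1` esc x0 (3 * r)) <= (Ct * e)%:E * P x L)%E.
  apply: markov_ub => //; first exact: ltW.
  move=> w /Lr /edist_some[y -> yr].
  have mF := measurable_hXA X (ltW T0) (measurable_image_some (far_measurable y (2 * r))).
  have mDe := measurable_hXA X (ltW T0) (@measurable_dead R M).
  apply: (@le_trans _ _ (P (Some y) (hX X T @^-1` (Some @` [set z : M | (2 * r <= mdist y z)%R]) `|` hX X T @^-1` [set None]))).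
    apply: le_measure; rewrite ?inE.
    - by apply: measurable_hXA => //; exact: ltW.
    - exact: measurableU.
    - move=> w'; rewrite /esc /=; case: (hX X T w') => [z|] /=; last by right.
      rewrite lte_fin => rz; left; exists z => //=.
      by have := metric_triangle z y x0; rewrite (metric_sym z y); lra.
  apply: le_trans (measureU2 _ mF mDe) _; rewrite -[leRHS]adde0; apply: leeD.
    apply: (le_trans (tail y T0 r2)); rewrite lee_fin small//.
    by rewrite mulr_natl mulr2n lerDl ltW.
  by move: (cons y (ltW T0)) => /eqP; rewrite eq_le => /andP[].
have mLH : measurable (L `&` hit X t0 T D) by exact: measurableI.
have ub4 : (P x (L `&` hit X t0 T D `&` hX X (t0 + T) @^-1` esc x0 (3 * r)) <= P x (L `&` hX X (t0 + T) @^-1` esc x0 (3 * r)))%E.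
  apply: le_measure; rewrite ?inE.
  - by apply: measurableI => //; exact: measurable_hXA.
  - by apply: measurableI => //; exact: measurable_hXA.
  - by move=> w [[]].
have split_P : P x (L `&` hX X (t0 + T) @^-1` near_set x0 r) =
    (P x (L `&` hit X t0 T D `&` hX X (t0 + T) @^-1` near_set x0 r) +
     P x (L `&` ~` hit X t0 T D `&` hX X (t0 + T) @^-1` near_set x0 r))%E.
  rewrite -measureU; last 3 first.
  - exact: measurableI.
  - by apply: measurableI => //; apply: measurableI => //; exact: measurableC.
  - by apply/seteqP; split => // w [[[_ h1] _] [[_ h2] _]].
  congr (P x _); apply/seteqP; split=> w.
    by move=> [Lw Nw]; have [Hw|Hw] := pselect (hit X t0 T D w); [left|right].
  by case=> -[[]].
have mL2 : measurable (L `&` ~` hit X t0 T D `&` hX X (t0 + T) @^-1` near_set x0 r).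
  by apply: measurableI => //; apply: measurableI => //; exact: measurableC.
have mL3 : measurable (L `&` hX X (t0 + T) @^-1` esc x0 (3 * r)) by apply: measurableI => //; exact: measurable_hXA.
have mL4 : measurable (L `&` hit X t0 T D `&` hX X (t0 + T) @^-1` near_set x0 r) by exact: measurableI.
have := le_trans ub2 ub4 => {ub4}ub2; move: lb; rewrite split_P => lb.
have f1 := fin_num_measure (P x) _ mL; have f2 := fin_num_measure (P x) _ mLH.
have f3 := fin_num_measure (P x) _ mL2; have f4 := fin_num_measure (P x) _ mL3.
have f5 := fin_num_measure (P x) _ mL4.
have P0 : (0 <= P x L)%E by exact: measure_ge0.
move: lb ub1 ub2 ub3 P0; rewrite -(fineK f1) -(fineK f2) -(fineK f3) -(fineK f4) -(fineK f5).
set p1 := fine _; set p2' := fine _; set p3 := fine _; set p4 := fine _; set p5 := fine _.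
rewrite -!EFinM -!EFinD !lee_fin => lb ub1 ub2 ub3 P0.
have h1 : p4 <= 2 * (Ct * e * p1) by lra.
have h2 : Ct * e * p4 <= Ct * e * (2 * (Ct * e * p1)) by rewrite ler_wpM2l// mulr_ge0// ltW.
have h3 : 2 * Ct ^+ 2 * e * (e * p1) <= a / 2 * (e * p1) by rewrite ler_wpM2r// mulr_ge0// ltW.
have h4 : Ct * e * (2 * (Ct * e * p1)) = 2 * Ct ^+ 2 * e * (e * p1) by ring.
have h5 : a * e / 2 * p1 = a / 2 * (e * p1) by field.
have h6 : a * e * p1 = 2 * (a / 2 * (e * p1)) by field.
by lra.
Qed.

(** The induction also keeps the final position in the inner ball, from which the next step can
    start. An arbitrary initial event [L] is allowed so that trials can later be chained to the
    past. *)
Lemma confined_ge : exists2 e, 0 < e & exists2 k, 0 < k &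
  forall (x : opc M) (x0 : M) (r t0 : R) (L : set Omega) n, 0 < r -> 0 <= t0 -> hF X t0 L ->
  L `<=` hX X t0 @^-1` near_set x0 r ->
  exists L', [/\ hF X (t0 + e * phi r * n%:R) L', L' `<=` L,
    L' `<=` ~` hit X t0 (e * phi r * n%:R) (esc x0 (5 * r)) & ((k ^+ n)%:E * P x L <= P x L')%E].
Proof.
have [e e0 [k k0 ekP]] := confined_step; exists e => //; exists k => // x x0 r t0 L n r0 t00 hL Lr.
have pr := scale_gt0 phiS r0; have T0 : 0 < e * phi r by rewrite mulr_gt0.
suff [L' [h1 h2 h3 h4 _]] : exists L', [/\ hF X (t0 + e * phi r * n%:R) L', L' `<=` L,
    L' `<=` ~` hit X t0 (e * phi r * n%:R) (esc x0 (5 * r)), ((k ^+ n)%:E * P x L <= P x L')%E &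
    L' `<=` hX X (t0 + e * phi r * n%:R) @^-1` near_set x0 r] by exists L'.
elim: n => [|n [L' [h1 h2 h3 h4 h5]]].
  exists L; rewrite mulr0 addr0 expr0 mul1e; split => //.
  move=> w Lw [s]; rewrite addr0 => ts; have -> : s = t0 by apply/eqP; rewrite eq_le andbC.
  rewrite /esc /= ltNge => /negP; apply; apply: le_trans (Lr w Lw) _.
  by rewrite lee_fin; lra.
set t1 := t0 + e * phi r * n%:R in h1 h5 *.
have t10 : 0 <= t1 by rewrite addr_ge0// mulr_ge0// ltW.
have tS : t0 + e * phi r * n.+1%:R = t1 + e * phi r by rewrite -natr1 mulrDr mulr1 addrA.
have tT0 : 0 <= t1 + e * phi r by rewrite addr_ge0// ltW.
exists (L' `&` ~` hit X t1 (e * phi r) (esc x0 (5 * r)) `&` hX X (t1 + e * phi r) @^-1` near_set x0 r).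
split.
- rewrite tS; apply: hF_I => //.
    apply: hF_I => //; first by apply: hF_mono h1 => //; rewrite lerDl ltW.
    by apply: hF_C => //; apply: hF_hit => //; exact: open_esc.
  by apply: hX_hF => //; exact: measurable_near_set.
- by move=> w [[/h2]].
- move=> w [[L'w nh] _] [s /andP[s1 s2] sD].
  have [st|st] := leP s t1.
    by apply: (h3 w L'w); exists s => //; rewrite s1.
  by apply: nh; exists s => //; rewrite (ltW st) -tS.
- rewrite exprS EFinM -muleA; apply: le_trans (ekP x x0 r t1 L' r0 t10 h1 h5).
  by apply: lee_wpmul2l => //; rewrite lee_fin ltW.
- by rewrite tS => w [].
Qed.

End exit_estimates.

(** * Zero-one law *)

Section cylinder_sigma_algebra.
Context {R : realType} {M : pmetricType R} {d : measure_display}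
  {Omega : measurableType d} (X : hunt_process M Omega).
Local Notation S := (borel (opc M)).
Local Notation G := (<<s cylinders X >>).

Lemma cyl_at (s : R) (A : set S) : 0 <= s -> measurable A -> G (hX X s @^-1` A).
Proof.
move=> s0 mA; apply: sub_gen_smallest; exists [:: s], (fun=> A); split => //.
  by move=> s'; rewrite inE => /eqP->.
apply/seteqP; split=> w /= => [Aw s'|/(_ s (mem_head _ _))//].
by rewrite inE => /eqP->.
Qed.

Lemma cylC A : G A -> G (~` A).
Proof. exact: (@measurableC _ (g_sigma_algebraType (cylinders X))). Qed.

Lemma cyl_bigcup_rat (F : rat -> set Omega) : (forall i, G (F i)) -> G (\bigcup_i F i).
Proof. exact: (@bigcupT_measurable_rat _ (g_sigma_algebraType (cylinders X))). Qed.

Lemma cyl_exists_rat (Q : rat -> Prop) (F : rat -> set Omega) : (forall i, Q i -> G (F i)) ->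
  G [set w | exists i, Q i /\ F i w].
Proof.
move=> GF; rewrite (_ : [set _ | _] = \bigcup_i (if `[< Q i >] then F i else set0)).
  apply: cyl_bigcup_rat => i; case: asboolP => [/GF//|_].
  exact: (@measurable0 _ (g_sigma_algebraType (cylinders X))).
apply/seteqP; split=> w /= => [[i [Qi Fi]]|[i _]].
  by exists i => //; rewrite asboolT.
by case: asboolP => // Qi Fi; exists i.
Qed.

Lemma cyl_forall_rat (Q : rat -> Prop) (F : rat -> set Omega) : (forall i, Q i -> G (F i)) ->
  G [set w | forall i, Q i -> F i w].
Proof.
move=> GF; rewrite (_ : [set _ | _] = ~` [set w | exists i, Q i /\ (~` F i) w]).
  by apply: cylC; apply: cyl_exists_rat => i Qi; apply: cylC; exact: GF.
apply/seteqP; split=> w /= => [h [i [Qi]]|h i Qi]; first by apply; exact: h.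
by apply: contrapT => nF; apply: h; exists i.
Qed.

Lemma cyl_forall_nat (F : nat -> set Omega) : (forall n, G (F n)) -> G [set w | forall n, F n w].
Proof.
move=> GF; rewrite (_ : [set _ | _] = \bigcap_n F n).
  exact: (@bigcapT_measurable _ (g_sigma_algebraType (cylinders X))).
by apply/seteqP; split=> w /= => [h n _|h n]; exact: h.
Qed.

Lemma cylinder_hF C : cylinders X C -> exists2 n : nat, (0 < n)%N & hF X n%:R C.
Proof.
move=> [l [A [l0 mA ->]]].
have [n n0 nl] : exists2 n : nat, (0 < n)%N & forall s, s \in l -> s <= n%:R.
  elim: l {l0} => [|s l [n n0 nl]]; first by exists 1%N.
  exists (maxn n (Num.truncn s).+1); first by rewrite leq_max n0.
  move=> s'; rewrite inE => /predU1P[->|/nl s'n].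
    by rewrite (le_trans (ltW (truncnS_gt s)))// ler_nat leq_maxr.
  by rewrite (le_trans s'n)// ler_nat leq_maxl.
exists n => //; elim: l l0 nl => [|s l IH] l0 nl.
  rewrite (_ : [set _ | _] = setT); first exact: hF_T.
  by apply/seteqP; split.
rewrite (_ : [set _ | _] = hX X s @^-1` A s `&` [set w | forall s, s \in l -> A s (hX X s w)]).
  apply: hF_I => //.
    by apply: hX_hF; [apply: l0|apply: nl|]; rewrite ?inE ?eqxx.
  by apply: IH => s' s'l; [apply: l0|apply: nl]; rewrite inE s'l orbT.
apply/seteqP; split=> w /=.
  by move=> h; split=> [|s' s'l]; apply: h; rewrite inE ?eqxx// s'l orbT.
by move=> [h1 h2] s'; rewrite inE => /predU1P[->//|/h2].
Qed.

End cylinder_sigma_algebra.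

Section zero_one.
Context {R : realType} {M : pmetricType R} {d : measure_display}
  {Omega : measurableType d}.
Variables (mu : {measure set (borel M) -> \bar R}) (V phi : R -> R).
Variable (X : hunt_process M Omega).
Local Notation S := (borel (opc M)).
Local Notation P := (hP X).
Hypothesis M_balls : forall (x : M) (r : R), precompact (ball x r).
Hypotheses (VS : weak_scaling V) (phiS : weak_scaling phi).
Variables (Cstar Ct Cl : R).
Hypotheses (Cstar1 : 1 <= Cstar) (mu_ball : volume_comparable mu V Cstar).
Hypotheses (Ct0 : 0 < Ct) (tail : tail_bound phi X Ct).
Hypotheses (Cl0 : 0 < Cl) (lowb : lower_bound mu V phi X Cl).
Hypothesis cons : forall (x : M) (t : R), 0 <= t -> P (Some x) (hX X t @^-1` [set None]) = 0%E.

Let measurable_sem (t : R) (f : borel M -> R) : 0 <= t -> measurable_fun setT f ->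
  measurable_fun setT (fun w => (at_cemetery0 f (hX X t w))%:E).
Proof.
move=> t0 mf; apply/measurable_EFinP.
exact: (measurableT_comp (measurable_at_cemetery mf) (measurable_hX X t0)).
Qed.

Lemma semigroup_cst (t k : R) (x : M) : 0 <= t -> 0 <= k -> semigroup X t (fun=> k) x = k%:E.
Proof.
move=> t0 k0; rewrite /semigroup.
have mD := measurable_hXA X t0 (@measurable_dead R M).
rewrite (@ae_eq_integral _ _ _ (P (Some x)) setT (cst k%:E))//.
- rewrite (_ : (\int[P (Some x)]_x _)%E = (k%:E * P (Some x) setT)%E); last exact: integral_cst.
  by rewrite probability_setT mule1.
- by apply: measurable_sem => //; exact: measurable_cst.
exists (hX X t @^-1` [set None]); split => //.
- exact: cons.
- by move=> w /=; case: (hX X t w) => //= y; apply: contra_notP.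
Qed.

Lemma semigroupD (t : R) (f g : borel M -> R) (x : M) : 0 <= t ->
  measurable_fun setT f -> measurable_fun setT g -> (forall y, 0 <= f y) -> (forall y, 0 <= g y) ->
  semigroup X t (fun y => f y + g y) x = (semigroup X t f x + semigroup X t g x)%E.
Proof.
move=> t0 mf mg f0 g0; rewrite /semigroup -ge0_integralD//.
- by apply: eq_integral => w _; rewrite -EFinD; case: (hX X t w) => [y|] //=; rewrite addr0.
- by move=> w _; rewrite lee_fin at_cemetery_ge0.
- exact: measurable_sem.
- by move=> w _; rewrite lee_fin at_cemetery_ge0.
- exact: measurable_sem.
Qed.

(* Two starting points [x], [y] share a fixed proportion of their laws after a
   time comparable to [phi (mdist x y)]. *)
Lemma overlap : exists2 eta, 0 < eta <= 1 & forall x y : M, exists n : nat, exists m : R, exists A : set (borel M),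
  [/\ (0 < n)%N, measurable A, 0 <= m, (mu A < +oo)%E & (eta%:E <= m%:E * mu A)%E] /\
  forall f : borel M -> R, measurable_fun setT f -> (forall z, 0 <= f z) ->
    (m%:E * \int[mu]_(z in A) (f z)%:E <= semigroup X n%:R f x)%E /\
    (m%:E * \int[mu]_(z in A) (f z)%:E <= semigroup X n%:R f y)%E.
Proof.
have Cs0 : 0 < Cstar by rewrite (lt_le_trans _ Cstar1).
have [Kp Kp0 KpP] := @scale_bound _ _ phiS 2 (ltr0n _ 2).
have [Kv Kv0 KvP] := @scale_bound _ _ VS 2 (ltr0n _ 2).
have [K K0 KP] := scale_ginv phiS.
pose e := Num.min 1 (Kv * Kp * K)^-1.
have e0 : 0 < e by rewrite lt_min ltr01 invr_gt0 !mulr_gt0.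
exists (Num.min 1 (Cl * e / Cstar)).
  by rewrite lt_min ltr01 divr_gt0 ?mulr_gt0//= ge_min lexx.
move=> x y; have [T T0 TP] := ginv_cvg phiS (mdist x y).
(* A natural time, since a shift by it sends rational times to rational times. It is so large that
   both starting points see the ball of radius [r] from within [2 * r]. *)
pose n := (Num.truncn T).+1; have n0 : 0 < n%:R :> R by rewrite ltr0n.
have := TP n%:R (truncnS_gt T); set r := ginv phi n%:R => rxy.
have r0 : 0 < r := ginv_gt0 phiS n0; have r2 : 0 < 2 * r by rewrite mulr_gt0.
have Vr := scale_gt0 VS r0; have V2 := scale_gt0 VS r2; have p2 := scale_gt0 phiS r2; have pr := scale_gt0 phiS r0.
have mB : measurable (ball x r : set (borel M)) by apply: openM; exact: open_ball_metric.
pose m := Cl * Num.min (V r)^-1 (n%:R / (V (2 * r) * phi (2 * r))).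
have m0 : 0 <= m by rewrite mulr_ge0 ?ltW// lt_min invr_gt0 Vr divr_gt0 ?mulr_gt0.
exists n, m, (ball x r); split.
  split => //.
    by apply: le_lt_trans (mu_ball x r0).2 _; rewrite ltry.
  apply: (@le_trans _ _ (m%:E * (Cstar^-1 * V r)%:E)%E); last first.
    by apply: lee_wpmul2l; [rewrite lee_fin|exact: (mu_ball x r0).1].
  rewrite -EFinM lee_fin ge_min; apply/orP; right.
  have me : e / V r <= Num.min (V r)^-1 (n%:R / (V (2 * r) * phi (2 * r))).
    rewrite le_min; apply/andP; split.
      by rewrite ler_piMl ?invr_ge0 ?(ltW Vr)// /e ge_min lexx.
    rewrite ler_pdivrMr// mulrAC ler_pdivlMr ?mulr_gt0//.
    have eK : e <= (Kv * Kp * K)^-1 by rewrite /e ge_min lexx orbT.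
    have h1 := KvP _ r0; have h2 := KpP _ r0; have [h3 _] := KP _ n0.
    have h4 : phi (2 * r) <= Kp * (K * n%:R) by apply: (le_trans h2); rewrite ler_pM2l.
    have h5 := ler_pM (ltW V2) (ltW p2) h1 h4.
    apply: (@le_trans _ _ ((Kv * Kp * K)^-1 * (Kv * V r * (Kp * (K * n%:R))))).
      by apply: ler_pM => //; [exact: ltW|rewrite mulr_ge0// ltW].
    rewrite le_eqVlt; apply/orP; left; apply/eqP; field.
    by rewrite !gt_eqF.
  rewrite (_ : Cl * e / Cstar = (Cl * (e / V r)) * (Cstar^-1 * V r)); last first.
    by field; rewrite !gt_eqF.
  rewrite ler_pM2r ?mulr_gt0 ?invr_gt0// ler_pM2l//.
move=> f mf f0; split; apply: lowb => //.
  by move=> z; rewrite !mdist_ballE => zr; rewrite (lt_trans zr)// mulr_natl mulr2n ltrDl.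
move=> z; rewrite !mdist_ballE => zr; have := metric_triangle y x z.
by rewrite (metric_sym y x); lra.
Qed.

Variable rho : R -> R.
Hypothesis rho_infty : forall B : R, exists T : R, forall t, T < t -> B <= rho t.

Let x0 : M := point.

(* Confinement to [b rho (q + u)] up to time [q], for arbitrarily large [q].  Only
   rational times occur, so that the event is generated by cylinders; the shift
   by time [v] turns [u] into [u + v]. *)
Definition confined_io (b u : R) : set Omega := [set w | forall n : nat, exists q : rat, n%:R <= ratr q :> R /\
  forall s : rat, 0 < (ratr s : R) <= ratr q -> near_set x0 (b * rho (ratr q + u)) (hX X (ratr s) w)].

Lemma confined_io_cyl b u : <<s cylinders X >> (confined_io b u).
Proof.
apply: cyl_forall_nat => n; apply: cyl_exists_rat => q _.
apply: cyl_forall_rat => s /andP[s0 _]; apply: cyl_at; first exact: ltW.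
exact: measurable_near_set.
Qed.

(** The exceptional set of the shift: a path that is unbounded during [[0, v]] cannot be recovered
    as confined from its behaviour after [v]. It is null because escape to large distances in a
    fixed time has small probability. *)
Definition unbounded_before (v : R) : set Omega := \bigcap_(k : nat) hit X 0 v (esc x0 k%:R).

Lemma measurable_unbounded_before v : 0 < v -> measurable (unbounded_before v).
Proof.
move=> v0; apply: bigcapT_measurable => k.
have := hF_hit X (lexx 0) v0 (@open_esc _ _ M_balls x0 k%:R).
by rewrite add0r; apply: hF_meas; exact: ltW.
Qed.

Lemma unbounded_before0 v (x : M) : 0 < v -> P (Some x) (unbounded_before v) = 0%E.
Proof.
move=> v0; have [C C0 CP] := escape_le M_balls phiS Ct0 tail cons.
apply/eqP; rewrite eq_le measure_ge0 andbT.
apply/lee_addgt0Pr => e e0; rewrite add0e.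
have [r r0 rP] := scale_unbounded phiS (C * v / e).
have pr := scale_gt0 phiS r0.
apply: (@le_trans _ _ (P (Some x) (hit X 0 v (esc x r)))); last first.
  apply: (le_trans (CP x v r v0 r0)); rewrite lee_fin mulrA ler_pdivrMr// [leRHS]mulrC -ler_pdivrMr//.
apply: le_measure; rewrite ?inE.
- exact: measurable_unbounded_before.
- have := hF_hit X (lexx 0) v0 (@open_esc _ _ M_balls x r).
  by rewrite add0r; apply: hF_meas; exact: ltW.
move=> w /(_ (Num.truncn (r + mdist x x0)).+1 I)[s st sD]; exists s => //.
move: sD; rewrite /esc /=; case: (hX X s w) => [y|] /=; last by rewrite !ltry.
rewrite !lte_fin => h; have h2 := truncnS_gt (r + mdist x x0).
by have := metric_triangle y x x0; lra.
Qed.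

(** Removing an initial segment only weakens the constraint. To restore it, the segment must be
    bounded by some [K], and then [b * rho] exceeds [K] at all large times. *)
Lemma confined_io_shift (b u : R) (v : nat) (th : Omega -> Omega) w : 0 < b ->
  (forall (s : R) w, 0 <= s -> hX X s (th w) = hX X (s + v%:R) w) ->
  ~ unbounded_before v%:R w ->
  confined_io b u w <-> confined_io b (u + v%:R) (th w).
Proof.
move=> b0 hth nU; have vR : ratr v%:R = v%:R :> R by rewrite ratr_nat.
split=> h n.
  have [q [nq qP]] := h (n + v)%N; exists (q - v%:R); split.
    by rewrite rmorphB /= vR lerBrDr -natrD.
  move=> s; rewrite rmorphB /= vR => /andP[s0 sq]; rewrite hth ?ltW//.
  have := qP (s + v%:R); rewrite rmorphD /= vR => qs.
  rewrite (_ : ratr q - v%:R + (u + v%:R) = ratr q + u); last by ring.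
  apply: qs; rewrite ltr_wpDr//=.
  by rewrite -lerBrDr.
have [K KP] : exists K : R, forall s, 0 <= s <= v%:R -> near_set x0 K (hX X s w).
  move/existsNP : nU => [k /not_implyP[_ kP]]; exists k%:R => s sv.
  apply: contrapT => nN; apply: kP; exists s; first by rewrite add0r.
  by rewrite -near_setC.
have [T TP] := rho_infty (K / b).
have [q [nq qP]] := h (maxn n (Num.truncn (T - u)).+1).
exists (q + v%:R); rewrite rmorphD /= vR; split.
  rewrite (le_trans _ (_ : ratr q <= _))// ?lerDl// (le_trans _ nq)// ler_nat leq_maxl//.
move=> s /andP[s0 sq]; have [sv|sv] := leP (ratr s : R) v%:R.
  have /KP : 0 <= (ratr s : R) <= v%:R by rewrite ltW.
  rewrite /near_set /= => /le_trans; apply; rewrite lee_fin mulrC -ler_pdivrMr//.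
  apply: TP; have := truncnS_gt (T - u) => h1.
  have : (Num.truncn (T - u)).+1%:R <= (ratr q : R).
    by rewrite (le_trans _ nq)// ler_nat leq_maxr.
  by have : 0 <= v%:R :> R by []; lra.
have := qP (s - v%:R); rewrite rmorphB /= vR => /(_ _) qs.
rewrite (_ : ratr q + v%:R + u = ratr q + (u + v%:R)); last by ring.
rewrite hth in qs; last by rewrite subr_ge0 ltW.
rewrite subrK in qs; apply: qs.
by rewrite subr_gt0 sv/= lerBlDr.
Qed.

Section fixed_level.
Variables (b : R) (b0 : 0 < b).

Definition io_prob (u : R) (y : M) : R := fine (P (Some y) (confined_io b u)).

Let mio u : measurable (confined_io b u).
Proof. by have [] := path_markov (confined_io_cyl b u). Qed.

Let io_fin u z : (fine (P z (confined_io b u)))%:E = P z (confined_io b u).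
Proof. by rewrite fineK// fin_num_measure. Qed.

Lemma io_prob_ge0 u y : 0 <= io_prob u y.
Proof. by rewrite fine_ge0. Qed.

Lemma io_prob_le1 u y : io_prob u y <= 1.
Proof. by rewrite -lee_fin io_fin probability_le1. Qed.

Lemma measurable_io_prob u : measurable_fun setT (io_prob u : borel M -> R).
Proof.
apply: measurableT_comp => //; have [_ mP _] := path_markov (confined_io_cyl b u).
exact: (measurableT_comp mP (@measurable_fun_some R M)).
Qed.

Lemma io_prob_markov (x : M) (u : R) (v : nat) (L : set Omega) : (0 < v)%N -> hF X v%:R L ->
  P (Some x) (L `&` confined_io b u) =
  (\int[P (Some x)]_(w in L) (at_cemetery0 (io_prob (u + v%:R)) (hX X v%:R w))%:E)%E.
Proof.
move=> v0 hL; have v0R : 0 < v%:R :> R by rewrite ltr0n.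
have mL := hF_meas (ltW v0R) hL.
have [th hth] := hX_shift X (ltW v0R).
have [_ mP /(_ (Some x) v%:R th L (ltW v0R) hth hL)[mth PE]] := path_markov (confined_io_cyl b (u + v%:R)).
have mU := measurable_unbounded_before v0R.
have U0 := unbounded_before0 x v0R.
transitivity (P (Some x) (L `&` th @^-1` confined_io b (u + v%:R))).
  have le (A B : set Omega) : measurable A -> measurable B -> A `<=` B `|` unbounded_before v%:R ->
      (P (Some x) A <= P (Some x) B)%E.
    move=> mA mB AB; apply: (@le_trans _ _ (P (Some x) (B `|` unbounded_before v%:R))).
      by apply: le_measure; rewrite ?inE//; exact: measurableU.
    apply: le_trans (measureU2 _ mB mU) _; rewrite -[leRHS]adde0; apply: leeD => //.
    by move/eqP : U0; rewrite eq_le => /andP[].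
  apply/eqP; rewrite eq_le; apply/andP; split; apply: le.
  - exact: measurableI.
  - exact: measurableI.
  - move=> w [Lw Cw]; have [Uw|Uw] := pselect (unbounded_before v%:R w); first by right.
    by left; split => //; exact: (confined_io_shift u b0 hth Uw).1.
  - exact: measurableI.
  - exact: measurableI.
  - move=> w [Lw Cw]; have [Uw|Uw] := pselect (unbounded_before v%:R w); first by right.
    by left; split => //; exact: (confined_io_shift u b0 hth Uw).2.
rewrite PE; have mD := measurable_hXA X (ltW v0R) (@measurable_dead R M).
apply: ae_eq_integral => //.
- by apply: measurable_funTS; exact: (measurableT_comp mP (measurable_hX X (ltW v0R))).
- by apply: measurable_funTS; apply: measurable_sem; [exact: ltW|exact: measurable_io_prob].
exists (hX X v%:R @^-1` [set None]); split => //.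
- by apply: cons; exact: ltW.
- move=> w /=; case: (hX X v%:R w) => //= y; apply: contra_notP => _ _.
  by rewrite /io_prob io_fin.
Qed.

Lemma io_prob_semigroup (x : M) (u : R) (v : nat) : (0 < v)%N ->
  (io_prob u x)%:E = semigroup X v%:R (io_prob (u + v%:R)) x.
Proof.
move=> v0; rewrite /io_prob io_fin -[confined_io b u]setTI (@io_prob_markov x u v setT v0)//.
exact: hF_T.
Qed.

Lemma io_prob_const u x y : io_prob u x = io_prob u y.
Proof.
have [eta /andP[eta0 eta1] ov] := overlap.
(* The common part of the two laws contributes the same to both sides, so the
   oscillation contracts by the factor [1 - eta]. *)
have contr (n : nat) : forall u x y, io_prob u x - io_prob u y <= (1 - eta) ^+ n.
  elim: n => [|n IH] {}u {}x {}y.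
    by rewrite expr0; have := io_prob_le1 u x; have := io_prob_ge0 u y; lra.
  set dl := (1 - eta) ^+ n in IH *.
  have [v [m [A [[v0 mA m0 Afin etaA] lo]]]] := ov x y.
  pose f := io_prob (u + v%:R); pose i := inf (range f).
  have hi : has_inf (range f).
    by split; [exists (f point); exists point|exists 0 => _ [z _ <-]; exact: io_prob_ge0].
  have i0 : 0 <= i by apply: lb_le_inf; [exact: hi.1|move=> _ [z _ <-]; exact: io_prob_ge0].
  have fi z : i <= f z by apply: ge_inf; [exact: hi.2|exists z].
  have fd z : f z - i <= dl.
    rewrite lerBlDr -lerBlDl; apply: lb_le_inf; first exact: hi.1.
    by move=> _ [z' _ <-]; rewrite lerBlDl -lerBlDr; exact: IH.
  (* Minorization needs non-negative functions, and both [h1] and its complement [h2] to the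
     oscillation [dl] are. It is applied to [h1] from [y] and to [h2] from [x]; together they remove
     [eta * dl] from the difference. *)
  pose h1 (z : borel M) := f z - i; pose h2 (z : borel M) := dl - h1 z.
  have h10 z : 0 <= h1 z by rewrite subr_ge0.
  have h20 z : 0 <= h2 z by rewrite subr_ge0; exact: fd.
  have mf : measurable_fun setT (f : borel M -> R) := measurable_io_prob _.
  have mh1 : measurable_fun setT h1 by apply: measurable_funB.
  have mh2 : measurable_fun setT h2 by apply: measurable_funB.
  have dl0 : 0 <= dl by rewrite (le_trans (h10 point))// fd.
  have v0R : 0 <= v%:R :> R by [].
  have E1 z : (io_prob u z)%:E = (semigroup X v%:R h1 z + i%:E)%E.
    rewrite (io_prob_semigroup z u v0) -(semigroup_cst z v0R i0) -semigroupD//.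
    by congr (semigroup X _ _ _); apply/funext => z'; rewrite /h1 subrK.
  have E2 z : (semigroup X v%:R h1 z + semigroup X v%:R h2 z = dl%:E)%E.
    rewrite -semigroupD// -(semigroup_cst z v0R dl0).
    by congr (semigroup X _ _ _); apply/funext => z'; rewrite /h2 addrC subrK.
  have sum : (m%:E * \int[mu]_(z in A) (h1 z)%:E + m%:E * \int[mu]_(z in A) (h2 z)%:E = m%:E * mu A * dl%:E)%E.
    rewrite -ge0_muleDr; last 2 first.
    - by apply: integral_ge0 => z _; rewrite lee_fin.
    - by apply: integral_ge0 => z _; rewrite lee_fin.
    rewrite -ge0_integralD//.
    - rewrite -muleA; congr (_ * _)%E; rewrite muleC -integral_cst//.
      by apply: eq_integral => z _; rewrite -EFinD /h2 addrC subrK.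
    - by move=> z _; rewrite lee_fin.
    - by apply/measurable_EFinP; exact: measurable_funTS.
    - by move=> z _; rewrite lee_fin.
    - by apply/measurable_EFinP; exact: measurable_funTS.
  have [_ l1] := lo h1 mh1 h10; have [l2 _] := lo h2 mh2 h20.
  have : (eta%:E * dl%:E <= semigroup X v%:R h1 y + semigroup X v%:R h2 x)%E.
    by apply: le_trans (leeD l1 l2); rewrite sum; apply: (@lee_wpmul2r _ dl%:E _ _ _ etaA); rewrite lee_fin.
  have fin z : semigroup X v%:R h1 z \is a fin_num.
    rewrite ge0_fin_numE ?semigroup_ge0//; apply: (@le_lt_trans _ _ dl%:E); last exact: ltry.
    by rewrite -(E2 z) leeDl// semigroup_ge0.
  have fin2 z : semigroup X v%:R h2 z \is a fin_num.
    rewrite ge0_fin_numE ?semigroup_ge0//; apply: (@le_lt_trans _ _ dl%:E); last exact: ltry.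
    by rewrite -(E2 z) leeDr// semigroup_ge0.
  have := E1 x; have := E1 y; have := E2 x.
  rewrite -(fineK (fin x)) -(fineK (fin y)) -(fineK (fin2 x)) -!EFinD -EFinM lee_fin.
  move=> [e2] [e1y] [e1x] key; rewrite exprS -/dl mulrBl mul1r; lra.
have eta2 : `|1 - eta| < 1 by rewrite ltr_norml; apply/andP; split; lra.
have le0 z z' : io_prob u z - io_prob u z' <= 0.
  apply/ler_addgt0Pr => e e0; rewrite add0r.
  have /cvgrPdist_lt/(_ e e0)[n _ /(_ n (leqnn n))] := cvg_expr eta2.
  rewrite /= sub0r normrN => /(le_lt_trans (ler_norm _))/ltW.
  exact: le_trans (contr n u z z').
by apply/eqP; rewrite eq_le; apply/andP; split; rewrite -subr_le0.
Qed.

(** Given the path up to an integer time, the conditional probability of the event is the constant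
    [q], so the event is independent of every cylinder. Two finite measures that agree on the
    cylinders agree on the event itself, which gives [q = q * q]. *)
Lemma zero_one : (forall x : M, P (Some x) (confined_io b 0) = 0%E) \/
  (forall x : M, P (Some x) (confined_io b 0) = 1%E).
Proof.
pose q := io_prob 0 point.
have q0 : 0 <= q := io_prob_ge0 _ _.
have qE (v : nat) y : (0 < v)%N -> io_prob (0 + v%:R) y = q.
  move=> v0; apply/eqP; rewrite -eqe; apply/eqP.
  rewrite /q (io_prob_semigroup point 0 v0).
  rewrite -(semigroup_cst point (ler0n R v) (io_prob_ge0 (0 + v%:R) y)).
  by congr (semigroup X _ _ _); apply/funext => z; exact: io_prob_const.
have PE (x : M) : P (Some x) (confined_io b 0) = q%:E.
  by rewrite /q (io_prob_const 0 point x) /io_prob io_fin.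
have cylE (x : M) C : cylinders X C -> P (Some x) (confined_io b 0 `&` C) = (q%:E * P (Some x) C)%E.
  move=> /cylinder_hF[v v0 hC]; rewrite setIC (io_prob_markov x 0 v0 hC).
  have v0R : 0 <= v%:R :> R by [].
  have mC := hF_meas v0R hC.
  have mD := measurable_hXA X v0R (@measurable_dead R M).
  rewrite -integral_cst//; apply: ae_eq_integral => //.
  - by apply: measurable_funTS; apply: measurable_sem => //; exact: measurable_io_prob.
  exists (hX X v%:R @^-1` [set None]); split => //.
  - exact: cons.
  - by move=> w /=; case: (hX X v%:R w) => //= y; apply: contra_notP => _ _; rewrite qE.
have qq (x : M) : q = q * q.
  have m0 := mio 0.
  pose m1 := mrestr (P (Some x)) m0; pose m2 := mscale (NngNum q0) (P (Some x)).
  have cylT : cylinders X setT.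
    exists [::], (fun=> setT); split => //.
    by apply/seteqP; split.
  have : m1 (confined_io b 0) = m2 (confined_io b 0).
    apply: (g_sigma_algebra_measure_unique (cylinders X) _ (fun=> setT)).
    - by move=> C /cylinder_hF[v _ /hF_meas]; apply.
    - by [].
    - by rewrite bigcup_const.
    - exact: cylinders_setI.
    - move=> C cC; rewrite /m1 /m2 /= /mrestr /mscale /= setIC; exact: cylE.
    - by move=> k; rewrite /m1 /= /mrestr setTI ltey_eq fin_num_measure.
    - exact: confined_io_cyl.
  rewrite /m1 /m2 /= /mrestr /mscale /= setIid PE.
  by rewrite -EFinM => -[].
have /eqP := qq point; rewrite -{1}[q]mulr1 -subr_eq0 -mulrBr mulf_eq0 subr_eq0 => /orP[/eqP qz|/eqP q1].
  by left => x; rewrite PE qz.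
by right => x; rewrite PE -q1.
Qed.

End fixed_level.
End zero_one.

(** * The critical level *)

Section iterated_logarithm.
Context {R : realType}.
Implicit Types s t : R.

Lemma lnln_ge1 t : expR (expR 1) <= t -> 1 <= ln (ln t).
Proof.
move=> te; have t0 : 0 < t by rewrite (lt_le_trans (expR_gt0 _) te).
have lt : expR 1 <= ln t by rewrite -[leLHS]expRK ler_ln ?posrE ?expR_gt0.
have l0 : 0 < ln t by rewrite (lt_le_trans (expR_gt0 _) lt).
by rewrite -[leLHS]expRK ler_ln ?posrE ?expR_gt0.
Qed.

Definition lnln_clock t : R := t / ln (ln t).

Lemma lnln_clock_gt0 t : expR (expR 1) <= t -> 0 < lnln_clock t.
Proof.
move=> te; rewrite divr_gt0 ?(lt_le_trans (expR_gt0 _) te)//.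
by rewrite (lt_le_trans ltr01)// lnln_ge1.
Qed.

(** Two uses of [ln (1 + v) <= v], with [ln s >= 1], bound the increase of [ln ln] from [s] to [t]
    by [t / s - 1]; since [ln (ln s) >= 1], the numerator grows at least as fast in proportion. *)
Lemma lnln_clock_le s t : expR (expR 1) <= s -> s <= t -> lnln_clock s <= lnln_clock t.
Proof.
move=> se st; have te := le_trans se st.
have s0 : 0 < s by rewrite (lt_le_trans (expR_gt0 _) se).
have t0 := lt_le_trans s0 st.
have ls := lnln_ge1 se; have lt := lnln_ge1 te.
have lls : 1 <= ln s.
  rewrite -[leLHS]expRK ler_ln ?posrE ?expR_gt0// (le_trans _ se)// ler_expR.
  by rewrite (le_trans _ (expR_ge1Dx 1))// lerDl.
have ls0 : 0 < ln s by rewrite (lt_le_trans ltr01).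
have st0 : 0 < t / s by rewrite divr_gt0.
have st1 : 1 <= t / s by rewrite ler_pdivlMr ?mul1r.
pose v := ln (t / s) / ln s.
have v0 : 0 <= v := divr_ge0 (ln_ge0 st1) (ltW ls0).
have vl : v <= t / s - 1.
  rewrite (le_trans (_ : v <= ln (t / s)))//.
    by rewrite ler_pdivrMr// ler_peMr// ln_ge0.
  have h : -1 < t / s - 1 by lra.
  by have := le_ln1Dx h; rewrite (addrC 1) subrK.
have key : ln (ln t) <= ln (ln s) + (t / s - 1).
  have -> : ln t = ln s * (1 + v).
    rewrite mulrDr mulr1 /v mulrCA divff ?gt_eqF// mulr1 -lnM ?posrE//.
    by rewrite mulrC divfK ?gt_eqF.
  rewrite lnM ?posrE//; last by lra.
  rewrite lerD2l (le_trans _ vl)// le_ln1Dx//; lra.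
rewrite /lnln_clock ler_pdivrMr; last by lra.
rewrite mulrAC ler_pdivlMr; last by lra.
have : s * ln (ln t) <= s * (ln (ln s) + (t / s - 1)) by rewrite ler_pM2l.
have -> : s * (ln (ln s) + (t / s - 1)) = s * ln (ln s) + (t - s) by field; rewrite gt_eqF.
by move=> /le_trans; apply; nra.
Qed.

Lemma lnln_clock_unbounded (B : R) : exists2 T, expR (expR 1) <= T & forall t, T < t -> B <= lnln_clock t.
Proof.
exists (Num.max (expR (expR 1)) (expR (4 * `|B|))); first by rewrite le_max lexx.
move=> t; rewrite gt_max => /andP[/ltW te tB].
have t0 : 0 < t by rewrite (lt_le_trans (expR_gt0 _) te).
have l1 := lnln_ge1 te.
have y4 : 4 * `|B| <= ln t by rewrite -[leLHS]expRK ler_ln ?posrE ?expR_gt0// ltW.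
rewrite ler_pdivlMr; last by lra.
have yl : ln (ln t) <= ln t.
  have [y0|y0] := ltP 0 (ln t); first exact: ltW (ln_sublinear y0).
  by have := l1; rewrite ln0//; lra.
have h := expR_ge1Dx (ln t / 2).
(* Writing [t] as a square of an exponential yields a bound quadratic in [ln t], which beats
   [B * ln (ln t)]. *)
have tE : t = expR (ln t / 2) ^+ 2 by rewrite -expRM_natl mulrC divfK// lnK.
rewrite [leRHS]tE expr2; have B0 := ler_norm B; have B1 := normr_ge0 B.
set y := ln t in y4 yl h *; set l := ln y in l1 yl *; set e := expR _ in h *.
nra.
Qed.

Definition chung_rate (phi : R -> R) t := ginv phi (lnln_clock t).

Lemma chung_rate_le phi s t : weak_scaling phi -> expR (expR 1) <= s -> s <= t ->
  chung_rate phi s <= chung_rate phi t.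
Proof. by move=> phiS se st; apply: ginv_nd => //; [exact: lnln_clock_gt0|exact: lnln_clock_le]. Qed.

Lemma chung_rate_infty phi : weak_scaling phi ->
  forall B : R, exists T : R, forall t, T < t -> B <= chung_rate phi t.
Proof.
move=> phiS B; have [T T0 TP] := ginv_cvg phiS B.
have [T' _ T'P] := lnln_clock_unbounded (T + 1).
by exists T' => t /T'P h; apply: TP; lra.
Qed.

End iterated_logarithm.

(** * From confinement at rational times to the limit inferior *)

Section liminf.
Context {R : realType} {M : pmetricType R} {d : measure_display}
  {Omega : measurableType d}.
Variable (X : hunt_process M Omega).
Hypothesis M_balls : forall (x : M) (r : R), precompact (ball x r).

Lemma right_window (D : set (opc M)) (s : R) w : 0 <= s -> open D -> D (hX X s w) ->
  exists2 u, s < u & forall v, s < v < u -> D (hX X v w).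
Proof.
move=> s0 oD Ds.
have /(@hX_rcont _ _ _ _ X s w s0) : nbhs (hX X s w) D by exact: open_nbhs_nbhs.
move=> [e /= e0 eP]; exists (s + e); first by rewrite ltrDl.
move=> v /andP[sv ve]; apply: eP => //=.
by rewrite ltr0_norm ?subr_lt0// opprB ltrBlDl.
Qed.

Lemma rat_window (D : set (opc M)) (s u : R) w : 0 <= s -> s < u -> open D -> D (hX X s w) ->
  exists2 q : rat, s < ratr q < u & D (hX X (ratr q) w).
Proof.
move=> s0 su oD Ds; have [v sv vP] := right_window s0 oD Ds.
have [q] : exists q : rat, ratr q \in `]s, (Num.min u v)[.
  by apply: rat_in_itvoo; rewrite lt_min su.
rewrite in_itv/= lt_min => /and3P[sq qu qv].
by exists q; [rewrite sq|apply: vP; rewrite sq].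
Qed.

Lemma rat_confined (x0 : M) (r u : R) w :
  (forall q : rat, 0 < (ratr q : R) < u -> near_set x0 r (hX X (ratr q) w)) ->
  forall s, 0 <= s < u -> near_set x0 r (hX X s w).
Proof.
move=> h s /andP[s0 su]; apply: contrapT => nN.
have Es : esc x0 r (hX X s w) by rewrite -near_setC.
have [q /andP[sq qu]] := rat_window s0 su (@open_esc _ _ M_balls x0 r) Es.
by rewrite -near_setC; apply; apply: h; rewrite qu (le_lt_trans s0).
Qed.

Lemma near_set_edist (x0 x : M) (r : R) z : near_set x0 r z ->
  (Defs.edist x z <= (r + mdist x0 x)%:E)%E.
Proof.
move=> /edist_some[y -> yr] /=; rewrite lee_fin.
by rewrite (le_trans (metric_triangle y x0 x))// lerD2r.
Qed.

Variable rho : R -> R.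
Hypothesis rho_infty : forall B : R, exists T : R, forall t, T < t -> B <= rho t.

Let x0 : M := point.

(** Right-continuity extends the confinement from rational to real times, and the gap [b' - b] pays
    for moving the centre from [x0] to [x]. *)
Lemma limf_einf_le (x : M) (b b' : R) w : 0 < b -> b < b' -> confined_io X rho b 0 w ->
  (limf_einf (fun t : R => running_max X x t w * ((rho t)^-1)%:E)%E (pinfty_nbhs R) <= b'%:E)%E.
Proof.
move=> b0 bb io; rewrite limf_einfE; apply: ge_ereal_sup => _ [W [T [_ TW]] <-].
pose D := mdist x0 x; have [T1 T1P] := rho_infty (Num.max 1 (D / (b' - b))).
have [q [nq qP]] := io (Num.truncn (Num.max 0 (Num.max T T1))).+1.
have tq : Num.max 0 (Num.max T T1) < ratr q by exact: lt_le_trans (truncnS_gt _) nq.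
move: tq; rewrite !gt_max => /and3P[q0 Tq T1q].
have := T1P _ T1q; rewrite ge_max => /andP[r1 rD].
have r0 : 0 < rho (ratr q) by exact: lt_le_trans r1.
have {}rD : D <= (b' - b) * rho (ratr q) by rewrite mulrC -ler_pdivrMr// subr_gt0.
rewrite addr0 in qP.
apply: (@le_trans _ _ (running_max X x (ratr q) w * ((rho (ratr q))^-1)%:E)%E).
  by apply: ereal_inf_lbound; exists (ratr q) => //; exact: TW.
apply: (@le_trans _ _ ((b' * rho (ratr q))%:E * ((rho (ratr q))^-1)%:E)%E); last first.
  by rewrite -EFinM mulfK// gt_eqF.
apply: lee_wpmul2r; first by rewrite lee_fin invr_ge0 ltW.
apply: ge_ereal_sup => _ [s [s0 sq] <-].
apply: (@le_trans _ _ (b * rho (ratr q) + mdist x0 x)%:E); last by rewrite lee_fin -/D; lra.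
apply: near_set_edist; move: sq; rewrite le_eqVlt => /predU1P[->|sq].
  by apply: qP; rewrite q0 lexx.
apply: (@rat_confined x0 _ (ratr q)); last by rewrite (ltW s0).
by move=> q' /andP[q'0 q'q]; apply: qP; rewrite q'0 ltW.
Qed.

(** A small ratio at a real time [t] would give confinement at level [b'] up to a rational time just
    after [t]: the path moves little to the right of [t], and the rate does not decrease. *)
Lemma limf_einf_ge (T0 : R) (x : M) (b b' : R) w : (forall s t, T0 <= s -> s <= t -> rho s <= rho t) ->
  0 < b -> b < b' -> ~ confined_io X rho b' 0 w ->
  (b%:E <= limf_einf (fun t : R => running_max X x t w * ((rho t)^-1)%:E)%E (pinfty_nbhs R))%E.
Proof.
move=> rho_nd b0 bb nio; rewrite limf_einfE.
(* The summand 1 places the path strictly inside the open ball, as right-continuity at time [t]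
   requires. *)
pose D := mdist x x0; have [T1 T1P] := rho_infty (Num.max 1 ((D + 1) / (b' - b))).
have {nio}[n nP] : exists n : nat, forall q : rat, n%:R <= ratr q :> R ->
    ~ forall s : rat, 0 < (ratr s : R) <= ratr q -> near_set x0 (b' * rho (ratr q)) (hX X (ratr s) w).
  move/existsNP : nio => [n nP]; exists n => q nq h; apply: nP; exists q; split => //.
  by rewrite addr0.
pose T := Num.max (Num.max 0 n%:R) (Num.max T0 T1).
apply: (@le_trans _ _ (ereal_inf [set (running_max X x t w * ((rho t)^-1)%:E)%E | t in [set t | T < t]])); last first.
  by apply: ereal_sup_ubound; exists [set t | T < t] => //; exists T; split => //; exact: num_real.
apply: le_ereal_inf_tmp => _ [t /= + <-]; rewrite !gt_max => /andP[/andP[t0 nt] /andP[T0t T1t]].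
have := T1P _ T1t; rewrite ge_max => /andP[r1 rD].
have r0 : 0 < rho t by exact: lt_le_trans r1.
have {}rD : D + 1 <= (b' - b) * rho t by rewrite mulrC -ler_pdivrMr// subr_gt0.
apply: (@le_trans _ _ ((b * rho t)%:E * ((rho t)^-1)%:E)%E).
  by rewrite -EFinM mulfK// gt_eqF.
apply: lee_wpmul2r; first by rewrite lee_fin invr_ge0 ltW.
rewrite leNgt; apply/negP => small.
have nearb s : 0 < s -> s <= t -> exists2 y, hX X s w = Some y & mdist y x0 < b' * rho t.
  move=> s0 st; have /ltW/edist_some[y yE yr] : (Defs.edist x (hX X s w) < (b * rho t)%:E)%E.
    by apply: le_lt_trans small; apply: ereal_sup_ubound; exists s.
  by exists y => //; have := metric_triangle y x x0; rewrite -/D; lra.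
have [y yE yr] := nearb t t0 (lexx t).
have Dt : (Some @` ball x0 (b' * rho t)) (hX X t w).
  by exists y; rewrite ?mdist_ballE ?yE// metric_sym.
have [u tu uP] := right_window (ltW t0) (@open_ball_image _ _ x0 (b' * rho t)) Dt.
have [q] := rat_in_itvoo tu; rewrite in_itv/= => /andP[tq qu].
have rq : b' * rho t <= b' * rho (ratr q).
  by rewrite ler_pM2l ?(lt_trans b0)//; apply: rho_nd; exact: ltW.
apply: (nP q); first by rewrite (le_trans (ltW nt))// ltW.
move=> s /andP[s0 sq]; rewrite /near_set /=.
suff [y' -> yr'] : exists2 y', hX X (ratr s) w = Some y' & mdist y' x0 < b' * rho t.
  by rewrite /= lee_fin (le_trans (ltW yr')).
have [st|ts] := leP (ratr s : R) t; first exact: nearb.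
have [|y' y'r <-] := uP (ratr s); first by rewrite ts (le_lt_trans sq).
by exists y' => //; rewrite metric_sym -mdist_ballE.
Qed.

End liminf.

Section elementary.
Context {R : realType}.

Lemma ln2_ge_half : 1 / 2 <= ln 2 :> R.
Proof.
have h : -1 < - (1 / 2) :> R by lra.
have := le_ln1Dx h; rewrite (_ : 1 + - (1 / 2) = 2^-1); last by field.
by rewrite lnV ?posrE//; lra.
Qed.

Lemma bernoulli_ge (p : R) n : 0 <= p -> 1 + n%:R * p <= (1 + p) ^+ n.
Proof.
move=> p0; elim: n => [|n IH]; first by rewrite mul0r addr0 expr0.
rewrite exprS; apply: (@le_trans _ _ ((1 + p) * (1 + n%:R * p))).
  rewrite -natr1; have : 0 <= n%:R * p * p by rewrite !mulr_ge0.
  by lra.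
by rewrite ler_pM2l// ltr_pwDl.
Qed.

(** [(1 - p) ^+ n * (1 + p) ^+ n] is at most 1, while the second factor is at least 4 by
    Bernoulli. *)
Lemma one_sub_expr_le (p : R) n : 0 <= p <= 1 -> 3 <= n%:R * p -> (1 - p) ^+ n <= 1 / 4.
Proof.
move=> /andP[p0 p1] np.
have h1 := bernoulli_ge n p0.
have h2 : (1 - p) ^+ n * (1 + p) ^+ n <= 1.
  rewrite -exprMn exprn_ile1//; first by rewrite mulr_ge0//; lra.
  by have := mulr_ge0 p0 p0; lra.
have h3 : 0 <= (1 - p) ^+ n by rewrite exprn_ge0//; lra.
set a := _ ^+ n in h2 h3 *; set c := _ ^+ n in h1 h2.
by nra.
Qed.

(* The number of dyadic confinement attempts that is affordable at time [2 ^ k]. *)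
Lemma trunc_log_le_lnln k : (3 <= k)%N ->
  (2 * trunc_log 2 k.+1)%:R <= 8 * ln (ln (2 ^+ k.+1)) :> R.
Proof.
move=> k3; set l := trunc_log 2 k.+1.
have l2 := ln2_ge_half; have l20 : 0 < ln 2 :> R by lra.
have k0 : 0 < k.+1%:R :> R by rewrite ltr0n.
have h1 : l%:R * ln 2 <= ln k.+1%:R :> R.
  rewrite mulr_natl -lnXn// ler_ln ?posrE ?exprn_gt0//.
  by rewrite -natrX ler_nat; exact: trunc_logP.
have h2 : 2 * ln 2 <= ln k.+1%:R :> R.
  rewrite mulr_natl -lnXn// ler_ln ?posrE ?exprn_gt0//.
  by rewrite -natrX ler_nat.
have h3 : - ln 2 <= ln (ln 2) :> R.
  by rewrite -lnV ?posrE// ler_ln ?posrE ?invr_gt0//; lra.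
rewrite lnXn// -(mulr_natl (ln 2)) lnM ?posrE// natrM.
have : l%:R * (1 / 2) <= l%:R * ln 2 :> R by rewrite ler_wpM2l.
lra.
Qed.

(** The left side is of order [k ^- 2]; the right side is a telescoping majorant, so partial sums
    are explicit. *)
Lemma trunc_log_pow_le k : 2^-1 ^+ (2 * trunc_log 2 k.+2) <= 4 / k.+1%:R - 4 / k.+2%:R :> R.
Proof.
set l := trunc_log 2 k.+2.
have k1 : 0 < k.+1%:R :> R by rewrite ltr0n.
have k2 : 0 < k.+2%:R :> R by rewrite ltr0n.
have h : k.+2%:R <= 2 * 2 ^+ l :> R.
  by rewrite -exprS -natrX ler_nat; apply/ltnW/trunc_log_ltn.
have l0 : 0 < 2 ^+ l :> R by rewrite exprn_gt0.
rewrite mulnC exprM exprVn.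
apply: (@le_trans _ _ ((k.+2%:R / 2)^-1 ^+ 2)).
  rewrite lerXn2r ?nnegrE ?invr_ge0 ?divr_ge0 ?(ltW l0)//.
  by rewrite lef_pV2 ?posrE ?divr_gt0// ler_pdivrMr// mulrC.
rewrite (_ : 4 / k.+1%:R - 4 / k.+2%:R = 4 / (k.+1%:R * k.+2%:R)); last first.
  by move: k1 k2; rewrite -(@natr1 _ k.+1); set a := k.+1%:R => a0 a1; field; rewrite !gt_eqF.
rewrite (_ : (k.+2%:R / 2)^-1 ^+ 2 = 4 / (k.+2%:R * k.+2%:R)); last by field; rewrite gt_eqF.
rewrite ler_pM2l// lef_pV2 ?posrE ?mulr_gt0// ler_pM2r// ler_nat//.
Qed.

End elementary.

(** * At small levels the probability is below one *)

Section lower.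
Context {R : realType} {M : pmetricType R} {d : measure_display}
  {Omega : measurableType d}.
Variables (mu : {measure set (borel M) -> \bar R}) (V phi : R -> R).
Variable (X : hunt_process M Omega).
Local Notation P := (hP X).
Hypothesis M_balls : forall (x : M) (r : R), precompact (ball x r).
Hypotheses (VS : weak_scaling V) (phiS : weak_scaling phi).
Variables (Cstar Cu : R).
Hypotheses (Cstar1 : 1 <= Cstar) (mu_ball : volume_comparable mu V Cstar).
Hypotheses (Cu0 : 0 < Cu) (ondiag : on_diag_bound mu V phi X Cu).
Local Notation rho := (chung_rate phi).

Lemma measurable_confined_io b : measurable (confined_io X rho b 0).
Proof. by have [] := path_markov (confined_io_cyl (X := X) M_balls rho b 0). Qed.

Lemma measurable_hit0 (T : R) (x : M) (r : R) : 0 < T -> measurable (hit X 0 T (esc x r)).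
Proof.
move=> T0; have := hF_hit X (lexx 0) T0 (@open_esc _ _ M_balls x r).
by rewrite add0r; apply: hF_meas; exact: ltW.
Qed.

(** If the path is confined up to [q] with [2 ^ k < q <= 2 ^ k.+1], then [E k] occurs: confinement
    up to the smaller time within the larger radius. The time [2 ^ k] has room for about [2 log k]
    blocks of [confined_le], so [E k] has probability of order [k ^- 2], and the sum over large [k]
    is at most 1/2. *)
Lemma confined_io_lt1 : exists2 a, 0 < a & forall z : opc M, (P z (confined_io X rho a 0) < 1)%E.
Proof.
have [A A0 AP] := confined_le M_balls VS phiS Cstar1 mu_ball Cu0 ondiag.
have [K K0 KP] := scale_ginv phiS.
(* The factor 16 is 8, from the comparison of the number of blocks with [ln ln], times 2, from the
   ratio of consecutive dyadic times; [K] pays for the inexact inverse. *)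
have [l l1 lP] := scale_grow phiS (16 * A * K).
have l0 : 0 < l := lt_trans ltr01 l1.
exists l^-1; first by rewrite invr_gt0.
move=> z; pose x0 : M := point.
(* The bound 8 makes the telescoped tail [4 / k0] at most 1/2; the other bound puts the dyadic times
   in the range where the rate is monotone. *)
pose k0 := maxn 8 (Num.truncn (expR (expR 1) : R)).+1.
have k0e k : (k0 <= k)%N -> expR (expR 1) <= 2 ^+ k :> R.
  move=> k0k; rewrite (le_trans (ltW (truncnS_gt _)))// -natrX ler_nat.
  apply: leq_trans (ltnW (ltn_expl k (ltnSn 1))).
  by apply: leq_trans k0k; rewrite leq_maxr.
pose E k := ~` hit X 0 (2 ^+ k) (esc x0 (l^-1 * rho (2 ^+ k.+1))).
have mE k : measurable (E k) by apply/measurableC/measurable_hit0; exact: exprn_gt0.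
have PE k : (k0 <= k)%N -> (P z (E k) <= (4 / k%:R - 4 / k.+1%:R)%:E)%E.
  move=> kk; have k8 : (8 <= k)%N by rewrite (leq_trans _ kk)// leq_maxl.
  case: k kk k8 => // k kk k8.
  apply: (@le_trans _ _ (2^-1 ^+ (2 * trunc_log 2 k.+2))%:E); last first.
    by rewrite lee_fin trunc_log_pow_le.
  have te := k0e _ (leqW kk); have ct := lnln_clock_gt0 te.
  have r0 : 0 < rho (2 ^+ k.+2) := ginv_gt0 phiS ct.
  have lr0 : 0 < l^-1 * rho (2 ^+ k.+2) by rewrite mulr_gt0// invr_gt0.
  apply: AP => //.
  have := lP _ lr0; rewrite mulrA divff ?gt_eqF// mul1r => h1.
  have [h2 _] := KP _ ct; have {h1}h2 := le_trans h1 h2.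
  set f := phi _ in h2 *; have f0 : 0 < f := scale_gt0 phiS lr0.
  have L1 := lnln_ge1 te; set L := ln (ln _) in L1.
  have {h2} : 16 * A * f * L <= 2 * 2 ^+ k.+1.
    rewrite -ler_pdivlMr; last by lra.
    rewrite -exprS -(ler_pM2l K0); move: h2; rewrite /lnln_clock -/L; lra.
  have : (2 * trunc_log 2 k.+2)%:R <= 8 * L :> R by apply: trunc_log_le_lnln; exact: leq_trans k8.
  set m := (_ * _)%:R => hm.
  have : A * f * m <= A * f * (8 * L) by rewrite ler_pM2l// mulr_gt0.
  lra.
pose U n := \big[setU/set0]_(i < n) E (k0 + i)%N.
have mU n : measurable (U n) by exact: bigsetU_measurable.
have k00 : 0 < k0%:R :> R by rewrite ltr0n (leq_trans _ (leq_maxl 8 _)).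
have PU n : (P z (U n) <= (4 / k0%:R - 4 / (k0 + n)%:R)%:E)%E.
  elim: n => [|n IH]; first by rewrite /U big_ord0 measure0 addn0 subrr.
  rewrite /U big_ord_recr /=; apply: le_trans (measureU2 _ (mU n) (mE _)) _.
  apply: (le_trans (leeD IH (PE _ (leq_addr n k0)))).
  by rewrite -EFinD lee_fin addnS addrA subrK.
have Uhalf : (P z (\bigcup_n U n) <= (1 / 2)%:E)%E.
  apply: nondecreasing_bigcup_bound => //.
    by move=> m n mn; apply/subsetPset; exact: (@subset_bigsetU _ (fun i => E (k0 + i)%N)).
  move=> n; apply: (le_trans (PU n)); rewrite lee_fin.
  have : 0 <= 4 / (k0 + n)%:R :> R by rewrite divr_ge0.
  have : 4 / k0%:R <= 1 / 2 :> R.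
    rewrite ler_pdivrMr//; have : 8 <= k0%:R :> R by rewrite ler_nat leq_maxl.
    lra.
  lra.
apply: (@le_lt_trans _ _ (1 / 2)%:E); last by rewrite lte_fin; lra.
apply: le_trans Uhalf; apply: le_measure; rewrite ?inE//.
- exact: measurable_confined_io.
- exact: bigcupT_measurable.
move=> w /(_ (2 ^ k0.+1)%N)[q [nq qP]]; rewrite addr0 in qP.
rewrite natrX in nq.
have qe : expR (expR 1) <= ratr q := le_trans (k0e _ (leqnSn _)) nq.
have ex : exists m, (ratr q : R) <= 2 ^+ m.
  exists (Num.truncn (ratr q : R)).+1; rewrite (le_trans (ltW (truncnS_gt _)))// -natrX ler_nat.
  exact: ltnW (ltn_expl _ (ltnSn 1)).
case: (ex_minnP ex) => m qm mmin.
have km : (k0 < m)%N.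
  rewrite ltnNge; apply/negP => mk.
  have := le_trans nq qm; rewrite ler_eXn2l ?ltr1n// => h.
  by have := leq_trans h mk; rewrite ltnn.
case: m km qm mmin => // k; rewrite ltnS => kk qm mmin.
have kq : 2 ^+ k < (ratr q : R).
  by rewrite ltNge; apply/negP => /mmin; rewrite ltnn.
exists (k - k0).+1 => //; rewrite /U big_ord_recr /=; right.
rewrite subnKC// => -[s /andP[s0 sk] Es].
rewrite add0r in sk.
have [q' /andP[sq' q'q]] := rat_window s0 (le_lt_trans sk kq) (@open_esc _ _ M_balls x0 _) Es.
rewrite -near_setC; apply.
have := qP q'; rewrite (le_lt_trans s0 sq') (ltW q'q) => /(_ isT).
rewrite /near_set /= => /le_trans; apply; rewrite lee_fin ler_pM2l ?invr_gt0//.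
exact: chung_rate_le.
Qed.

End lower.

(** * At large levels the probability is positive *)

Section upper.
Context {R : realType} {M : pmetricType R} {d : measure_display}
  {Omega : measurableType d}.
Variables (mu : {measure set (borel M) -> \bar R}) (V phi : R -> R).
Variable (X : hunt_process M Omega).
Local Notation P := (hP X).
Hypothesis M_balls : forall (x : M) (r : R), precompact (ball x r).
Hypotheses (VS : weak_scaling V) (phiS : weak_scaling phi).
Variables (Cstar Ct Cl : R).
Hypotheses (Cstar1 : 1 <= Cstar) (mu_ball : volume_comparable mu V Cstar).
Hypotheses (Ct0 : 0 < Ct) (tail : tail_bound phi X Ct).
Hypotheses (Cl0 : 0 < Cl) (lowb : lower_bound mu V phi X Cl).
Hypothesis cons : forall (x : M) (t : R), 0 <= t -> P (Some x) (hX X t @^-1` [set None]) = 0%E.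
Local Notation rho := (chung_rate phi).

Section successive_trials.
Variables (x : opc M) (x0 : M) (tau r : nat -> R) (p dl : R).
Hypotheses (tau0 : forall j, 0 < tau j) (r0 : forall j, 0 < r j).
Hypothesis tau_nd : forall j, tau j <= tau j.+1.
Hypotheses (p01 : 0 <= p <= 1) (dl0 : 0 <= dl).
Hypothesis escaped : forall j, (P x (hit X 0 (tau j) (esc x0 (r j))) <= dl%:E)%E.
Hypothesis trial : forall j L, hF X (tau j) L -> L `<=` hX X (tau j) @^-1` near_set x0 (r j) ->
  exists L', [/\ hF X (tau j.+1) L', L' `<=` L,
    L' `<=` ~` hit X (tau j) (tau j.+1 - tau j) (esc x0 (5 * r j)) & (p%:E * P x L <= P x L')%E].

(** A trial can begin only if the path has not yet left radius [r j], which fails with probability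
    at most [dl]. These errors do not add up: with [a] the probability of failure so far, the next
    one is at most [(1 - p) * a + p * dl], a contraction towards [dl]. The Markov property replaces
    independence. *)
Lemma all_trials_fail_le j : exists S, [/\ hF X (tau j) S,
  forall w, ~ S w -> exists2 i, (i < j)%N & forall s, 0 <= s <= tau i.+1 -> near_set x0 (5 * r i) (hX X s w)
  & (P x S <= (dl + (1 - p) ^+ j)%:E)%E].
Proof.
case/andP: p01 => p0 p1.
have near5 i w s : near_set x0 (r i) (hX X s w) -> near_set x0 (5 * r i) (hX X s w).
  rewrite /near_set /= => /le_trans; apply; rewrite lee_fin ler_peMl// ?ler1n//.
  exact: ltW.
elim: j => [|j [S [hS cS PS]]].
  exists setT; split => //; first by apply: hF_T; exact: ltW.
    by move=> w /(_ I).
  by rewrite probability_setT expr0 lee_fin lerDr.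
have tj := ltW (tau0 j); have tj1 := ltW (tau0 j.+1).
have hH : hF X (tau j) (hit X 0 (tau j) (esc x0 (r j))).
  by have := hF_hit X (lexx 0) (tau0 j) (@open_esc _ _ M_balls x0 (r j)); rewrite add0r.
pose L := S `&` ~` hit X 0 (tau j) (esc x0 (r j)).
have hL : hF X (tau j) L by apply: hF_I => //; exact: hF_C.
have Ln w s : L w -> 0 <= s <= tau j -> near_set x0 (r j) (hX X s w).
  move=> [_ Hw] st; apply: contrapT => nN; apply: Hw; exists s; first by rewrite add0r.
  by rewrite -near_setC.
have [L' [hL' L'L L'n PL']] := trial hL (fun w Lw => Ln w _ Lw (introT andP (conj tj (lexx _)))).
have hS1 : hF X (tau j.+1) S by apply: hF_mono hS.
exists (S `\` L'); split; first exact: hF_D.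
- move=> w nS'; have [Sw|/cS[i ij iP]] := pselect (S w); last by exists i => //; exact: ltnW.
  exists j => // s /andP[s0 sj].
  have L'w : L' w by apply: contrapT => nL'; apply: nS'; split.
  have [st|ts] := leP s (tau j).
    by apply/near5/(Ln w); [exact: L'L|rewrite s0].
  apply: contrapT => nN; apply: (L'n w L'w); exists s; last by rewrite -near_setC.
  by rewrite (ltW ts) addrC subrK.
have mS := hF_meas tj hS; have mL := hF_meas tj hL; have mH := hF_meas tj hH.
have mL' := hF_meas tj1 hL'; have mS' : measurable (S `\` L') by exact: measurableD.
have e1 : (P x S <= P x L + dl%:E)%E.
  apply: (@le_trans _ _ (P x (L `|` hit X 0 (tau j) (esc x0 (r j))))).
    apply: le_measure; rewrite ?inE//; first exact: measurableU.
    by move=> w Sw; have [|] := pselect (hit X 0 (tau j) (esc x0 (r j)) w); [right|left].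
  by apply: le_trans (measureU2 _ mL mH) _; apply: leeD; [exact: lexx|exact: escaped].
have e2 : P x S = (P x (S `\` L') + P x L')%E.
  rewrite -measureU//; last by apply/seteqP; split => // w [[]].
  congr (P x _); apply/seteqP; split=> w.
    by move=> Sw; have [|] := pselect (L' w); [right|left].
  by case=> [[]//|/L'L[]].
move: e1 e2 PL' PS.
have f1 := fin_num_measure (P x) _ mS; have f2 := fin_num_measure (P x) _ mL.
have f3 := fin_num_measure (P x) _ mL'; have f4 := fin_num_measure (P x) _ mS'.
rewrite -(fineK f1) -(fineK f2) -(fineK f3) -(fineK f4).
set q1 := fine _; set q2 := fine _; set q3 := fine _; set q4 := fine _.
rewrite -!EFinD -EFinM !lee_fin => e1 [e2] e3 e4; rewrite exprS.
set pw := _ ^+ j in e4 *; have : (1 - p) * q1 <= (1 - p) * (dl + pw) by rewrite ler_wpM2l ?subr_ge0.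
have : p * q1 <= p * (q2 + dl) by rewrite ler_wpM2l.
lra.
Qed.

End successive_trials.

Lemma rate_dominates (A : R) : 0 < A -> exists2 b, 0 < b &
  forall r T, 0 < r -> A * phi r <= T -> 5 * r <= b * ginv phi T.
Proof.
move=> A0; have [l l1 lP] := scale_grow phiS (2 / A); have l0 := lt_trans ltr01 l1.
exists (5 * l); first by rewrite mulr_gt0.
move=> r T r0 AT; rewrite -mulrA ler_pM2l// -ler_pdivrMl//.
have lr : 0 < l^-1 * r by rewrite mulr_gt0// invr_gt0.
apply: (le_ginv phiS) => //; apply: lt_le_trans AT.
have := lP _ lr; rewrite mulVKf ?gt_eqF// => h.
have f0 := scale_gt0 phiS lr; set f := phi _ in h f0 *.
have : A * (2 / A * f) <= A * phi r by rewrite ler_pM2l.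
rewrite (_ : A * (2 / A * f) = 2 * f); last by field; rewrite gt_eqF.
lra.
Qed.

(* The time scales are powers of [h n] with exponents up to [2 * (3 * Q ^ n)]; this is
   where [ln ln t] enters: it is proportional to the length [n] of a trial. *)
Lemma lnln_horizon (c : R) (Q h : nat) : 0 < c -> (1 < Q)%N -> (0 < h)%N -> exists2 B, 0 < B &
  forall (n : nat) (y : R), (0 < n)%N -> expR (expR 1) <= y ->
    y <= c * n%:R * (h * n)%:R ^+ (2 * (3 * Q ^ n)) -> ln (ln y) <= B * n%:R.
Proof.
move=> c0 Q1 h0; pose D : R := Num.max 1 (c + 6 * h%:R) * Q%:R ^+ 2.
have m1 : 1 <= Num.max 1 (c + 6 * h%:R) :> R by rewrite le_max lexx.
have Q1R : 1 < Q%:R :> R by rewrite ltr1n.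
have D1 : 1 < D.
  by rewrite (lt_le_trans _ (ler_peMl _ m1)) ?exprn_ge0// exprn_egt1.
have D0 : 0 < D := lt_trans ltr01 D1.
exists (ln D); first by rewrite ln_gt0.
move=> n y n0 ye yP; have l1 := lnln_ge1 ye.
have y0 : 0 < y := lt_le_trans (expR_gt0 _) ye.
have n1 : 1 <= n%:R :> R by rewrite ler1n.
have nR : 0 < n%:R :> R by rewrite ltr0n.
have hn0 : 0 < (h * n)%:R :> R by rewrite ltr0n muln_gt0 h0.
have ly0 : 0 < ln y.
  rewrite (lt_le_trans ltr01)// -[leLHS]expRK ler_ln ?posrE ?expR_gt0// (le_trans _ ye)// ler_expR.
  by rewrite (le_trans _ (expR_ge1Dx 1))// lerDl.
rewrite mulrC mulr_natl -lnXn// ler_ln ?posrE ?exprn_gt0//.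
have cn : 0 < c * n%:R by rewrite mulr_gt0.
have lb : ln y <= c * n%:R + (2 * (3 * Q ^ n))%:R * (h * n)%:R.
  apply: (@le_trans _ _ (ln (c * n%:R * (h * n)%:R ^+ (2 * (3 * Q ^ n))))).
    by rewrite ler_ln ?posrE// mulr_gt0 ?exprn_gt0.
  rewrite lnM ?posrE ?exprn_gt0// lnXn// lerD//; first exact: ltW (ln_sublinear _).
  by rewrite -(mulr_natl (ln _)) ler_wpM2l//; exact: ltW (ln_sublinear _).
apply: (le_trans lb); rewrite !natrM natrX.
have qn : n%:R <= Q%:R ^+ n :> R.
  by rewrite -natrX ler_nat ltnW// ltn_expl.
have q1 : 1 <= Q%:R ^+ n :> R by rewrite exprn_ege1// ltW.
rewrite /D exprMn -exprM mulnC exprM expr2.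
set q := _ ^+ n in qn q1 *.
have h0R : 0 < h%:R :> R by rewrite ltr0n.
apply: (@le_trans _ _ ((c + 6 * h%:R) * (q * q))).
  have nq : n%:R <= q * q by rewrite (le_trans qn)// ler_peMr// (le_trans _ q1).
  have : c * n%:R <= c * (q * q) by rewrite ler_pM2l.
  have : q * n%:R <= q * q by rewrite ler_pM2l// (lt_le_trans ltr01).
  move=> h1; have : h%:R * (q * n%:R) <= h%:R * (q * q) by rewrite ler_pM2l.
  lra.
rewrite ler_pM2r; last by rewrite mulr_gt0// (lt_le_trans ltr01).
apply: (@le_trans _ _ (Num.max 1 (c + 6 * h%:R))); first by rewrite le_max lexx orbT.
by case: n n0 {qn q1 q n1 nR hn0 cn lb yP} => // n _; rewrite ler_eXnr.
Qed.

Let x0 : M := point.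

Definition confined_after (b : R) (m : nat) : set Omega :=
  [set w | exists q : rat, (m%:R <= ratr q :> R) /\
    forall s : rat, 0 < (ratr s : R) <= ratr q -> near_set x0 (b * rho (ratr q + 0)) (hX X (ratr s) w)].

Lemma measurable_confined_after b m : measurable (confined_after b m).
Proof.
suff : <<s cylinders X >> (confined_after b m) by move=> /path_markov[].
apply: cyl_exists_rat => q _; apply: cyl_forall_rat => s /andP[s0 _].
by apply: cyl_at; [exact: ltW|exact: measurable_near_set].
Qed.

(** The level [b] is fixed before [m]; only the length [n] of the trials depends on [m]. One of
    [3 * Q ^ n] trials, at scales separated by the ratio [h * n], succeeds with probability at least
    1/2. At a successful trial the elapsed time is of order [n * phi r] and its iterated logarithm
    at most of order [n], so [n] cancels in the rate. *)
Lemma confined_often : exists2 b, 0 < b & forall m : nat,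
  (P (Some x0) (~` confined_after b m) <= (1 / 2)%:E)%E.
Proof.
have [C C0 CP] := escape_le M_balls phiS Ct0 tail cons.
have [e e0 [k k0 kP]] := confined_ge M_balls VS phiS Cstar1 mu_ball Ct0 tail Cl0 lowb cons.
have [K K0 KP] := scale_ginv phiS.
(* An integer above [1 / k]: a trial succeeds with probability at least [Q ^- n], and [3 * Q ^ n]
   trials make the expected number of successes exactly 3 in [one_sub_expr_le]. *)
pose Q := (Num.truncn k^-1).+2; have Q1 : (1 < Q)%N by [].
have Qk : Q%:R^-1 <= k.
  rewrite -[leRHS]invrK lef_pV2 ?posrE ?invr_gt0// ?ltr0n//.
  by rewrite (le_trans (ltW (truncnS_gt _)))// ler_nat.
(* Large enough that leaving radius [r j] before trial [j] has probability at most 1/4; at least 2,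
   so that the earlier trials sum geometrically. *)
pose h := (Num.truncn (8 * C * e * K ^+ 2)).+2; have h2 : (1 < h)%N by [].
have hP : 8 * C * e * K ^+ 2 <= h%:R.
  by rewrite (le_trans (ltW (truncnS_gt _)))// ler_nat.
have c0 : 0 < e / 2 * K by rewrite mulr_gt0// divr_gt0.
have [B B0 BP] := lnln_horizon c0 Q1 (ltnW h2).
have A0 : 0 < e / (2 * B) by rewrite divr_gt0// mulr_gt0.
have [b b0 bP] := rate_dominates A0; exists b => // m.
pose y0 : R := Num.max (expR (expR 1)) m%:R.
(* Long trials, so that already half of one exceeds both [m] and the threshold of the iterated
   logarithm. *)
pose n := (Num.truncn (2 * K / e * y0)).+1; have n0 : (0 < n)%N by [].
have nR : 0 < n%:R :> R by rewrite ltr0n.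
have ny : y0 <= e * n%:R / (2 * K).
  rewrite ler_pdivlMr ?mulr_gt0// -ler_pdivrMl// (le_trans _ (ltW (truncnS_gt _)))//.
  by rewrite le_eqVlt; apply/orP; left; apply/eqP; field; rewrite gt_eqF.
have [N NE] : exists N, N = (3 * Q ^ n)%N by exists (3 * Q ^ n)%N.
have [H HE] : exists H : R, H = (h * n)%:R by exists (h * n)%:R.
have H2 : 2 <= H by rewrite HE ler_nat (leq_trans h2)// leq_pmulr.
have H0 : 0 < H by rewrite (lt_le_trans _ H2).
pose T j := H ^+ (N + j); have T0 j : 0 < T j by exact: exprn_gt0.
have T1 j : 1 <= T j by rewrite exprn_ege1// (le_trans _ H2)// ler1n.
pose r j := ginv phi (T j); have r0 j : 0 < r j := ginv_gt0 phiS (T0 j).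
pose sg j := e * phi (r j) * n%:R.
have sg0 j : 0 < sg j by rewrite /sg !mulr_gt0// scale_gt0.
(* Trials follow one another without pause. The initial time is chosen so that [tau_le] holds with
   equality at 0; that bound says that all trials before [j] take a time small compared with
   [T j]. *)
pose tau := fix tau j := if j is i.+1 then tau i + sg i else 2 * e * n%:R * K * T 0%N / H.
have tauS j : tau j.+1 = tau j + sg j by [].
have tau0 j : 0 < tau j.
  elim: j => [|j IH]; last by rewrite tauS addr_gt0.
  by rewrite /= divr_gt0// !mulr_gt0.
have tau_le j : tau j <= 2 * e * n%:R * K * T j / H.
  elim: j => [|j IH]; first by [].
  have TS : T j.+1 = H * T j by rewrite /T addnS exprS.
  have [sgT _] := KP _ (T0 j).
  have : sg j <= e * n%:R * K * T j.
    by rewrite /sg mulrAC -[leRHS]mulrA ler_pM2l ?mulr_gt0.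
  rewrite tauS TS (_ : 2 * e * n%:R * K * (H * T j) / H = 2 * (e * n%:R * K * T j)); last first.
    by field; rewrite gt_eqF.
  have : 2 * e * n%:R * K * T j / H <= e * n%:R * K * T j.
    rewrite ler_pdivrMr//; have u0 : 0 < e * n%:R * K * T j by rewrite !mulr_gt0.
    have : e * n%:R * K * T j * 2 <= e * n%:R * K * T j * H by rewrite ler_pM2l.
    lra.
  lra.
have [|||||S [hS cS PS]] := @all_trials_fail_le (Some x0) x0 tau r (Q%:R^-1 ^+ n) (1 / 4) tau0 r0 _ _ _ _ _ N.
- by move=> j; rewrite tauS lerDl ltW.
- by rewrite exprn_ge0 ?invr_ge0//= exprn_ile1// ?invr_ge0// invf_le1 ?ler1n ?ltr0n.
- by lra.
- move=> j; apply: (le_trans (CP _ _ _ (tau0 j) (r0 j))); rewrite lee_fin.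
  have [_ Tp] := KP _ (T0 j); have pr := scale_gt0 phiS (r0 j); rewrite -/(r j) in Tp.
  rewrite mulrA ler_pdivrMr//.
  have h3 : C * tau j <= C * (2 * e * n%:R * K * T j / H) by rewrite ler_pM2l.
  apply: (le_trans h3); set f := phi _ in pr Tp *.
  have h4 : C * (2 * e * n%:R * K * T j / H) <= C * (2 * e * n%:R * K * (K * f) / H).
    by rewrite ler_pM2l// ler_pM2r ?invr_gt0// ler_pM2l// !mulr_gt0.
  apply: (le_trans h4); rewrite HE natrM.
  have h0R : 0 < h%:R :> R by rewrite ltr0n.
  rewrite (_ : C * _ = (8 * C * e * K ^+ 2) / h%:R * (1 / 4 * f)); last by field; rewrite !gt_eqF.
  by rewrite ler_piMl ?mulr_ge0 ?(ltW pr)// ler_pdivrMr// mul1r.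
- move=> j L hL Ln; have [L' [a1 a2 a3 a4]] := kP (Some x0) x0 (r j) (tau j) L n (r0 j) (ltW (tau0 j)) hL Ln.
  exists L'; split => //; first by rewrite tauS addrC addKr.
  apply: le_trans a4; apply: lee_wpmul2r => //; rewrite lee_fin lerXn2r ?nnegrE ?invr_ge0//.
  exact: ltW.
have mS := hF_meas (ltW (tau0 N)) hS.
have PS2 : (P (Some x0) S <= (1 / 2)%:E)%E.
  apply: (le_trans PS); rewrite lee_fin.
  have : (1 - Q%:R^-1 ^+ n) ^+ N <= 1 / 4 :> R.
    apply: one_sub_expr_le.
      by rewrite exprn_ge0 ?invr_ge0//= exprn_ile1// ?invr_ge0// invf_le1 ?ler1n ?ltr0n.
    rewrite NE natrM natrX -mulrA -exprMn divff ?expr1n ?mulr1//.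
    by rewrite pnatr_eq0.
  by move: (_ ^+ N) => z hz; lra.
apply: le_trans PS2; apply: le_measure; rewrite ?inE//.
  by apply: measurableC; exact: measurable_confined_after.
move=> w; apply: contra_notP => /cS[i iN iP].
(* Half the length of the successful trial lies strictly before its end, which leaves room for a
   rational time. *)
pose y := sg i / 2.
have yT : tau i.+1 > y.
  rewrite tauS (lt_le_trans (_ : y < sg i))// ?lerDr ?(ltW (tau0 i))//.
  by rewrite /y ltr_pdivrMr// ltr_pMr// ltr1n.
have [up lo] := KP _ (T0 i); rewrite -/(r i) in up lo.
have yE : y = e / 2 * n%:R * phi (r i) by rewrite /y /sg; field.
have yy : y0 <= y.
  apply: (le_trans ny); rewrite yE.
  have : 1 <= K * phi (r i) := le_trans (T1 i) lo.
  set f := phi _ => Kf.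
  rewrite (_ : e / 2 * n%:R * f = e * n%:R / (2 * K) * (K * f)); last by field; rewrite gt_eqF.
  by rewrite ler_peMr// divr_ge0 ?mulr_ge0 ?ltW.
move: (yy); rewrite ge_max => /andP[ye ym].
have [q] := rat_in_itvoo yT; rewrite in_itv/= => /andP[yq qt].
exists q; split; first by rewrite (le_trans ym)// ltW.
move=> s /andP[s0 sq]; have := iP (ratr s).
rewrite (ltW s0) (le_trans sq (ltW qt)) => /(_ isT).
rewrite /near_set /= => /le_trans; apply; rewrite lee_fin addr0.
apply: (@le_trans _ _ (b * rho y)); last first.
  by rewrite ler_pM2l//; apply: chung_rate_le => //; exact: ltW.
apply: bP => //; rewrite /lnln_clock ler_pdivlMr; last first.
  by rewrite (lt_le_trans ltr01)// lnln_ge1.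
have lB : ln (ln y) <= B * n%:R.
  apply: BP => //; rewrite yE -NE.
  have pT : phi (r i) <= K * H ^+ (2 * N).
    apply: (le_trans up); rewrite ler_pM2l// ler_eXn2l; last by rewrite (lt_le_trans _ H2)// ltr1n.
    by rewrite mul2n -addnn leq_add2l ltnW.
  rewrite (_ : e / 2 * K * n%:R * _ = e / 2 * n%:R * (K * H ^+ (2 * N))); last by rewrite HE; ring.
  by rewrite ler_pM2l// mulr_gt0// divr_gt0.
have f0 := scale_gt0 phiS (r0 i).
have : e / (2 * B) * phi (r i) * ln (ln y) <= e / (2 * B) * phi (r i) * (B * n%:R).
  by rewrite ler_pM2l// mulr_gt0.
move=> /le_trans; apply; rewrite yE.
by rewrite le_eqVlt; apply/orP; left; apply/eqP; field; rewrite gt_eqF.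
Qed.

(** The complement is an increasing union over [m] of events of probability at most 1/2, so the
    uniform bound passes to the limit. *)
Lemma confined_io_gt0 : exists2 b, 0 < b & (0 < P (Some x0) (confined_io X rho b 0))%E.
Proof.
have [b b0 bP] := confined_often; exists b => //.
have mio := measurable_confined_io phi X M_balls b.
have : (P (Some x0) (~` confined_io X rho b 0) <= (1 / 2)%:E)%E.
  rewrite (_ : ~` _ = \bigcup_m ~` confined_after b m).
    apply: nondecreasing_bigcup_bound => //.
    - by move=> m; apply: measurableC; exact: measurable_confined_after.
    - move=> m m' mm; apply/subsetPset => w; apply: contra_not => -[q [mq qP]].
      by exists q; split => //; rewrite (le_trans _ mq)// ler_nat.
  by rewrite -setC_bigcap; congr (~` _); apply/seteqP; split=> w /= => [h n _|h n]; exact: h.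
rewrite probability_setC// => h; rewrite lt0e measure_ge0 andbT; apply/eqP => z.
by move: h; rewrite z sube0 lee_fin; lra.
Qed.

End upper.

(** * Monotonicity in the level and the critical value *)

Lemma confined_io_le {R : realType} {M : pmetricType R} {d : measure_display}
    {Omega : measurableType d} (X : hunt_process M Omega) (rho : R -> R) (b b' : R) :
  (forall B : R, exists T : R, forall t, T < t -> B <= rho t) -> b <= b' ->
  confined_io X rho b 0 `<=` confined_io X rho b' 0.
Proof.
move=> rho_infty bb w io n; have [T TP] := rho_infty 0.
have [q [nq qP]] := io (maxn n (Num.truncn T).+1); exists q.
split=> [|s sq]; first by rewrite (le_trans _ nq)// ler_nat leq_maxl.
have := qP s sq; rewrite /near_set /= => /le_trans; apply; rewrite lee_fin ler_wpM2r//.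
apply: TP; rewrite addr0 (lt_le_trans (truncnS_gt T))// (le_trans _ nq)// ler_nat leq_maxr//.
Qed.

Theorem theorem3p8 (R : realType) (M : pmetricType R)
    (M_lc : locally_compact [set: M])
    (M_sep : separable M)
    (M_conn : connected [set: M])
    (M_balls : forall (x : M) (r : R), precompact (ball x r))
    (mu : {measure set (borel M) -> \bar R})
    (mu_radon : radon_on (measurable : set (set (borel M))) mu [set: M])
    (mu_supp : full_support (T := M) mu)
    (V phi : R -> R)
    (V_incr : pos_increasing V) (V0 : V 0 = 0)
    (Voo : V r @[r --> +oo] --> +oo)
    (phi_incr : pos_increasing phi)
    (Cstar : R) (Cstar1 : 1 <= Cstar)
    (mu_ball : forall (x : M) (r : R), 0 < r ->
      ((Cstar^-1 * V r)%:E <= mu (ball x r) /\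
       mu (ball x r) <= (Cstar * V r)%:E)%E)
    (c1 c2 c3 c4 d1 d2 d3 d4 : R)
    (c1_gt0 : 0 < c1) (c2_gt0 : 0 < c2) (c3_gt0 : 0 < c3) (c4_gt0 : 0 < c4)
    (d1_gt0 : 0 < d1) (d12 : d1 <= d2) (d3_gt0 : 0 < d3) (d4_gt0 : 0 < d4)
    (V_scaling : scaling V c1 c2 d1 d2)
    (phi_scaling : scaling phi c3 c4 d3 d4)
    (F : set (M -> R)) (E : (M -> R) -> (M -> R) -> R)
    (EF_dirichlet : dirichlet_form mu F E)
    (EF_regular : regular_form mu F E)
    (EF_jump : pure_jump F E)
    (d : measure_display) (Omega : measurableType d)
    (X : hunt_process M Omega)
    (X_assoc : associated mu X F E)
    (p : R -> M -> M -> R)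
    (p_hk : heat_kernel mu X p)
    (C1 C2 : R) (C1_gt0 : 0 < C1) (C2_gt0 : 0 < C2)
    (p_bounds : forall (t : R) (x : M), 0 < t ->
      {ae mu, forall y : M,
         C1 * hk_profile V phi t (mdist x y) <= p t x y <=
         C2 * hk_profile V phi t (mdist x y)}) :
  exists2 c : R, 0 < c & forall x : M,
    {ae hP X (Some x), forall w,
       limf_einf (fun t : R =>
         running_max X x t w * ((ginv phi (t / ln (ln t)))^-1)%:E)%E
         (pinfty_nbhs R) = c%:E}.
Proof.
have VS : weak_scaling V.
  by split => //; exists c1, c2, d1, d2; split.
have phiS : weak_scaling phi.
  by split => //; exists c3, c4, d3, d4; split.
have mu_fin (x : M) (r : R) : 0 < r -> (mu (ball x r) < +oo)%E.
  by move=> r0; apply: le_lt_trans (mu_ball x r r0).2 _; rewrite ltry.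
have ondiag := hk_on_diag_bound VS phiS p_hk C2_gt0 p_bounds.
have lowb := hk_lower_bound VS phiS p_hk C1_gt0 p_bounds.
have [Ct Ct0 tail] := hk_tail_bound VS phiS Cstar1 mu_ball p_hk C2_gt0 p_bounds.
have [cs cs0 surv] := survival_lb VS phiS Cstar1 mu_ball C1_gt0 lowb.
have cons := conservative M_balls EF_dirichlet EF_regular EF_jump X_assoc mu_fin phiS
  cs0 surv Ct0 tail ondiag.
pose rho := chung_rate phi; have rho_infty := chung_rate_infty phiS.
have zo (b : R) (b0 : 0 < b) := zero_one M_balls VS phiS Cstar1 mu_ball Ct0 tail C1_gt0 lowb
  cons rho_infty b0.
have [a a0 aP] := confined_io_lt1 M_balls VS phiS Cstar1 mu_ball C2_gt0 ondiag.
have [b b0 bP] := confined_io_gt0 M_balls VS phiS Cstar1 mu_ball Ct0 tail C1_gt0 lowb cons.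
have mono (s t : R) (z : opc M) : s <= t ->
    (hP X z (confined_io X rho s 0) <= hP X z (confined_io X rho t 0))%E.
  move=> st; apply: le_measure; rewrite ?inE; try exact: measurable_confined_io.
  exact: confined_io_le.
pose x0 : M := point.
(* Levels of probability 1, tested at one starting point only, since the zero-one alternative is
   common to all of them. *)
pose S := [set s : R | 0 < s /\ hP X (Some x0) (confined_io X rho s 0) = 1%E].
have Sb : S b.
  by split => //; have [z|//] := zo _ b0; move: bP; rewrite z ltxx.
have lbS : lbound S a.
  move=> s [s0 s1]; rewrite leNgt; apply/negP => /ltW/(mono _ _ (Some x0)).
  by rewrite s1 => /le_lt_trans /(_ (aP (Some x0))); rewrite ltxx.
pose c := inf S.
have c0 : 0 < c by rewrite (lt_le_trans a0)//; apply: lb_le_inf => //; exists b.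
have hi (s : R) (x : M) : c < s -> hP X (Some x) (confined_io X rho s 0) = 1%E.
  move=> cs1; have s0 := lt_trans c0 cs1.
  have [s' [s'0 s'1] s's] : exists2 s', S s' & s' < s by apply: inf_lt => //; exists b.
  have [z|//] := zo _ s0.
  have := mono _ _ (Some x0) (ltW s's); rewrite s'1 z => h.
  by move: h; rewrite lee_fin ler10.
have lo (s : R) (x : M) : 0 < s -> s < c -> hP X (Some x) (confined_io X rho s 0) = 0%E.
  move=> s0 sc; have [//|o] := zo _ s0.
  have : c <= s by apply: ge_inf; [exists a|split].
  by rewrite leNgt sc.
exists c => // x.
(* The index [n.+2] keeps the lower levels positive already at [n = 0]. *)
have n2 (n : nat) : 0 < 1 - n.+2%:R^-1 :> R.
  by rewrite subr_gt0 invf_lt1// ltr1n.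
have : {ae hP X (Some x), forall w, forall n : nat, confined_io X rho (c + n.+1%:R^-1) 0 w /\
    ~ confined_io X rho (c * (1 - n.+2%:R^-1)) 0 w}.
  apply: ae_foralln => n.
  have m1 : measurable (confined_io X rho (c + n.+1%:R^-1) 0) by exact: measurable_confined_io.
  have m2 : measurable (confined_io X rho (c * (1 - n.+2%:R^-1)) 0) by exact: measurable_confined_io.
  exists (~` confined_io X rho (c + n.+1%:R^-1) 0 `|` confined_io X rho (c * (1 - n.+2%:R^-1)) 0); split.
  - by apply: measurableU => //; exact: measurableC.
  - apply/eqP; rewrite eq_le measure_ge0 andbT.
    apply: le_trans (measureU2 _ (measurableC m1) m2) _.
    have p1 : hP X (Some x) (~` confined_io X rho (c + n.+1%:R^-1) 0) = 0%E.
      by rewrite probability_setC// hi ?subee// ltrDl invr_gt0.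
    have p2 : hP X (Some x) (confined_io X rho (c * (1 - n.+2%:R^-1)) 0) = 0%E.
      by apply: lo; rewrite ?mulr_gt0// gtr_pMr// ltrBlDr ltrDl invr_gt0.
    rewrite -[leRHS]adde0; apply: leeD.
      by move/eqP : p1; rewrite eq_le => /andP[].
    by move/eqP : p2; rewrite eq_le => /andP[].
  - move=> w /= nw; have [i1|] := pselect (confined_io X rho (c + n.+1%:R^-1) 0 w); last by left.
    by right; apply: contrapT => i2; apply: nw.
move=> h; move: (h); apply: (@filterS _ _ (ae_filter_ringOfSetsType (hP X (Some x)))) => w wP.
apply/eqP; rewrite eq_le; apply/andP; split; apply/lee_addgt0Pr => e e0.
  have [n _ /(_ n (leqnn n)) /= ne] := near_infty_natSinv_lt (PosNum e0).
  have cn : 0 < c + n.+1%:R^-1 by rewrite addr_gt0.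
  rewrite -EFinD; apply: (limf_einf_le M_balls rho_infty x cn _ (wP n).1).
  by rewrite ltrD2l.
have ec : 0 < e / c by rewrite divr_gt0.
have [n _ /(_ n (leqnn n)) /= ne] := near_infty_natSinv_lt (PosNum ec).
have ne2 : c * n.+2%:R^-1 < e.
  rewrite mulrC -ltr_pdivlMr// (le_lt_trans _ ne)// lef_pV2 ?posrE// ler_nat//.
pose s := c * (1 - n.+2%:R^-1); have s0 : 0 < s by rewrite mulr_gt0.
have cs1 : c - e < s by rewrite /s mulrBr mulr1 ltrD2l ltrN2.
(* [limf_einf_ge] needs a positive level, while [c - e] may be negative. *)
pose s' := Num.max (c - e) (s / 2).
have s's : s' < s by rewrite gt_max cs1/= ltr_pdivrMr// ltr_pMr// ltr1n.
have s'0 : 0 < s' by rewrite lt_max divr_gt0 ?orbT.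
have L := limf_einf_ge rho_infty x (fun s t se st => chung_rate_le phiS se st) s'0 s's (wP n).2.
apply: le_trans (leeD2r e%:E L).
by rewrite -EFinD lee_fin -lerBlDr le_max lexx.
Qed.
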